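(* Let $\Omega\subset\mathbb C$ be a domain and let $h\in\mathscr W^{1,2}(\Omega)$ be a mapping with nonnegative Jacobian, $J_h=|h_z|^2-|h_{\bar z}|^2\ge0$ a.e. in $\Omega$. Suppose that the Hopf product $h_z\,\overline{h_{\bar z}}$ is bounded and Hölder continuous in $\Omega$. Then $h$ is locally Lipschitz in $\Omega$. However, $h$ is not necessarily $\mathscr C^1$-smooth: there exist a domain $\Omega$ and a mapping $h\in\mathscr W^{1,2}(\Omega)$ with nonnegative Jacobian whose Hopf product $h_z\,\overline{h_{\bar z}}$ is bounded and Hölder continuous, but $h\notin\mathscr C^1(\Omega)$.
   Context: $\mathscr W^{1,2}(\Omega)$ is the Sobolev space of complex-valued functions in $\mathscr L^2(\Omega)$ with weak first derivatives in $\mathscr L^2(\Omega)$; functions are identified when equal a.e., so regularity statements about $h$ or about $h_z\overline{h_{\bar z}}$ refer to suitable representatives. $h_z=\partial h/\partial z$ and $h_{\bar z}=\partial h/\partial\bar z$ are the complex (weak) partial derivatives. *)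

(* Defs.v *)
From HB Require Import structures.
From mathcomp Require Import all_boot all_order all_algebra complex.
From mathcomp Require Import all_classical all_reals all_analysis.

Set Implicit Arguments.
Unset Strict Implicit.
Unset Printing Implicit Defensive.

Import Order.TTheory GRing.Theory Num.Theory.
Import numFieldNormedType.Exports.

Local Open Scope classical_set_scope.
Local Open Scope ring_scope.

(* R[i] carries the topology of its modulus only once it is presented as a
   numFieldType. *)
Definition C (R : realType) : numClosedFieldType := R[i]%C.

Section Plane.
Context {R : realType}.
Implicit Types (Omega : set (C R)) (f g h hx hy : C R -> C R).

(* Real differentiation and Lebesgue measure live on R * R, which is identified
   with C R through toC; the differential structure of C R itself is the complex
   one. *)
Definition toC (p : R * R) : C R := (p.1 +i* p.2)%C.

Definition plane Omega : set (R * R) := toC @^-1` Omega.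

Definition reC f (p : R * R) : R := complex.Re (f (toC p) : R[i]%C).
Definition imC f (p : R * R) : R := complex.Im (f (toC p) : R[i]%C).

(* The modulus with values in R; the norm `|z| of C R has values in C R. *)
Definition cmod (z : C R) : R := complex.Re (`|z| : R[i]%C).

Local Notation mu2 := ((@lebesgue_measure R) \x (@lebesgue_measure R))%E.

Definition ae_in Omega (P : C R -> Prop) : Prop :=
  {ae mu2, forall p : R * R, plane Omega p -> P (toC p)}.

Definition ae_eq_in Omega f g : Prop := ae_in Omega (fun z => f z = g z).

Definition domain Omega : Prop :=
  [/\ Omega !=set0, open Omega & connected Omega].

Definition L2 Omega f : Prop :=
  [/\ measurable_fun (plane Omega) (reC f),
      measurable_fun (plane Omega) (imC f) &
      (\int[mu2]_(p in plane Omega) (cmod (f (toC p)) ^+ 2)%:E < +oo)%E].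

(* u is of class C^k on the open set D. *)
Fixpoint Ck (k : nat) (D : set (R * R)) (u : R * R -> R) : Prop :=
  (forall p, D p -> {for p, continuous u}) /\
  if k is k'.+1 then
    forall v : R * R, v = (1, 0) \/ v = (0, 1) ->
      (forall p, D p -> derivable u p v) /\ Ck k' D ('D_v u)
  else True.

Definition test_function (D : set (R * R)) (phi : R * R -> R) : Prop :=
  (forall k, Ck k setT phi) /\
  exists K, [/\ compact K, K `<=` D & forall p, ~ K p -> phi p = 0].

(* g is the weak derivative of u on D in the direction v. The integrals are
   meaningful for locally integrable u and g; below u and g are square
   integrable on D. *)
Definition weak_deriv (v : R * R) (D : set (R * R)) (u g : R * R -> R) : Prop :=
  forall phi, test_function D phi ->
    \int[mu2]_(p in D) (u p * 'D_v phi p) = - \int[mu2]_(p in D) (g p * phi p).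

(* h belongs to W^{1,2}(Omega) and hx, hy are its weak partial derivatives with
   respect to x and y; these are determined by h up to a null set. *)
Definition W12 Omega h hx hy : Prop :=
  [/\ L2 Omega h, L2 Omega hx, L2 Omega hy,
      weak_deriv (1, 0) (plane Omega) (reC h) (reC hx) /\
      weak_deriv (1, 0) (plane Omega) (imC h) (imC hx) &
      weak_deriv (0, 1) (plane Omega) (reC h) (reC hy) /\
      weak_deriv (0, 1) (plane Omega) (imC h) (imC hy)].

Definition d_z hx hy (z : C R) : C R := (hx z - 'i%C * hy z) / 2.
Definition d_zbar hx hy (z : C R) : C R := (hx z + 'i%C * hy z) / 2.

Definition jacobian_det hx hy (z : C R) : R :=
  cmod (d_z hx hy z) ^+ 2 - cmod (d_zbar hx hy z) ^+ 2.

Definition hopf hx hy (z : C R) : C R := d_z hx hy z * (d_zbar hx hy z)^*.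

Definition hoelder_in Omega f : Prop :=
  exists alpha L : R, [/\ 0 < alpha, alpha <= 1 &
    forall z w, Omega z -> Omega w ->
      cmod (f z - f w) <= L * cmod (z - w) `^ alpha].

Definition locally_lipschitz Omega f : Prop :=
  forall z, Omega z ->
    exists2 U, nbhs z U & [lipschitz f w | w in U `&` Omega].

Definition C1 Omega f : Prop :=
  Ck 1 (plane Omega) (reC f) /\ Ck 1 (plane Omega) (imC f).

End Plane.

(* Main.v *)
Require Import Defs.
From HB Require Import structures.
From mathcomp Require Import all_boot all_order all_algebra complex.
From mathcomp Require Import all_classical all_reals all_analysis.
From mathcomp Require finmap.
From mathcomp Require Import measurable_realfun ring lra.

(* Put a = 2 h_z, b = 2 h_zbar and phi = a b^*, four times the Hopf product.
   Since |b| <= |a|, |b|^2 <= |phi| is bounded. Let P be the difference of two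
   radial mollifiers. The weak derivatives of h satisfy a * P = b * S for a
   complex kernel S of mean zero that acts on L^2 with the same norm as P, so the
   L^2 oscillation of a on a ball is controlled by that of b on a larger ball.
   Conversely, let A be an average of a at a point z and c the number with
   c A^* = phi(z)^*; then (b - c) A^* = b (A - a)^* + (phi - phi(z))^*, so that,
   up to a Hoelder error, b oscillates much less than a as soon as |A| is large.
   Along geometric scales the averages therefore can only increase by a summable
   amount once they are large, and the mean of |Dh|^2 over a ball is bounded
   uniformly in the scale and locally uniformly in the centre. This makes the
   mollifications of h equi-Lipschitz and geometrically convergent, and their
   limit is the Lipschitz representative.

   The map z |-> |Re z| has constant Hopf product 1/4 and vanishing Jacobian. *)

Import Order.TTheory GRing.Theory Num.Theory.
Import numFieldNormedType.Exports.

Local Open Scope classical_set_scope.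
Local Open Scope ring_scope.

Set Implicit Arguments.
Unset Strict Implicit.
Unset Printing Implicit Defensive.

(** * Integrals over the plane *)

Section integration.
Context {R : realType}.
Local Notation mu2 := ((@lebesgue_measure R) \x (@lebesgue_measure R))%E.
Implicit Types (f g u v : R * R -> R).

(** The system says that h_z is the image of h_zbar under the Beurling transform, whose L^2 bound
    usually comes from Plancherel. Only truncations of it occur here. For a radial profile q,
    constant multiples of 1/t being cancelled far out, the field w = d q(|d|^2) is a gradient with
    compact support; two integrations by parts show that P = w_z and S have equal autocorrelations,
    hence equal L^2 action. As P is a difference of mollifiers at scales e <= t, the bounds are
    uniform in e, and e may tend to 0. The obstacle is that phi determines b from a only where a is
    not small, so the excess of a (its mean square deviation from an average) is not known to decay
    at every scale. Decay is obtained only where the average is large; elsewhere one change of scale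
    moves the average by a bounded amount. A potential combining the size of the average with the
    square root of the excess turns this dichotomy into a bound. The ratio x of the scales is fixed
    by the smooth part: its square deviation, integrated over the smaller square, is of order x^4,
    against an area of order x^2, and the factor x^2 left over absorbs the constants. *)

#[global] Instance ae_mu2_filter : Filter (nbhs (almost_everywhere mu2)).
Proof.
exact: (@ae_filter_ringOfSetsType _ (measurableTypeR R * measurableTypeR R)%type R mu2).
Qed.

Definition pint f : R := \int[mu2]_p f p.

Definition pintegrable f : Prop := mu2.-integrable setT (EFin \o f).

Lemma pintegrable_measurable f : pintegrable f -> measurable_fun setT f.
Proof. by move=> /measurable_int /measurable_EFinP. Qed.

Lemma pintegrable_le f g : measurable_fun setT f -> pintegrable g ->
  (forall p, `|f p| <= g p) -> pintegrable f.
Proof.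
move=> mf ig fg; apply: (le_integrable _ _ _ ig) => //.
  exact/measurable_EFinP.
by move=> p _ /=; rewrite lee_fin (le_trans (fg p)) ?ler_norm.
Qed.

Lemma pintegrableD f g : pintegrable f -> pintegrable g ->
  pintegrable (fun p => f p + g p).
Proof. by move=> fi gi; exact: (integrableD _ fi gi). Qed.

Lemma pintegrableZ c f : pintegrable f -> pintegrable (fun p => c * f p).
Proof. by move=> fi; exact: (integrableZl _ c fi). Qed.

Lemma pintegrableB f g : pintegrable f -> pintegrable g ->
  pintegrable (fun p => f p - g p).
Proof. by move=> fi gi; exact: (integrableB _ fi gi). Qed.

Lemma pintegrable_norm f : pintegrable f -> pintegrable (fun p => `|f p|).
Proof. by move=> fi; exact: (integrable_norm fi). Qed.

Lemma pintegrable0 : pintegrable (fun=> 0).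
Proof. exact: integrable0. Qed.

Lemma pint_ext f g : f =1 g -> pint f = pint g.
Proof. by move=> /funext->. Qed.

Lemma pintD f g : pintegrable f -> pintegrable g ->
  pint (fun p => f p + g p) = pint f + pint g.
Proof. by move=> ? ?; rewrite /pint RintegralD. Qed.

Lemma pintB f g : pintegrable f -> pintegrable g ->
  pint (fun p => f p - g p) = pint f - pint g.
Proof. by move=> ? ?; rewrite /pint RintegralB. Qed.

Lemma pintZ c f : pintegrable f -> pint (fun p => c * f p) = c * pint f.
Proof. by move=> ?; rewrite /pint RintegralZl. Qed.

Lemma pintN f : pintegrable f -> pint (fun p => - f p) = - pint f.
Proof.
move=> fi; rewrite -mulN1r -pintZ//; apply: pint_ext => p; by rewrite mulN1r.
Qed.

Lemma pint0 : pint (fun=> 0) = 0.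
Proof. by rewrite /pint /Rintegral integral0. Qed.

Lemma pint_ge0 f : (forall p, 0 <= f p) -> 0 <= pint f.
Proof. by move=> f0; apply: Rintegral_ge0. Qed.

Lemma pint_le f g : pintegrable f -> pintegrable g ->
  (forall p, f p <= g p) -> pint f <= pint g.
Proof. by move=> fi gi fg; apply: le_Rintegral. Qed.

Lemma pint_norm f : pintegrable f -> `|pint f| <= pint (fun p => `|f p|).
Proof. by move=> fi; apply: le_normr_Rintegral. Qed.

Lemma pintegrable_ae f g : measurable_fun setT g -> pintegrable f ->
  {ae mu2, forall p, f p = g p} -> pintegrable g.
Proof.
move=> mg fi fg.
apply/integrableP; split; first exact/measurable_EFinP.
have /integrableP[mf] := fi.
rewrite (@ae_eq_integral _ _ _ mu2 setT (fun x => `|(EFin \o g) x|%E))//.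
- by apply: measurableT_comp.
- by apply: measurableT_comp => //; exact/measurable_EFinP.
- by apply: filterS fg => p /= -> _.
Qed.

Lemma pint_ae f g : measurable_fun setT f -> measurable_fun setT g ->
  {ae mu2, forall p, f p = g p} -> pint f = pint g.
Proof.
move=> mf mg fg; rewrite /pint /Rintegral; congr fine.
apply: ae_eq_integral => //; try exact/measurable_EFinP.
by apply: filterS fg => p /= -> _.
Qed.

Lemma pint_le_ae f g : pintegrable f -> pintegrable g ->
  {ae mu2, forall p, f p <= g p} -> pint f <= pint g.
Proof.
move=> fi gi fg.
(* The maximum equals [g] almost everywhere and dominates [f] everywhere, so the pointwise
   comparison applies to it. *)
have mm : measurable_fun setT (fun p => Num.max (f p) (g p)).
  by apply: measurable_maxr; exact: pintegrable_measurable.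
have ae : {ae mu2, forall p, g p = Num.max (f p) (g p)}.
  by apply: filterS fg => p /max_r ->.
rewrite (pint_ae (pintegrable_measurable gi) mm ae).
apply: pint_le => //; first exact: (pintegrable_ae mm gi ae).
by move=> p; rewrite le_max lexx.
Qed.

Lemma pint_eq0_ae f : pintegrable f -> (forall p, 0 <= f p) -> pint f = 0 ->
  {ae mu2, forall p, f p = 0}.
Proof.
move=> fi f0 If0.
have /integrableP[mf _] := fi.
have [mu20 _] := ae_eq_integral_abs mu2 measurableT mf.
have : (\int[mu2]_(p in setT) `|(EFin \o f) p| = 0)%E.
  have -> : (\int[mu2]_(p in setT) `|(EFin \o f) p| = (pint f)%:E)%E.
    rewrite /pint /Rintegral fineK//; last exact: integrable_fin_num.
    by apply: eq_integral => p _; rewrite gee0_abs// lee_fin.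
  by rewrite If0.
by move=> /mu20; apply: filterS => p /(_ Logic.I) [].
Qed.

(** Balls of the sup norm: the product measure of a square is immediate, and a square contains the
    axis-parallel segments along which Lipschitz bounds are later proved. *)
Definition box (z : R * R) (r : R) : set (R * R) :=
  [set p | `|p.1 - z.1| < r /\ `|p.2 - z.2| < r].

Lemma boxE z r : box z r = ball z.1 r `*` ball z.2 r.
Proof.
by apply/seteqP; split => p /=; rewrite /box/= /ball/= (distrC z.1) (distrC z.2).
Qed.

Lemma measurable_box z r : measurable (box z r).
Proof. by rewrite boxE; apply: measurableX; exact: measurable_ball. Qed.

Lemma mu2_box z r : 0 <= r -> mu2 (box z r) = (4 * r ^+ 2)%:E.
Proof.
move=> r0; rewrite boxE product_measure1E//; try exact: measurable_ball.
transitivity ((r *+ 2)%:E * (r *+ 2)%:E)%E.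
  by congr (_ * _)%E; exact: lebesgue_measure_ball.
by rewrite -EFinM; congr EFin; rewrite mulr2n; ring.
Qed.

Lemma mu2_sigma_finite : sigma_finite setT mu2.
Proof.
exists (fun n => box 0 n.+1%:R); last first.
  by move=> n; split; [exact: measurable_box|rewrite mu2_box// ltry].
apply/esym/seteqP; split => // p _.
exists (Num.truncn (Num.max `|p.1| `|p.2|)) => //.
have := truncnS_gt (Num.max `|p.1| `|p.2|); rewrite gt_max => /andP[].
by rewrite /box /= !subr0.
Qed.

(* The library's instance for products of sigma-finite measures is not
   found by unification on [mu2]. *)
Definition smu2 :
    {sigma_finite_measure set (measurableTypeR R * measurableTypeR R)%type -> \bar R} :=
  HB.pack mu2 (Measure_isSigmaFinite.Build _ _ _ mu2 mu2_sigma_finite).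

Lemma pintegrable_indic A : measurable A -> (mu2 A < +oo)%E -> pintegrable (\1_A).
Proof.
move=> mA Aoo; apply/integrableP; split; first exact/measurable_EFinP.
rewrite (eq_integral (fun x => (\1_A x)%:E)); last first.
  by move=> t _; rewrite /= ger0_norm.
by rewrite integral_indic// setIT.
Qed.

Lemma pint_indic A : measurable A -> pint \1_A = fine (mu2 A).
Proof. by move=> mA; rewrite /pint /Rintegral integral_indic// setIT. Qed.


Definition sqi u := measurable_fun setT u /\ pintegrable (fun p => u p ^+ 2).

Lemma sqi_measurable u : sqi u -> measurable_fun setT u.
Proof. by case. Qed.

Lemma sqi_mul u v : sqi u -> sqi v -> pintegrable (fun p => u p * v p).
Proof.
move=> [mu iu] [mv iv]; apply: (@pintegrable_le _ (fun p => u p ^+ 2 + v p ^+ 2)).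
- exact: measurable_funM.
- exact: pintegrableD.
- by move=> p; rewrite ler_norml; apply/andP; split; nra.
Qed.

Lemma sqiD u v : sqi u -> sqi v -> sqi (fun p => u p + v p).
Proof.
move=> hu hv; have [mu iu] := hu; have [mv iv] := hv.
split; first exact: measurable_funD.
rewrite (_ : (fun p => _) = (fun p => (u p ^+ 2 + v p ^+ 2) + 2 * (u p * v p))).
  by apply: pintegrableD; [exact: pintegrableD|apply: pintegrableZ; exact: sqi_mul].
by apply/funext => p; ring.
Qed.

Lemma sqiZ c u : sqi u -> sqi (fun p => c * u p).
Proof.
move=> [mu iu]; split; first exact: measurable_funM.
rewrite (_ : (fun p => _) = (fun p => c ^+ 2 * u p ^+ 2)).
  exact: pintegrableZ.
by apply/funext => p; ring.
Qed.

Lemma sqiB u v : sqi u -> sqi v -> sqi (fun p => u p - v p).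
Proof.
move=> hu hv; have := sqiD hu (sqiZ (- 1) hv).
by congr sqi; apply/funext => p; ring.
Qed.

Lemma sqi_le u v : measurable_fun setT u -> sqi v ->
  (forall p, `|u p| <= `|v p|) -> sqi u.
Proof.
move=> mu [mv iv] uv; split => //; apply: (pintegrable_le _ iv).
  exact: measurable_funX.
by move=> p; rewrite normrX -(real_normK (num_real (v p))) lerXn2r// nnegrE.
Qed.

(** The quadratic polynomial t |-> integral of (u + t v)^2 is nonnegative; it is evaluated at its
    minimiser -B/A. *)
Lemma cauchy_schwarz u v : sqi u -> sqi v ->
  pint (fun p => u p * v p) ^+ 2 <=
  pint (fun p => u p ^+ 2) * pint (fun p => v p ^+ 2).
Proof.
move=> hu hv; have [mu iu] := hu; have [mv iv] := hv.
set B := pint (fun p => u p * v p); set A := pint (fun p => v p ^+ 2).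
set C := pint (fun p => u p ^+ 2).
have quad t : 0 <= C + 2 * t * B + t ^+ 2 * A.
  have : 0 <= pint (fun p => (u p + t * v p) ^+ 2).
    by apply: pint_ge0 => p; exact: sqr_ge0.
  rewrite (_ : (fun p => _) =
    (fun p => (u p ^+ 2 + (2 * t) * (u p * v p)) + t ^+ 2 * v p ^+ 2)); last first.
    by apply/funext => p; ring.
  have iuv := sqi_mul hu hv.
  rewrite pintD ?pintD ?pintZ//; try exact: pintegrableZ.
  by apply: pintegrableD => //; exact: pintegrableZ.
have A0 : 0 <= A by apply: pint_ge0 => p; exact: sqr_ge0.
have C0 : 0 <= C by apply: pint_ge0 => p; exact: sqr_ge0.
have [A00|An0] := eqVneq A 0.
  have [->|Bn0] := eqVneq B 0; first by rewrite A00 expr0n /= mulr0.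
  (* When [A = 0] the polynomial is affine in t, and this t would give it the value -1. *)
  have := quad (- (C + 1) / (2 * B)); rewrite A00.
  have -> : C + 2 * (- (C + 1) / (2 * B)) * B + (- (C + 1) / (2 * B)) ^+ 2 * 0 = -1.
    by field; rewrite Bn0.
  by rewrite ler0N1.
have Ap : 0 < A by rewrite lt_def An0.
have := quad (- B / A).
have -> : C + 2 * (- B / A) * B + (- B / A) ^+ 2 * A = (C * A - B ^+ 2) / A by field.
by rewrite pmulr_lge0 ?invr_gt0// subr_ge0.
Qed.

Lemma pintegrable_prod (F : (R * R) * (R * R) -> R) f g :
  measurable_fun setT F -> pintegrable f -> pintegrable g ->
  (forall x y, `|F (x, y)| <= f x * g y) ->
  (mu2 \x mu2)%E.-integrable setT (EFin \o F).
Proof.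
move=> mF fi gi FG.
have mEF : measurable_fun setT (EFin \o F) by exact/measurable_EFinP.
have [_ H] := @integrable12ltyP _ _ _ _ R smu2 smu2 (EFin \o F) mEF; apply: H.
apply: (@le_lt_trans _ _ (\int[mu2]_x (`|f x| * pint (fun y => `|g y|))%:E)%E).
  apply: ge0_le_integral => //.
  - by move=> x _; apply: integral_ge0.
  - apply: (@measurable_fun_fubini_tonelli_F _ _ _ _ R smu2 (abse \o (EFin \o F))) => //=.
    exact: measurableT_comp.
  - apply/measurable_EFinP; apply: measurable_funM => //.
    by apply: measurableT_comp => //; exact: pintegrable_measurable.
  move=> x _; rewrite EFinM /pint /Rintegral fineK; last first.
    by apply: integrable_fin_num => //; exact: pintegrable_norm.
  rewrite -ge0_integralZl//; last first.
    apply/measurable_EFinP; apply: measurableT_comp => //.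
    exact: pintegrable_measurable.
  apply: ge0_le_integral => //.
  - by apply: measurableT_comp => //; apply: measurableT_comp => //.
  - apply/measurable_EFinP; apply: measurable_funM => //; apply: measurableT_comp => //.
    exact: pintegrable_measurable.
  move=> y _; rewrite /= lee_fin (le_trans (FG x y))// -normrM ler_norm//.
have := pintegrableZ (pint (fun y => `|g y|)) (pintegrable_norm fi).
move=> /integrableP[_]; apply: le_lt_trans.
apply: ge0_le_integral => //.
- by move=> x _; rewrite lee_fin mulr_ge0// pint_ge0.
- apply/measurable_EFinP; apply: measurable_funM => //.
  by apply: measurableT_comp => //; exact: pintegrable_measurable.
- do 2 apply: measurableT_comp => //; apply: measurable_funM => //.
  by apply: measurableT_comp => //; exact: pintegrable_measurable.
- by move=> x _ /=; rewrite lee_fin mulrC ler_norm.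
Qed.

Lemma pintegrable_fubini (F : (R * R) * (R * R) -> R) :
  (mu2 \x mu2)%E.-integrable setT (EFin \o F) ->
  (forall x, pintegrable (fun y => F (x, y))) ->
  pintegrable (fun x => pint (fun y => F (x, y))).
Proof.
move=> iF iF1; have := @integrable_fubini_F _ _ _ _ R smu2 smu2 (EFin \o F) iF.
congr (integrable _ _ _); apply/funext => x.
by rewrite /fubini_F /pint /Rintegral /= fineK//; exact: integrable_fin_num (iF1 x).
Qed.

Lemma pint_fubini (F : (R * R) * (R * R) -> R) :
  (mu2 \x mu2)%E.-integrable setT (EFin \o F) ->
  (forall x, pintegrable (fun y => F (x, y))) ->
  (forall y, pintegrable (fun x => F (x, y))) ->
  pint (fun x => pint (fun y => F (x, y))) = pint (fun y => pint (fun x => F (x, y))).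
Proof.
move=> iF iF1 iF2; rewrite {1}/pint {2}/pint /Rintegral; congr fine.
transitivity (\int[mu2]_x \int[mu2]_y (F (x, y))%:E)%E.
  by apply: eq_integral => x _; rewrite /pint /Rintegral fineK//; exact: integrable_fin_num (iF1 x).
transitivity (\int[mu2]_y \int[mu2]_x (F (x, y))%:E)%E; first exact: (@Fubini _ _ _ _ R smu2 smu2 (EFin \o F) iF).
by apply: eq_integral => x _; rewrite /pint /Rintegral fineK//; exact: integrable_fin_num (iF2 x).
Qed.

End integration.

(** * Kernels and convolutions *)

Section convolution.
Context {R : realType}.
Local Notation mu2 := ((@lebesgue_measure R) \x (@lebesgue_measure R))%E.
Implicit Types (z w p : R * R) (r C B : R) (u v : R * R -> R) (S : R * R -> R * R -> R).

Definition bx (z : R * R) (r : R) : R * R -> R := \1_(box z r).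

Lemma bx_sym z w r : bx z r w = bx w r z.
Proof.
rewrite /bx !indicE; congr (_ %:R); congr nat_of_bool.
by apply/idP/idP; rewrite !inE /box /= => -[]; rewrite (distrC z.1) (distrC z.2).
Qed.

Lemma bx_ge0 z r w : 0 <= bx z r w.
Proof. by rewrite /bx indicE. Qed.

Lemma bx_le1 z r w : bx z r w <= 1.
Proof. by rewrite /bx indicE lern1; case: (w \in _). Qed.

Lemma bx_in z r w : box z r w -> bx z r w = 1.
Proof. by move=> h; rewrite /bx indicE mem_set. Qed.

Lemma bx_out z r w : ~ box z r w -> bx z r w = 0.
Proof. by move=> h; rewrite /bx indicE memNset. Qed.

Lemma measurable_bx z r : measurable_fun setT (bx z r).
Proof. by apply: measurable_indic; exact: measurable_box. Qed.

Lemma pintegrable_bx z r : pintegrable (bx z r).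
Proof.
have [r0|r0] := leP 0 r.
  by apply: pintegrable_indic; [exact: measurable_box|rewrite mu2_box// ltry].
rewrite (_ : bx z r = (fun=> 0)); first exact: pintegrable0.
apply/funext => p; rewrite bx_out// => -[h _].
by move: (le_lt_trans (normr_ge0 _) h); rewrite ltNge (ltW r0).
Qed.

Lemma pint_bx z r : 0 <= r -> pint (bx z r) = 4 * r ^+ 2.
Proof. by move=> r0; rewrite pint_indic ?mu2_box//; exact: measurable_box. Qed.

Lemma bx_idem z r p : bx z r p * bx z r p = bx z r p.
Proof. by rewrite /bx indicE; case: (p \in _); rewrite /= ?mulr1 ?mulr0. Qed.

Lemma sqi_bx z r : sqi (bx z r).
Proof.
split; first exact: measurable_bx.
have := pintegrable_bx z r; congr pintegrable; apply/funext => p.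
by rewrite expr2 bx_idem.
Qed.

Lemma measurable_bx2 r : measurable_fun setT (fun q : (R * R) * (R * R) => bx q.2 r q.1).
Proof.
have m1 : measurable_fun setT (fun q : (R * R) * (R * R) => `|q.1.1 - q.2.1| < r).
  apply: measurable_fun_ltr => //; apply: measurableT_comp => //.
  by apply: measurable_funB; apply: measurableT_comp.
have m2 : measurable_fun setT (fun q : (R * R) * (R * R) => `|q.1.2 - q.2.2| < r).
  apply: measurable_fun_ltr => //; apply: measurableT_comp => //.
  by apply: measurable_funB; apply: measurableT_comp.
have mA : measurable [set q : (R * R) * (R * R) | box q.2 r q.1].
  have := measurable_and m1 m2 => /(_ measurableT [set true]); rewrite setTI.
  rewrite (_ : _ @^-1` _ = [set q : (R * R) * (R * R) | box q.2 r q.1]); first by apply.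
  by apply/seteqP; split => q /=; [move=> /andP[]|move=> [-> ->]].
have := @measurable_indic _ _ R setT _ mA.
by congr measurable_fun; apply/funext => q; rewrite /bx !indicE; congr (_ %:R);
  congr nat_of_bool; apply/idP/idP; rewrite !inE.
Qed.

(** The first argument of [S] is the variable of integration, the second the point of evaluation.
    The pair (C, r) bounds the size and the support at once, and C * 4 r^2 will bound the operator
    on L^2. *)
Definition kern S (C r : R) : Prop :=
  [/\ measurable_fun setT (fun q : (R * R) * (R * R) => S q.1 q.2), 0 <= r &
      forall w z, `|S w z| <= C * bx z r w].

(** A general integral operator; it becomes a convolution when [S w z] depends on [w - z] only. *)
Definition conv S u (z : R * R) : R := pint (fun w => u w * S w z).

(** Bounded support puts u in L^1 as well, which is what makes every exchange of integrals below
    legitimate. *)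
Definition sqic u : Prop := sqi u /\ exists B, forall p, ~ box 0 B p -> u p = 0.

Lemma sqic_integrable u : sqic u -> pintegrable u.
Proof.
move=> [[mu iu] [B uB]].
apply: (@pintegrable_le _ _ (fun p => u p ^+ 2 + bx 0 B p)) => //.
  by apply: pintegrableD => //; exact: pintegrable_bx.
move=> p; have [pB|pB] := pselect (box 0 B p).
  by rewrite bx_in// ler_norml; apply/andP; split; nra.
by rewrite uB// normr0 addr_ge0 ?sqr_ge0// bx_ge0.
Qed.

Lemma sqi_bxM u z r : sqi u -> sqi (fun p => u p * bx z r p).
Proof.
move=> hu; apply: (sqi_le _ hu); first by apply: measurable_funM; [case: hu|exact: measurable_bx].
move=> p; rewrite normrM (ger0_norm (bx_ge0 z r p)).
by rewrite ler_piMr// bx_le1.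
Qed.

Lemma box_sub z r : box z r `<=` box 0 (`|z.1| + `|z.2| + r).
Proof.
move=> p [p1 p2]; split; rewrite subr0.
  have := ler_normD (p.1 - z.1) z.1; rewrite subrK; have := normr_ge0 z.2; lra.
have := ler_normD (p.2 - z.2) z.2; rewrite subrK; have := normr_ge0 z.1; lra.
Qed.

Lemma sqic_bxM u z r : sqi u -> sqic (fun p => u p * bx z r p).
Proof.
move=> hu; split; first exact: sqi_bxM.
exists (`|z.1| + `|z.2| + r) => p np /=; rewrite [bx z r p]bx_out ?mulr0// => /box_sub.
exact: np.
Qed.

Lemma sqicD u v : sqic u -> sqic v -> sqic (fun p => u p + v p).
Proof.
move=> [hu [B uB]] [hv [B' vB]]; split; first exact: sqiD.
exists (Num.max B B') => p np; rewrite uB ?vB ?addr0//.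
  by move=> [p1 p2]; apply: np; split; rewrite lt_max ?p1 ?p2 orbT.
by move=> [p1 p2]; apply: np; split; rewrite lt_max ?p1 ?p2.
Qed.

Lemma sqicZ c u : sqic u -> sqic (fun p => c * u p).
Proof.
move=> [hu [B uB]]; split; first exact: sqiZ.
by exists B => p /uB ->; rewrite mulr0.
Qed.

Lemma sqicB u v : sqic u -> sqic v -> sqic (fun p => u p - v p).
Proof.
move=> hu hv; have := sqicD hu (sqicZ (-1) hv).
by congr sqic; apply/funext => p; ring.
Qed.

Lemma kern_swap S C r : kern S C r -> kern (fun w z => S z w) C r.
Proof.
move=> [mS r0 bS]; split => // [|w z]; last by rewrite bx_sym.
exact: (measurableT_comp mS (measurable_fun_pair measurable_snd measurable_fst)).
Qed.

Lemma kernZ c S C r : kern S C r -> kern (fun w z => c * S w z) (`|c| * C) r.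
Proof.
move=> [mS r0 bS]; split => // [|w z]; first exact: measurable_funM.
by rewrite normrM -mulrA ler_wpM2l.
Qed.

Lemma sqicW u : sqic u -> exists2 B, 0 <= B & forall p, ~ box 0 B p -> u p = 0.
Proof.
move=> [_ [B uB]]; exists `|B| => // p np; apply: uB => -[p1 p2]; apply: np.
by split; [apply: (lt_le_trans p1)|apply: (lt_le_trans p2)]; exact: ler_norm.
Qed.

Section kernel.
Variables (S : R * R -> R * R -> R) (C r : R).
Hypothesis kS : kern S C r.

Lemma kern_measurable : measurable_fun setT (fun q : (R * R) * (R * R) => S q.1 q.2).
Proof. by case: kS. Qed.

Lemma kern_measurablel z : measurable_fun setT (S^~ z).
Proof. exact: (measurableT_comp kern_measurable (pair2_measurable z)). Qed.

Lemma kern_measurabler w : measurable_fun setT (S w).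
Proof. exact: (measurableT_comp kern_measurable (pair1_measurable w)). Qed.

Lemma kern_bd w z : `|S w z| <= C * bx z r w.
Proof. by case: kS. Qed.

Lemma kern_sqi z : sqi (S^~ z).
Proof.
apply: (sqi_le (kern_measurablel z) (sqiZ C (sqi_bx z r))) => p.
exact: (le_trans (kern_bd _ _) (ler_norm _)).
Qed.

Lemma kern_sqir w : sqi (S w).
Proof.
apply: (sqi_le (kern_measurabler w) (sqiZ C (sqi_bx w r))) => p.
by rewrite bx_sym; exact: (le_trans (kern_bd _ _) (ler_norm _)).
Qed.

Lemma kern_prod_integrable u v : pintegrable u -> pintegrable v ->
  (mu2 \x mu2)%E.-integrable setT
    (EFin \o (fun q : (R * R) * (R * R) => u q.1 * S q.1 q.2 * v q.2)).
Proof.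
move=> iu iv; apply: (@pintegrable_prod _ _ (fun x => `|C| * `|u x|) (fun y => `|v y|)).
- apply: measurable_funM.
    apply: measurable_funM; last exact: kern_measurable.
    apply: (measurableT_comp (f := u)) => //; exact: pintegrable_measurable.
  apply: (measurableT_comp (f := v)) => //; exact: pintegrable_measurable.
- by apply: pintegrableZ; exact: pintegrable_norm.
- exact: pintegrable_norm.
move=> x y /=; rewrite !normrM ler_wpM2r// mulrC ler_wpM2r//.
rewrite (le_trans (kern_bd _ _))// (le_trans (ler_norm _))// normrM.
by rewrite (ger0_norm (bx_ge0 _ _ _)) ler_piMr// bx_le1.
Qed.

Lemma conv_adjoint u v : sqic u -> sqic v ->
  pint (fun z => conv S u z * v z) = pint (fun w => u w * pint (fun z => S w z * v z)).
Proof.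
move=> hu hv.
have iF := kern_prod_integrable (sqic_integrable hu) (sqic_integrable hv).
have i1 x : pintegrable (fun y => u x * S x y * v y).
  have := pintegrableZ (u x) (sqi_mul (kern_sqir x) hv.1).
  by congr pintegrable; apply/funext => y; rewrite mulrA.
have i2 y : pintegrable (fun x => u x * S x y * v y).
  have := pintegrableZ (v y) (sqi_mul hu.1 (kern_sqi y)).
  by congr pintegrable; apply/funext => x; rewrite mulrC.
have := pint_fubini iF i1 i2 => /= E.
transitivity (pint (fun y => pint (fun x => u x * S x y * v y))).
  apply: pint_ext => z; rewrite /conv mulrC -pintZ; last exact: sqi_mul hu.1 (kern_sqi z).
  by apply: pint_ext => w; rewrite mulrC.
rewrite -E; apply: pint_ext => w; rewrite -pintZ; last exact: sqi_mul (kern_sqir w) hv.1.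
by apply: pint_ext => z; rewrite mulrA.
Qed.

Lemma conv_cauchy u z : sqi u ->
  conv S u z ^+ 2 <= (C ^+ 2 * (4 * r ^+ 2)) * pint (fun w => u w ^+ 2 * bx z r w).
Proof.
move=> hu; have [_ r0 _] := kS.
have -> : conv S u z = pint (fun w => (u w * bx z r w) * S w z).
  apply: pint_ext => w; have [zw|zw] := pselect (box z r w); first by rewrite bx_in// mulr1.
  have := kern_bd w z; rewrite bx_out// mulr0 normr_le0 => /eqP ->.
  by rewrite !mulr0.
apply: (le_trans (cauchy_schwarz (sqi_bxM z r hu) (kern_sqi z))).
rewrite mulrC.
have -> : pint (fun p => (u p * bx z r p) ^+ 2) = pint (fun w => u w ^+ 2 * bx z r w).
  by apply: pint_ext => p; rewrite exprMn [bx _ _ _ ^+ 2]expr2 bx_idem.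
apply: ler_wpM2r.
  by apply: pint_ge0 => p; rewrite mulr_ge0 ?sqr_ge0 ?bx_ge0.
rewrite -(pint_bx z r0) -pintZ; last exact: pintegrable_bx.
apply: pint_le.
- by case: (kern_sqi z).
- by apply: pintegrableZ; exact: pintegrable_bx.
move=> p; rewrite -real_normK ?num_real//.
have -> : C ^+ 2 * bx z r p = (C * bx z r p) ^+ 2 by rewrite exprMn [bx _ _ _ ^+ 2]expr2 bx_idem.
by rewrite lerXn2r ?nnegrE ?kern_bd//; exact: le_trans (kern_bd p z).
Qed.

Lemma conv_out u B z : 0 <= B -> (forall p, ~ box 0 B p -> u p = 0) -> ~ box 0 (B + r) z ->
  conv S u z = 0.
Proof.
move=> B0 uB nz; rewrite /conv (_ : (fun w => _) = (fun=> 0)) ?pint0//.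
apply/funext => w; have [wB|wB] := pselect (box 0 B w); last by rewrite uB// mul0r.
have [zw|zw] := pselect (box z r w).
  exfalso; apply: nz; case: wB zw; rewrite /box /= !subr0 => w1 w2 [w3 w4]; split.
    by have := ler_normB w.1 (w.1 - z.1); rewrite subKr; lra.
  by have := ler_normB w.2 (w.2 - z.2); rewrite subKr; lra.
by have := kern_bd w z; rewrite bx_out// mulr0 normr_le0 => /eqP ->; rewrite mulr0.
Qed.

End kernel.

Section young.
Variables (S : R * R -> R * R -> R) (C r : R).
Hypothesis kS : kern S C r.

Lemma conv_pintegrable u : sqic u -> pintegrable (conv S u).
Proof.
move=> hu; have [B B0 uB] := sqicW hu.
have kS' := kern_swap kS.
have iF := kern_prod_integrable kS' (pintegrable_bx 0 (B + r)) (sqic_integrable hu).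
have := @pintegrable_fubini _ _ iF; rewrite /= => h.
have {}h := h (fun x => _).
have : pintegrable (fun z => bx 0 (B + r) z * conv S u z).
  rewrite (_ : (fun z => _) =
     (fun z => pint (fun w => bx 0 (B + r) z * S w z * u w))).
    apply: h => x; have := pintegrableZ (bx 0 (B + r) x) (sqi_mul hu.1 (kern_sqi kS x)).
    by congr pintegrable; apply/funext => w; ring.
  apply/funext => z; rewrite -pintZ; last exact: sqi_mul hu.1 (kern_sqi kS z).
  by apply: pint_ext => w; ring.
congr pintegrable; apply/funext => z.
have [zB|zB] := pselect (box 0 (B + r) z); first by rewrite bx_in// mul1r.
by rewrite (conv_out kS B0 uB zB) mulr0.
Qed.

Lemma conv_bounded u z : sqic u -> `|conv S u z| <= `|C| * pint (fun w => `|u w|).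
Proof.
move=> hu; have iu := sqic_integrable hu.
have i2 := sqi_mul hu.1 (kern_sqi kS z).
rewrite (le_trans (pint_norm i2))// -pintZ; last exact: pintegrable_norm.
apply: pint_le; [exact: pintegrable_norm|by apply: pintegrableZ; exact: pintegrable_norm|].
move=> w; rewrite normrM mulrC ler_wpM2r// (le_trans (kern_bd kS _ _))//.
by rewrite (le_trans (ler_norm _))// normrM (ger0_norm (bx_ge0 _ _ _)) ler_piMr// bx_le1.
Qed.

Lemma conv_sqic u : sqic u -> sqic (conv S u).
Proof.
move=> hu; have [B B0 uB] := sqicW hu.
have iC := conv_pintegrable hu.
split; last by exists (B + r) => z; exact: (conv_out kS B0 uB).
split; first exact: pintegrable_measurable.
apply: (pintegrable_le _ (pintegrableZ (`|C| * pint (fun w => `|u w|)) (pintegrable_norm iC))).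
  by apply: measurable_funX; exact: pintegrable_measurable.
move=> p; rewrite normrX expr2 ler_wpM2r//; exact: conv_bounded.
Qed.

(** Pointwise, Cauchy-Schwarz costs C^2 * 4 r^2 times the mass of u^2 in the box around z;
    integrating in z and exchanging the integrals gives the second factor 4 r^2. *)
Lemma conv_young u : sqic u ->
  pint (fun z => conv S u z ^+ 2) <=
  (C * (4 * r ^+ 2)) ^+ 2 * pint (fun w => u w ^+ 2).
Proof.
move=> hu; have [_ r0 _] := kS; have [B B0 uB] := sqicW hu.
have kB : kern (fun w z => bx z r w) 1 r.
  split => // [|w z]; first exact: measurable_bx2.
  by rewrite mul1r (ger0_norm (bx_ge0 z r w)).
have iu2 : pintegrable (fun w => u w ^+ 2) by case: hu => -[].
(* The constant 1 is not integrable in z, so the exchange is done with the indicator of a box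
   outside which [conv S u] vanishes. *)
have iF := kern_prod_integrable kB iu2 (pintegrable_bx 0 (B + r)).
have iF' := kern_prod_integrable (kern_swap kB) (pintegrable_bx 0 (B + r)) iu2.
have i1 x : pintegrable (fun y => u x ^+ 2 * bx y r x * bx 0 (B + r) y).
  have := pintegrableZ (u x ^+ 2) (sqi_mul (kern_sqir kB x) (sqi_bx 0 (B + r))).
  by congr pintegrable; apply/funext => w; ring.
have i2 y : pintegrable (fun x => u x ^+ 2 * bx y r x * bx 0 (B + r) y).
  have := pintegrableZ (bx 0 (B + r) y) (sqi_mul (sqi_bxM y r hu.1) hu.1).
  by congr pintegrable; apply/funext => w; ring.
have := pint_fubini iF i1 i2 => /= E.
have c0 : 0 <= C ^+ 2 * (4 * r ^+ 2) := mulr_ge0 (sqr_ge0 C) (mulr_ge0 (ler0n R 4) (sqr_ge0 r)).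
apply: (@le_trans _ _ (pint (fun z => (C ^+ 2 * (4 * r ^+ 2)) *
    pint (fun x => u x ^+ 2 * bx z r x * bx 0 (B + r) z)))).
  apply: pint_le.
  - by case: (conv_sqic hu) => -[].
  - apply: pintegrableZ.
    have h := @pintegrable_fubini _ _ iF'; rewrite /= in h.
    have := h (fun y => _); rewrite (_ : (fun x => pint (fun y => bx 0 (B + r) x * bx x r y * u y ^+ 2)) =
       (fun z => pint (fun x => u x ^+ 2 * bx z r x * bx 0 (B + r) z))); last first.
      by apply/funext => z; apply: pint_ext => w; ring.
    apply => x; have := i2 x.
    by congr pintegrable; apply/funext => w; ring.
  move=> z; have [zB|zB] := pselect (box 0 (B + r) z); last first.
    rewrite (conv_out kS B0 uB zB) expr0n; apply: (mulr_ge0 c0); apply: pint_ge0 => x.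
    exact: mulr_ge0 (mulr_ge0 (sqr_ge0 _) (bx_ge0 _ _ _)) (bx_ge0 _ _ _).
  rewrite (bx_in zB); under pint_ext do rewrite mulr1.
  exact: (conv_cauchy kS _ hu.1).
rewrite pintZ; last first.
  have h := @pintegrable_fubini _ _ iF'; rewrite /= in h.
  have := h (fun y => _); rewrite (_ : (fun x => pint (fun y => bx 0 (B + r) x * bx x r y * u y ^+ 2)) =
       (fun z => pint (fun x => u x ^+ 2 * bx z r x * bx 0 (B + r) z))); last first.
    by apply/funext => z; apply: pint_ext => w; ring.
  apply => x; have := i2 x.
  by congr pintegrable; apply/funext => w; ring.
rewrite -E.
have -> : (C * (4 * r ^+ 2)) ^+ 2 * pint (fun w => u w ^+ 2) =
    (C ^+ 2 * (4 * r ^+ 2)) * ((4 * r ^+ 2) * pint (fun w => u w ^+ 2)) by ring.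
apply: (ler_wpM2l c0).
rewrite -(pintZ (4 * r ^+ 2) iu2); apply: pint_le; [|exact: pintegrableZ|].
  have h := @pintegrable_fubini _ _ iF; apply: h => x; exact: i1.
move=> x /=; rewrite mulrC -(pint_bx x r0) -pintZ; last exact: pintegrable_bx.
apply: pint_le; [exact: i1|by apply: pintegrableZ; exact: pintegrable_bx|move=> y].
rewrite [bx y r x]bx_sym; apply: ler_piMr; last exact: bx_le1.
exact: mulr_ge0 (sqr_ge0 _) (bx_ge0 _ _ _).
Qed.

End young.

End convolution.

(** * Smooth cut-off functions *)

Section smooth1.
Context {R : realType}.
Implicit Types (f g : R -> R) (x t : R).

(** A second-order remainder replaces the rules of calculus where they do not apply: at the flat
    point of [expinv], and, with M = 0, along directions in which a function on the plane is
    affine. *)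
Lemma is_derive_quad (V : normedModType R) (f : V -> R) (x v : V) (d M : R) :
  (forall h, `|f (h *: v + x) - f x - h * d| <= M * h ^+ 2) -> is_derive x v f d.
Proof.
move=> fM.
have cvgd : h^-1 *: (f (h *: v + x) - f x) @[h --> 0^'] --> d.
  apply/cvgrPdist_lep; near=> e; near=> h.
  have h0 : h != 0 by near: h; exact: nbhs_dnbhs_neq.
  have -> : d - h^-1 *: (f (h *: v + x) - f x) = - (h^-1 * (f (h *: v + x) - f x - h * d)).
    by rewrite /GRing.scale /=; field.
  rewrite normrN normrM normfV ler_pdivrMl ?normr_gt0//.
  apply: (le_trans (fM h)).
  rewrite -(real_normK (num_real h)) expr2 mulrA [leRHS]mulrC ler_wpM2r//.
  apply: (@le_trans _ _ ((`|M| + 1) * `|h|)).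
    by rewrite ler_wpM2r// (le_trans (ler_norm M))// lerDl.
  rewrite -ler_pdivlMl ?ltr_pwDr//.
  near: h; apply: dnbhs0_le; rewrite mulr_gt0// invr_gt0 ltr_pwDr//.
split; first by apply/cvg_ex; exists d.
exact: cvg_lim.
Unshelve. all: by end_near. Qed.

(** The index is shifted: [Dk 0] is already differentiability, so [Dk k] implies continuity for
    every k. *)
Fixpoint Dk (k : nat) f : Prop :=
  (forall x, derivable f x 1) /\ if k is k'.+1 then Dk k' (derive1 f) else True.

Definition smooth f := forall k, Dk k f.

Lemma is_derive_derive1 f g : (forall x, is_derive x 1 f (g x)) -> derive1 f = g.
Proof. by move=> fg; apply/funext => x; rewrite derive1E; case: (fg x). Qed.

Lemma DkS k f g : (forall x, is_derive x 1 f (g x)) -> Dk k g -> Dk k.+1 f.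
Proof.
move=> fg Dg; split; last by rewrite (is_derive_derive1 fg).
by move=> x; case: (fg x).
Qed.

Lemma Dk0 f g : (forall x, is_derive x 1 f (g x)) -> Dk 0 f.
Proof. by move=> fg; split => // x; case: (fg x). Qed.

Lemma Dk_le k f : Dk k.+1 f -> Dk k f.
Proof.
by elim: k f => [|k IH] f [fd fk]; split => //; apply: IH.
Qed.

Lemma Dk_derivable k f x : Dk k f -> derivable f x 1.
Proof. by case: k => [|k] []. Qed.

Lemma Dk_is_derive k f x : Dk k f -> is_derive x 1 f (derive1 f x).
Proof. by move=> /(@Dk_derivable _ _ x) df; rewrite derive1E; exact: derivableP. Qed.

Lemma Dk_derive1 k f : Dk k.+1 f -> Dk k (derive1 f).
Proof. by case. Qed.

Lemma smooth_derive1 f : smooth f -> smooth (derive1 f).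
Proof. by move=> sf k; exact: Dk_derive1 (sf k.+1). Qed.

Lemma smooth_is_derive f x : smooth f -> is_derive x 1 f (derive1 f x).
Proof. by move=> /(_ 0%N); exact: Dk_is_derive. Qed.

Lemma smooth_continuous f : smooth f -> continuous f.
Proof.
move=> sf x; apply: differentiable_continuous; apply/derivable1_diffP.
exact: Dk_derivable (sf 0%N).
Qed.

Lemma Dk_cst k c : Dk k (cst c).
Proof.
elim: k c => [|k IH] c; first exact: (Dk0 (fun x => is_derive_cst c x 1)).
exact: (DkS (fun x => is_derive_cst c x 1) (IH 0)).
Qed.

Lemma Dk_id k : Dk k id.
Proof.
case: k => [|k]; first exact: (Dk0 (fun x => is_derive_id x 1)).
exact: (DkS (fun x => is_derive_id x 1) (Dk_cst k 1)).
Qed.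

Lemma Dk_add k f g : Dk k f -> Dk k g -> Dk k (fun x => f x + g x).
Proof.
elim: k f g => [|k IH] f g df dg.
  exact: (Dk0 (fun x => is_deriveD (Dk_is_derive x df) (Dk_is_derive x dg))).
apply: (DkS (fun x => is_deriveD (Dk_is_derive x df) (Dk_is_derive x dg))).
by apply: IH; exact: Dk_derive1.
Qed.

Lemma Dk_mul k f g : Dk k f -> Dk k g -> Dk k (fun x => f x * g x).
Proof.
elim: k f g => [|k IH] f g df dg.
  exact: (Dk0 (fun x => is_deriveM (Dk_is_derive x df) (Dk_is_derive x dg))).
apply: (DkS (fun x => is_deriveM (Dk_is_derive x df) (Dk_is_derive x dg))).
apply: Dk_add.
  exact: (IH f (derive1 g) (Dk_le df) (Dk_derive1 dg)).
exact: (IH g (derive1 f) (Dk_le dg) (Dk_derive1 df)).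
Qed.

Lemma Dk_comp k f g : Dk k f -> Dk k g -> Dk k (fun x => f (g x)).
Proof.
elim: k f g => [|k IH] f g df dg.
  exact: (Dk0 (fun x => is_derive1_comp (Dk_is_derive (g x) df) (Dk_is_derive x dg))).
apply: (DkS (fun x => is_derive1_comp (Dk_is_derive (g x) df) (Dk_is_derive x dg))).
apply: Dk_mul; last exact: Dk_derive1.
by apply: (IH (derive1 f) g); [exact: Dk_derive1|exact: Dk_le].
Qed.

Lemma Dk_inv k f : (forall x, f x != 0) -> Dk k f -> Dk k (fun x => (f x)^-1).
Proof.
move=> f0; elim: k => [|k IH] df.
  exact: (Dk0 (fun x => is_deriveV (f0 x) (Dk_is_derive x df))).
apply: (DkS (fun x => is_deriveV (f0 x) (Dk_is_derive x df))).
have := IH (Dk_le df) => di.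
apply: Dk_mul; last exact: Dk_derive1.
rewrite (_ : (fun x => - _) = (fun x => (-1) * ((f x)^-1 * (f x)^-1))).
  by apply: Dk_mul; [exact: Dk_cst|exact: Dk_mul].
by apply/funext => x; rewrite mulN1r -expr2 exprVn.
Qed.

(** The powers t^-n are carried along because the family is closed under differentiation up to
    linear combinations; smoothness is then one induction for all n together. *)
Definition expinv (n : nat) (t : R) : R :=
  if 0 < t then t^-1 ^+ n * expR (- t^-1) else 0.

(** From e^s >= s^(n+2) / (n+2)! at s = 1/t. It gives the derivative 0 at the origin. *)
Lemma expinv_quad n t : `|expinv n t| <= n.+2`!%:R * t ^+ 2.
Proof.
rewrite /expinv; case: ifPn => [t0|_]; last by rewrite normr0 mulr_ge0// sqr_ge0.
have it0 : 0 < t^-1 by rewrite invr_gt0.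
rewrite ger0_norm ?mulr_ge0 ?expR_ge0 ?exprn_ge0 ?(ltW it0)//.
rewrite expRN ler_pdivrMr ?expR_gt0//.
have := expR_ge1Dxn n.+1 (ltW it0) => h.
have {h} : t^-1 ^+ n.+2 / n.+2`!%:R <= expR t^-1 by apply: le_trans h; rewrite lerDr.
rewrite ler_pdivrMr ?ltr0n ?fact_gt0// => h.
have : t ^+ 2 * t^-1 ^+ n.+2 <= t ^+ 2 * (expR t^-1 * n.+2`!%:R).
  by rewrite ler_wpM2l// sqr_ge0.
have -> : t ^+ 2 * t^-1 ^+ n.+2 = t^-1 ^+ n.
  by rewrite !exprS; field; rewrite gt_eqF.
move=> {}h; apply: (le_trans h); rewrite le_eqVlt; apply/orP; left; apply/eqP; ring.
Qed.

Lemma expinv_derive n x :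
  is_derive x 1 (expinv n) (expinv n.+2 x - n%:R * expinv n.+1 x).
Proof.
have [x0|x0|->] := ltgtP x 0.
- have -> : expinv n.+2 x - n%:R * expinv n.+1 x = 0.
    by rewrite /expinv ltNge (ltW x0) /= mulr0 subr0.
  apply: (@near_eq_is_derive _ _ _ (cst 0)).
  by near=> y; rewrite /expinv /cst ltNge (@ltW _ _ y 0)//; near: y; exact: lt_nbhsl.
- have xn0 : x != 0 by rewrite gt_eqF.
  apply: (@near_eq_is_derive _ _ _ (fun t => t^-1 ^+ n * expR (- t^-1))).
    by near=> y; rewrite /expinv (_ : 0 < y)//; near: y; exact: (cvgr_gt x cvg_id).
  have di : is_derive x 1 (fun t : R => t^-1) (- x ^- 2 *: 1) by exact: is_deriveV.
  have de : is_derive x 1 (fun t : R => expR (- t^-1)) (expR (- x^-1) * - (- x ^- 2 *: 1)).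
    by apply: (is_derive1_comp (f := expR) (g := fun t => - t^-1)).
  have dX := is_deriveX n di; rewrite exprfctE in dX.
  apply: (is_derive_eq (is_deriveM dX de)).
  rewrite /expinv x0 /GRing.scale /=.
  clear dX; case: n => [|n]; rewrite /=.
    rewrite !expr0 /= mulr0n !mul0r !mulr0. by field.
  rewrite !exprS -mulr_natl. by field.
- have -> : expinv n.+2 0 - n%:R * expinv n.+1 0 = 0.
    by rewrite /expinv ltxx mulr0 subr0.
  apply: (@is_derive_quad _ _ _ _ _ n.+2`!%:R) => h.
  rewrite /GRing.scale /= mulr1 addr0 mulr0 subr0 {2}/expinv ltxx subr0.
  exact: expinv_quad.
Unshelve. all: by end_near. Qed.

Lemma smooth_expinv n : smooth (expinv n).
Proof.
move=> k; elim: k n => [|k IH] n; first exact: (Dk0 (expinv_derive n)).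
apply: (DkS (expinv_derive n)).
rewrite (_ : (fun x => _) = (fun x => expinv n.+2 x + (- n%:R) * expinv n.+1 x)).
  by apply: Dk_add => //; apply: Dk_mul => //; exact: Dk_cst.
by apply/funext => x; rewrite mulNr.
Qed.

End smooth1.

(** * Radial profiles: a smooth step, the mollifier and its potential *)

Section cutoff.
Context {R : realType}.
Implicit Types t : R.

Definition step t : R := expinv 0 t / (expinv 0 t + expinv 0 (1 - t)).

Lemma expinv_ge0 n t : 0 <= expinv n t.
Proof.
rewrite /expinv; case: ifPn => // t0.
by rewrite mulr_ge0 ?expR_ge0// exprn_ge0// invr_ge0 ltW.
Qed.

Lemma expinv_gt0 n t : 0 < t -> 0 < expinv n t.
Proof.
by move=> t0; rewrite /expinv t0 mulr_gt0 ?expR_gt0// exprn_gt0// invr_gt0.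
Qed.

Lemma expinv_eq0 n t : t <= 0 -> expinv n t = 0.
Proof. by move=> t0; rewrite /expinv ltNge t0. Qed.

Lemma step_den_gt0 t : 0 < expinv 0 t + expinv 0 (1 - t).
Proof.
have [t0|t0] := ltP 0 t; first by rewrite ltr_pwDl ?expinv_gt0// expinv_ge0.
by rewrite ltr_wpDl ?expinv_ge0// expinv_gt0//; lra.
Qed.

Lemma step_eq0 t : t <= 0 -> step t = 0.
Proof. by move=> t0; rewrite /step expinv_eq0// mul0r. Qed.

Lemma step_eq1 t : 1 <= t -> step t = 1.
Proof.
move=> t1; rewrite /step (@expinv_eq0 _ (1 - t)) ?subr_le0// addr0 divff//.
by rewrite gt_eqF// expinv_gt0//; lra.
Qed.

Lemma step_ge0 t : 0 <= step t.
Proof. by rewrite divr_ge0 ?expinv_ge0// ltW// step_den_gt0. Qed.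

Lemma step_le1 t : step t <= 1.
Proof. by rewrite ler_pdivrMr ?step_den_gt0// mul1r lerDl expinv_ge0. Qed.

Lemma smooth_affine (a b : R) k : Dk k (fun t : R => a * t + b).
Proof.
apply: (@Dk_add _ k (fun t => a * t) (cst b)); last exact: Dk_cst.
by apply: (@Dk_mul _ k (cst a) id); [exact: Dk_cst|exact: Dk_id].
Qed.

Lemma smooth_step : smooth step.
Proof.
move=> k; apply: Dk_mul; first exact: smooth_expinv.
apply: Dk_inv; first by move=> t; rewrite gt_eqF// step_den_gt0.
apply: Dk_add; first exact: smooth_expinv.
rewrite (_ : (fun t => _) = (fun t => expinv 0 (-1 * t + 1))).
  by apply: (@Dk_comp _ k (expinv 0)); [exact: smooth_expinv|exact: smooth_affine].
by apply/funext => t; congr expinv; ring.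
Qed.

(** In the variable t = |d|^2, the derivative [cutg] of [cutG] is the profile of the mollifier. A
    profile q with (t q)' = [cutg] is [cutG t / t]: it is smooth at 0 because [cutG] vanishes up to
    1/2, and equals 1/t from 1 on, so that two rescaled copies cancel far away. *)
Definition cutG t : R := step (2 * t - 1).
(* A smooth form of [cutG t / t]: the denominator is positive everywhere and is
   equal to [t] wherever [cutG] does not vanish. *)
Definition cutH t : R := cutG t / (1 + (t - 1) * step (4 * t - 1)).

Lemma cutG_smooth : smooth cutG.
Proof.
by move=> k; apply: (@Dk_comp _ k step); [exact: smooth_step|exact: smooth_affine].
Qed.

Lemma cutG_eq0 t : t <= 1 / 2 -> cutG t = 0.
Proof. by move=> h; rewrite /cutG step_eq0//; lra. Qed.

Lemma cutG_eq1 t : 1 <= t -> cutG t = 1.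
Proof. by move=> h; rewrite /cutG step_eq1//; lra. Qed.

(** The denominator is the convex combination of 1 and t in which t has the weight
    [step (4 * t - 1)], and this weight is zero for t <= 1/4. *)
Lemma cutH_den_gt0 t : 0 < 1 + (t - 1) * step (4 * t - 1).
Proof.
have := step_ge0 (4 * t - 1); have := step_le1 (4 * t - 1).
have [t0|t0] := ltP (1 / 4) t; first by nra.
by rewrite step_eq0 ?mulr0 ?addr0//; lra.
Qed.

Lemma cutH_smooth : smooth cutH.
Proof.
move=> k; apply: Dk_mul; first exact: cutG_smooth.
apply: Dk_inv; first by move=> t; rewrite gt_eqF// cutH_den_gt0.
apply: (@Dk_add _ k (cst 1)); first exact: Dk_cst.
apply: Dk_mul; last by apply: (@Dk_comp _ k step); [exact: smooth_step|exact: smooth_affine].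
by have := @smooth_affine 1 (-1) k; congr Dk; apply/funext => t; rewrite mul1r.
Qed.

Lemma cutHE t : t * cutH t = cutG t.
Proof.
rewrite /cutH; have [t0|t0] := leP t (1 / 2); first by rewrite cutG_eq0// mul0r mulr0.
by rewrite (@step_eq1 (4 * t - 1)); [field; lra|lra].
Qed.

Lemma cutH_inv t : 1 <= t -> cutH t = t^-1.
Proof.
move=> t1; have t0 : t != 0 by lra.
by apply: (mulfI t0); rewrite cutHE cutG_eq1// divff.
Qed.

Definition cutg : R -> R := derive1 cutG.

Lemma cutg_derive t : is_derive t 1 cutG (cutg t).
Proof. exact: smooth_is_derive cutG_smooth. Qed.

Lemma cutg_smooth : smooth cutg.
Proof. exact: smooth_derive1 cutG_smooth. Qed.

(** [cutG] attains its minimum 0 at t, so its derivative vanishes there; this includes the end point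
    1/2. *)
Lemma cutg_eq0l t : t <= 1 / 2 -> cutg t = 0.
Proof.
move=> th; have : is_derive t 1 cutG 0.
  apply: (@derive1_at_min _ cutG (t - 1) (t + 1)) => //; first by lra.
  - by move=> x _; have [] := cutg_derive x.
  - by rewrite in_itv /=; apply/andP; split; lra.
  - by move=> x _; rewrite (cutG_eq0 th) step_ge0.
by move=> [_ h]; have [_ h'] := cutg_derive t; rewrite -h -h'.
Qed.

Lemma cutg_eq0r t : 1 <= t -> cutg t = 0.
Proof.
move=> th; have : is_derive t 1 cutG 0.
  apply: (@derive1_at_max _ cutG (t - 1) (t + 1)) => //; first by lra.
  - by move=> x _; have [] := cutg_derive x.
  - by rewrite in_itv /=; apply/andP; split; lra.
  - by move=> x _; rewrite (cutG_eq1 th) step_le1.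
by move=> [_ h]; have [_ h'] := cutg_derive t; rewrite -h -h'.
Qed.

(** The quotient rule, arranged so that only nonnegative terms remain and the sign of [cutg] can be
    read off. The derivative of [expinv 0] is [expinv 2]. *)
Lemma cutgE t : cutg t = 2 * ((expinv 2 (2 * t - 1) * expinv 0 (2 - 2 * t) +
  expinv 0 (2 * t - 1) * expinv 2 (2 - 2 * t)) /
  (expinv 0 (2 * t - 1) + expinv 0 (2 - 2 * t)) ^+ 2).
Proof.
have e2 (s : R) : expinv 2 s - 0%:R * expinv 1 s = expinv 2 s by rewrite mul0r subr0.
have d1 : is_derive t 1 (fun t : R => 2 * t - 1) 2.
  have h := is_deriveB (is_deriveZ (f := id) 2 (is_derive_id t (1 : R))) (is_derive_cst (1 : R) t (1 : R)).
  by apply: (is_derive_eq h); rewrite /GRing.scale /= mulr1 subr0.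
have d2 : is_derive t 1 (fun t : R => 1 - (2 * t - 1)) (- 2).
  have h := is_deriveB (is_derive_cst (1 : R) t (1 : R)) d1.
  by apply: (is_derive_eq h); rewrite sub0r.
have dn := @is_derive1_comp R (expinv 0) (fun t => 2 * t - 1) t _ _ (expinv_derive 0 (2 * t - 1)) d1.
have dd := @is_derive1_comp R (expinv 0) (fun t => 1 - (2 * t - 1)) t _ _ (expinv_derive 0 (1 - (2 * t - 1))) d2.
rewrite !e2 in dn dd.
have p0 := step_den_gt0 (2 * t - 1).
have h := is_deriveM dn (@is_deriveV _ _ t _ _ (lt0r_neq0 p0 : (_ + _ : R -> R) t != 0)
  (is_deriveD dn dd)).
have [_ <-] := cutg_derive t.
case: h => _ h; refine (etrans h _); rewrite !fctE /GRing.scale /=.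
have -> : 2 - 2 * t = 1 - (2 * t - 1) by ring.
move: (expinv 0 (2 * t - 1)) (expinv 0 (1 - (2 * t - 1))) (expinv 2 (2 * t - 1))
  (expinv 2 (1 - (2 * t - 1))) p0 {dn dd h} => a b c d p0.
by field; rewrite gt_eqF.
Qed.

Lemma cutg_ge0 t : 0 <= cutg t.
Proof.
rewrite cutgE mulr_ge0// divr_ge0 ?sqr_ge0// addr_ge0// mulr_ge0// expinv_ge0//.
Qed.

Lemma cutg_gt0 t : 1 / 2 < t -> t < 1 -> 0 < cutg t.
Proof.
move=> t1 t2; rewrite cutgE mulr_gt0// divr_gt0//.
  by rewrite addr_gt0// mulr_gt0// expinv_gt0//; lra.
by rewrite exprn_gt0// addr_gt0// expinv_gt0//; lra.
Qed.

Lemma smooth_bounded (f : R -> R) (a b : R) : smooth f ->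
  exists2 M, 0 <= M & forall t, a <= t <= b -> `|f t| <= M.
Proof.
move=> sf; have [ab|ab] := leP a b; last first.
  by exists 0 => // t /andP[h1 h2]; exfalso; lra.
have cf : {within `[a, b], continuous (fun t => `|f t|)}.
  apply: continuous_subspaceT => x.
  apply: (@continuous_comp _ _ _ f (fun y : R => `|y|)); last exact: norm_continuous.
  exact: smooth_continuous.
have [c _ fc] := EVT_max ab cf.
by exists `|f c| => // t tab; apply: fc; rewrite in_itv.
Qed.

End cutoff.

(** * Functions of class C^k on the plane *)

Section calculus2.
Context {R : realType}.
Local Notation mu2 := ((@lebesgue_measure R) \x (@lebesgue_measure R))%E.
Local Notation e1 := ((1, 0) : R * R).
Local Notation e2 := ((0, 1) : R * R).
Implicit Types (u v : R * R -> R) (p z w : R * R).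

(** A directional derivative is an ordinary derivative at 0 along a line, to which the one-variable
    chain rule applies. *)
Lemma is_derive_dirP (u : R * R -> R) (p v : R * R) (d : R) :
  is_derive p v u d <-> is_derive (0 : R) 1 (fun h : R => u (h *: v + p)) d.
Proof.
have E : (fun h : R => h^-1 *: ((u \o shift p) (h *: v) - u p)) =
    (fun h : R => h^-1 *: (((fun h : R => u (h *: v + p)) \o shift 0) (h *: (1 : R)) -
       u ((0 : R) *: v + p))).
  by rewrite funeqE => h /=; rewrite addr0 scale0r add0r [_%:A]mulr1.
split=> -[d1 d2]; split.
- by move: d1; rewrite /derivable E.
- by move: d2; rewrite /derive E.
- by move: d1; rewrite /derivable E.
- by move: d2; rewrite /derive E.
Qed.

Lemma is_derive_comp_dir (f : R -> R) u (p v : R * R) (d df : R) :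
  is_derive p v u d -> is_derive (u p) 1 f df -> is_derive p v (fun w => f (u w)) (df * d).
Proof.
move=> /is_derive_dirP du dff; apply/is_derive_dirP.
apply: (@is_derive1_comp _ f (fun h : R => u (h *: v + p))) => //.
by rewrite scale0r add0r.
Qed.

Lemma CkS k u u1 u2 : continuous u ->
  (forall p, is_derive p e1 u (u1 p)) -> (forall p, is_derive p e2 u (u2 p)) ->
  Ck k setT u1 -> Ck k setT u2 -> Ck k.+1 setT u.
Proof.
move=> cu d1 d2 c1 c2; split; first by move=> p _; exact: cu.
move=> v [->|->]; split.
- by move=> p _; case: (d1 p).
- by rewrite (_ : 'D_e1 u = u1)//; apply/funext => p; case: (d1 p).
- by move=> p _; case: (d2 p).
- by rewrite (_ : 'D_e2 u = u2)//; apply/funext => p; case: (d2 p).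
Qed.

Lemma Ck_continuous k u : Ck k setT u -> continuous u.
Proof. by case: k => [|k] [cu _] p; exact: cu. Qed.

Lemma Ck_d1 k u : Ck k.+1 setT u -> Ck k setT ('D_e1 u).
Proof. by move=> [_ /(_ e1 (or_introl erefl))[]]. Qed.

Lemma Ck_d2 k u : Ck k.+1 setT u -> Ck k setT ('D_e2 u).
Proof. by move=> [_ /(_ e2 (or_intror erefl))[]]. Qed.

Lemma Ck_is_derive1 k u p : Ck k.+1 setT u -> is_derive p e1 u ('D_e1 u p).
Proof. by move=> [_ /(_ e1 (or_introl erefl))[du _]]; exact/derivableP/du. Qed.

Lemma Ck_is_derive2 k u p : Ck k.+1 setT u -> is_derive p e2 u ('D_e2 u p).
Proof. by move=> [_ /(_ e2 (or_intror erefl))[du _]]; exact/derivableP/du. Qed.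

Lemma Ck_le k u : Ck k.+1 setT u -> Ck k setT u.
Proof.
elim: k u => [|k IH] u h; first by split => // p _; exact: (Ck_continuous h).
apply: (CkS (Ck_continuous h) (fun p => Ck_is_derive1 p h) (fun p => Ck_is_derive2 p h)).
  by apply: IH; exact: Ck_d1.
by apply: IH; exact: Ck_d2.
Qed.

Lemma Ck_cst k (c : R) : Ck k setT (fun=> c).
Proof.
elim: k c => [|k IH] c; first by split => // p _; exact: cst_continuous.
apply: (CkS (u1 := fun=> 0) (u2 := fun=> 0)) => // p.
exact: cst_continuous.
Qed.

Lemma Ck_add k u v : Ck k setT u -> Ck k setT v -> Ck k setT (fun p => u p + v p).
Proof.
elim: k u v => [|k IH] u v hu hv.
  split => // p _; apply: (@cvgD _ R^o); [exact: (Ck_continuous hu)|exact: (Ck_continuous hv)].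
apply: (CkS _ (fun p => is_deriveD (Ck_is_derive1 p hu) (Ck_is_derive1 p hv))
  (fun p => is_deriveD (Ck_is_derive2 p hu) (Ck_is_derive2 p hv))).
- by move=> p; apply: (@cvgD _ R^o); [exact: (Ck_continuous hu)|exact: (Ck_continuous hv)].
- by apply: IH; exact: Ck_d1.
- by apply: IH; exact: Ck_d2.
Qed.

Lemma Ck_mul k u v : Ck k setT u -> Ck k setT v -> Ck k setT (fun p => u p * v p).
Proof.
elim: k u v => [|k IH] u v hu hv.
  split => // p _; apply: cvgM; [exact: (Ck_continuous hu)|exact: (Ck_continuous hv)].
apply: (CkS _ (fun p => is_deriveM (Ck_is_derive1 p hu) (Ck_is_derive1 p hv))
  (fun p => is_deriveM (Ck_is_derive2 p hu) (Ck_is_derive2 p hv))).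
- by move=> p; apply: cvgM; [exact: (Ck_continuous hu)|exact: (Ck_continuous hv)].
- apply: Ck_add; first exact: (IH u ('D_e1 v) (Ck_le hu) (Ck_d1 hv)).
  exact: (IH v ('D_e1 u) (Ck_le hv) (Ck_d1 hu)).
- apply: Ck_add; first exact: (IH u ('D_e2 v) (Ck_le hu) (Ck_d2 hv)).
  exact: (IH v ('D_e2 u) (Ck_le hv) (Ck_d2 hu)).
Qed.

Lemma Dk_continuous k (f : R -> R) : Dk k f -> continuous f.
Proof.
move=> df x; apply: differentiable_continuous; apply/derivable1_diffP.
exact: Dk_derivable df.
Qed.

Lemma Ck_comp k (f : R -> R) u : Dk k f -> Ck k setT u -> Ck k setT (fun p => f (u p)).
Proof.
elim: k f u => [|k IH] f u df hu.
  split => // p _; apply: continuous_comp; [exact: (Ck_continuous hu)|exact: (Dk_continuous df)].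
apply: (CkS _ (fun p => is_derive_comp_dir (Ck_is_derive1 p hu) (Dk_is_derive (u p) df))
  (fun p => is_derive_comp_dir (Ck_is_derive2 p hu) (Dk_is_derive (u p) df))).
- by move=> p; apply: continuous_comp; [exact: (Ck_continuous hu)|exact: (Dk_continuous df)].
- apply: Ck_mul; last exact: Ck_d1.
  by apply: IH; [exact: Dk_derive1|exact: Ck_le].
- apply: Ck_mul; last exact: Ck_d2.
  by apply: IH; [exact: Dk_derive1|exact: Ck_le].
Qed.

Lemma is_derive_fst p (v : R * R) (c : R) : is_derive p v (fun w => w.1 - c) v.1.
Proof.
apply: (@is_derive_quad _ _ _ _ _ _ 0) => h /=.
rewrite (_ : _ - _ = 0) ?normr0 ?mul0r//; rewrite /GRing.scale /=; ring.
Qed.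

Lemma is_derive_snd p (v : R * R) (c : R) : is_derive p v (fun w => w.2 - c) v.2.
Proof.
apply: (@is_derive_quad _ _ _ _ _ _ 0) => h /=.
rewrite (_ : _ - _ = 0) ?normr0 ?mul0r//; rewrite /GRing.scale /=; ring.
Qed.

Lemma Ck_fst k (c : R) : Ck k setT (fun w : R * R => w.1 - c).
Proof.
have cc : continuous (fun w : R * R => w.1 - c).
  by move=> p; apply: (@cvgB _ R^o); [exact: cvg_fst|exact: cvg_cst].
case: k => [|k]; first by split => // p _; exact: cc.
by apply: (CkS cc (fun p => is_derive_fst p e1 c) (fun p => is_derive_fst p e2 c)); exact: Ck_cst.
Qed.

Lemma Ck_snd k (c : R) : Ck k setT (fun w : R * R => w.2 - c).
Proof.
have cc : continuous (fun w : R * R => w.2 - c).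
  by move=> p; apply: (@cvgB _ R^o); [exact: cvg_snd|exact: cvg_cst].
case: k => [|k]; first by split => // p _; exact: cc.
by apply: (CkS cc (fun p => is_derive_snd p e1 c) (fun p => is_derive_snd p e2 c)); exact: Ck_cst.
Qed.

(** Measurable sets of the plane come from the product of two Borel sigma-algebras; an open set is a
    countable union of squares with rational centres and radii 1/(n+1). *)
Lemma open_measurable2 (A : set (R * R)) : open A -> measurable A.
Proof.
move=> oA.
pose B (i : rat * rat * nat) : set (R * R) := box (ratr i.1.1, ratr i.1.2) i.2.+1%:R^-1.
have -> : A = \bigcup_(i in [set i | B i `<=` A]) B i.
  apply/seteqP; split => [p Ap|p [i Bi] /Bi //].
  have /nbhs_ballP[e /= e0 eA] : nbhs p A by exact: open_nbhs_nbhs.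
  have [n ne] : exists n, n.+1%:R^-1 < e / 2 :> R.
    by have [n _ /(_ _ (leqnn _))] := near_infty_natSinv_lt (PosNum (divr_gt0 e0 (ltr0n R 2))); exists n.
  have n0 : 0 < n.+1%:R^-1 :> R by rewrite invr_gt0.
  have [q1 h1] := rat_in_itvoo (ltr_pwDr n0 (lexx p.1)).
  have [q2 h2] := rat_in_itvoo (ltr_pwDr n0 (lexx p.2)).
  move: h1 h2; rewrite !in_itv /= => /andP[h1 h1'] /andP[h2 h2'].
  move: n0 h1' h2' ne; rewrite /B.
  have [d dE] : exists d : R, d = n.+1%:R^-1 by exists n.+1%:R^-1.
  rewrite -dE => n0 h1' h2' ne.
  exists (q1, q2, n); rewrite /= -dE.
    move=> w [w1 w2]; apply: eA; split; rewrite /ball /=.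
      have := ler_distD (ratr q1) p.1 w.1; rewrite /= in w1 *; rewrite (distrC w.1) in w1.
      have : `|p.1 - ratr q1| < d by rewrite ltr_norml; apply/andP; split; lra.
      lra.
    have := ler_distD (ratr q2) p.2 w.2; rewrite /= in w2 *; rewrite (distrC w.2) in w2.
    have : `|p.2 - ratr q2| < d by rewrite ltr_norml; apply/andP; split; lra.
    lra.
  by split => /=; rewrite ltr_norml; apply/andP; split; lra.
rewrite bigcup_mkcond; apply: countable_bigcupT_measurable => [|i].
  exact: countableP.
by case: ifP => _ //; exact: measurable_box.
Qed.

Lemma continuous_measurable2 u : continuous u -> measurable_fun setT u.
Proof.
move=> /continuousP cu; apply: (measurability _ (RGenOInfty.measurableE R)) => //.
move=> _ [_ [x ->] <-]; rewrite setTI; apply: open_measurable2.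
by apply: cu; exact: interval_open.
Qed.


Lemma derive_out u (K : set (R * R)) (v : R * R) p : closed K ->
  (forall w, ~ K w -> u w = 0) -> ~ K p -> 'D_v u p = 0.
Proof.
move=> cK uK Kp.
rewrite -[RHS](derive_cst (0 : R) v p); apply: near_eq_derive.
have : nbhs p (~` K) by apply: open_nbhs_nbhs; split => //; exact: closed_openC.
by apply: filterS => w /uK.
Qed.

Definition bsupp u (B : R) : Prop := forall p, ~ box 0 B p -> u p = 0.

Definition cbox z r : set (R * R) :=
  [set p | `|p.1 - z.1| <= r /\ `|p.2 - z.2| <= r].

Lemma cboxE z r :
  cbox z r = `[z.1 - r, z.1 + r]%classic `*` `[z.2 - r, z.2 + r]%classic.
Proof.
apply/seteqP; split => p /=; rewrite /cbox /= !in_itv /= !ler_distl.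
  by move=> [-> ->].
by move=> [/andP[-> ->] /andP[-> ->]].
Qed.

Lemma compact_cbox z r : compact (cbox z r).
Proof. by rewrite cboxE; apply: compact_setX; exact: segment_compact. Qed.

Lemma closed_cbox z r : closed (cbox z r).
Proof. by apply: compact_closed; [exact: norm_hausdorff|exact: compact_cbox]. Qed.

Lemma continuous_bounded_box u z r : continuous u -> 0 <= r ->
  exists2 M, 0 <= M & forall p, cbox z r p -> `|u p| <= M.
Proof.
move=> cu r0.
have cf : {within cbox z r, continuous (fun p => `|u p|)}.
  apply: continuous_subspaceT => x.
  apply: (@continuous_comp _ _ _ u (fun y : R => `|y|)); last exact: norm_continuous.
  exact: cu.
have z0 : cbox z r !=set0 by exists z; split; rewrite subrr normr0.
have [c _ fc] := compact_EVT_max z0 (@compact_cbox z r) cf.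
by exists `|u c| => // t tz; apply: fc; rewrite inE.
Qed.

Lemma box_cbox z r : box z r `<=` cbox z r.
Proof. by move=> p [p1 p2]; split; exact: ltW. Qed.

Lemma continuous_bsupp_integrable u B : continuous u -> bsupp u B -> 0 <= B ->
  pintegrable u.
Proof.
move=> cu uB B0; have [M M0 hM] := continuous_bounded_box 0 cu B0.
apply: (pintegrable_le _ (pintegrableZ M (pintegrable_bx 0 B))).
  exact: continuous_measurable2.
move=> p; have [pB|pB] := pselect (box 0 B p).
  by rewrite bx_in// mulr1 hM//; exact: box_cbox.
by rewrite (uB _ pB) normr0 mulr_ge0// bx_ge0.
Qed.

Lemma pint_fubini12 u : pintegrable u ->
  pint u = fine (\int[@lebesgue_measure R]_x \int[@lebesgue_measure R]_y (u (x, y))%:E)%E.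
Proof.
move=> iu; rewrite /pint /Rintegral; congr fine.
exact: esym (@integral12_prod_meas1 _ _ _ _ R (@lebesgue_measure R) (@lebesgue_measure R) _ iu).
Qed.

Lemma pint_fubini21 u : pintegrable u ->
  pint u = fine (\int[@lebesgue_measure R]_y \int[@lebesgue_measure R]_x (u (x, y))%:E)%E.
Proof.
move=> iu; rewrite /pint /Rintegral; congr fine.
exact: esym (@integral21_prod_meas1 _ _ _ _ R (@lebesgue_measure R) (@lebesgue_measure R) _ iu).
Qed.

Lemma integral_derive0 (f : R -> R) (df : R -> R) (B : R) : 0 < B ->
  (forall x : R, is_derive x 1 f (df x)) -> continuous df ->
  (forall x, B <= `|x| -> f x = 0) -> (forall x, B <= `|x| -> df x = 0) ->
  (\int[@lebesgue_measure R]_x (df x)%:E = 0)%E.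
Proof.
move=> B0 fdf cdf f0 df0.
have -> : (\int[@lebesgue_measure R]_x (df x)%:E =
    \int[@lebesgue_measure R]_(x in `[(- B)%R, B]) (df x)%:E)%E.
  rewrite [RHS]integral_mkcond; apply: eq_integral => x _.
  rewrite patchE; case: ifPn => //; rewrite notin_setE /= in_itv /= => /negP nx.
  rewrite df0//; have := nx; rewrite -ler_norml -ltNge; exact: ltW.
have cf : continuous f.
  by move=> x; apply: differentiable_continuous; apply/derivable1_diffP; case: (fdf x).
rewrite (@continuous_FTC2 _ df f); first 1 last.
- by lra.
- exact: continuous_subspaceT.
- split.
  + by move=> x _; case: (fdf x).
  + by apply: cvg_at_right_filter; exact: cf.
  + by apply: cvg_at_left_filter; exact: cf.
- by move=> x _; rewrite derive1E; case: (fdf x).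
by rewrite !f0 ?normrN ?ger0_norm ?(ltW B0)// subee.
Qed.

Lemma continuous_sec1 u (y : R) : continuous u -> continuous (fun x => u (x, y)).
Proof.
move=> cu x.
have h : u (z.1, z.2) @[z --> (x, y)] --> u (x, y).
  by rewrite (_ : (fun z => u (z.1, z.2)) = u); [exact: cu|apply/funext => -[]].
exact: (@continuous2_cvg _ _ _ _ _ _ id (fun=> y) (fun a b => u (a, b)) x y h cvg_id (cvg_cst y)).
Qed.

Lemma continuous_sec2 u (x : R) : continuous u -> continuous (fun y => u (x, y)).
Proof.
move=> cu y.
have h : u (z.1, z.2) @[z --> (x, y)] --> u (x, y).
  by rewrite (_ : (fun z => u (z.1, z.2)) = u); [exact: cu|apply/funext => -[]].
exact: (@continuous2_cvg _ _ _ _ _ _ (fun=> x) id (fun a b => u (a, b)) x y h (cvg_cst x) cvg_id).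
Qed.

(** All integrations by parts in the plane reduce to this: the inner integral of a derivative with
    bounded support is zero. *)
Lemma pint_derive1 u (u1 : R * R -> R) B : 0 < B ->
  (forall p, is_derive p e1 u (u1 p)) -> continuous u1 -> bsupp u B -> bsupp u1 B ->
  pint u1 = 0.
Proof.
move=> B0 du cu1 uB u1B.
rewrite pint_fubini21; last exact: (continuous_bsupp_integrable cu1 u1B (ltW B0)).
rewrite integral0_eq// => y _.
apply: (@integral_derive0 (fun x => u (x, y)) _ B) => //.
- move=> x; have /is_derive_dirP := du (x, y).
  move=> h; rewrite /=.
  have := @is_derive1_comp _ (fun h : R => u (h *: e1 + (x, y))) (fun t => t - x) x _ _.
  have d1 : is_derive x 1 (fun t : R => t - x) 1.
    have := is_deriveB (is_derive_id x (1 : R)) (is_derive_cst x x (1 : R)).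
    by rewrite subr0.
  rewrite subrr => /(_ _ _ h d1); rewrite mulr1.
  congr is_derive; apply/funext => t /=; congr u; congr pair; rewrite /GRing.scale /= ?[_%:A]mulr1 ?scaler0 ?add0r ?subrK//.
- exact: continuous_sec1.
- by move=> x Bx; apply: uB => -[]; rewrite /= subr0 ltNge Bx.
- by move=> x Bx; apply: u1B => -[]; rewrite /= subr0 ltNge Bx.
Qed.

Lemma pint_derive2 u (u2 : R * R -> R) B : 0 < B ->
  (forall p, is_derive p e2 u (u2 p)) -> continuous u2 -> bsupp u B -> bsupp u2 B ->
  pint u2 = 0.
Proof.
move=> B0 du cu2 uB u2B.
rewrite pint_fubini12; last exact: (continuous_bsupp_integrable cu2 u2B (ltW B0)).
rewrite integral0_eq// => x _.
apply: (@integral_derive0 (fun y => u (x, y)) _ B) => //.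
- move=> y; have /is_derive_dirP := du (x, y).
  move=> h; rewrite /=.
  have := @is_derive1_comp _ (fun h : R => u (h *: e2 + (x, y))) (fun t => t - y) y _ _.
  have d1 : is_derive y 1 (fun t : R => t - y) 1.
    have := is_deriveB (is_derive_id y (1 : R)) (is_derive_cst y y (1 : R)).
    by rewrite subr0.
  rewrite subrr => /(_ _ _ h d1); rewrite mulr1.
  congr is_derive; apply/funext => t /=; congr u; congr pair; rewrite /GRing.scale /= ?[_%:A]mulr1 ?scaler0 ?add0r ?subrK//.
- exact: continuous_sec2.
- by move=> y By; apply: uB => -[]; rewrite /= !subr0 => _; rewrite ltNge By.
- by move=> y By; apply: u2B => -[]; rewrite /= !subr0 => _; rewrite ltNge By.
Qed.

End calculus2.

(** * Radial kernels and the weak Cauchy-Riemann system *)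

Section radial.
Context {R : realType}.
Local Notation mu2 := ((@lebesgue_measure R) \x (@lebesgue_measure R))%E.
Local Notation e1 := ((1, 0) : R * R).
Local Notation e2 := ((0, 1) : R * R).
Implicit Types (u v : R * R -> R) (p z w d : R * R).

Lemma is_derive_shiftB u (p v z : R * R) (du : R) :
  is_derive (p - z) v u du -> is_derive p v (fun w => u (w - z)) du.
Proof.
move=> /is_derive_dirP h; apply/is_derive_dirP.
by have := h; congr is_derive; apply/funext => t; rewrite addrA.
Qed.

Lemma Ck_shift k u z : Ck k setT u -> Ck k setT (fun w => u (w - z)).
Proof.
have cs : continuous (fun w : R * R => w - z).
  by move=> p; apply: (@cvgB _ (R * R)%type); [exact: cvg_id|exact: cvg_cst].
elim: k u => [|k IH] u hu.
  by split => // p _; apply: continuous_comp; [exact: cs|exact: (Ck_continuous hu)].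
apply: (CkS _ (fun p => is_derive_shiftB (Ck_is_derive1 (p - z) hu))
  (fun p => is_derive_shiftB (Ck_is_derive2 (p - z) hu))).
- by move=> p; apply: continuous_comp; [exact: cs|exact: (Ck_continuous hu)].
- by apply: (IH ('D_e1 u)); exact: Ck_d1.
- by apply: (IH ('D_e2 u)); exact: Ck_d2.
Qed.

Definition nrm2 d : R := d.1 ^+ 2 + d.2 ^+ 2.

Lemma Ck_p1 k : Ck k setT (fun d : R * R => d.1).
Proof. by have := @Ck_fst R k 0; congr Ck; apply/funext => d; rewrite subr0. Qed.

Lemma Ck_p2 k : Ck k setT (fun d : R * R => d.2).
Proof. by have := @Ck_snd R k 0; congr Ck; apply/funext => d; rewrite subr0. Qed.

Lemma is_derive_p1 d (v : R * R) : is_derive d v (fun d : R * R => d.1) v.1.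
Proof. by have := @is_derive_fst R d v 0; congr is_derive; apply/funext => w; rewrite subr0. Qed.

Lemma is_derive_p2 d (v : R * R) : is_derive d v (fun d : R * R => d.2) v.2.
Proof. by have := @is_derive_snd R d v 0; congr is_derive; apply/funext => w; rewrite subr0. Qed.

Lemma Ck_nrm2 k : Ck k setT nrm2.
Proof.
rewrite (_ : nrm2 = (fun d => d.1 * d.1 + d.2 * d.2)).
  by apply: Ck_add; apply: Ck_mul; (exact: Ck_p1 || exact: Ck_p2).
by apply/funext => d; rewrite /nrm2 !expr2.
Qed.

Lemma is_derive_nrm2 d (v : R * R) : is_derive d v nrm2 (2 * (d.1 * v.1 + d.2 * v.2)).
Proof.
rewrite (_ : nrm2 = (fun d => d.1 * d.1 + d.2 * d.2)); last first.
  by apply/funext => w; rewrite /nrm2 !expr2.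
have h1 := is_deriveM (is_derive_p1 d v) (is_derive_p1 d v).
have h2 := is_deriveM (is_derive_p2 d v) (is_derive_p2 d v).
by apply: (is_derive_eq (is_deriveD h1 h2)); rewrite /GRing.scale /=; ring.
Qed.

Lemma pint_half2 (f g h k : R * R -> R) :
  pintegrable f -> pintegrable g -> pintegrable h -> pintegrable k ->
  pint f = pint g -> pint h = pint k ->
  pint (fun w => 2^-1 * (f w - g w) + 2^-1 * (h w - k w)) = 0.
Proof.
move=> i1 i2 i3 i4 fg hk; rewrite pintD; first last.
- by apply: pintegrableZ; exact: pintegrableB.
- by apply: pintegrableZ; exact: pintegrableB.
rewrite pintZ; last exact: pintegrableB.
rewrite pintZ; last exact: pintegrableB.
by rewrite !pintB// fg hk !subrr !mulr0 addr0.
Qed.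

Lemma pint_diff2 (f g h k : R * R -> R) :
  pintegrable f -> pintegrable g -> pintegrable h -> pintegrable k ->
  pint f = pint g -> pint h = pint k ->
  pint (fun w => (f w - g w) + (h w - k w)) = 0.
Proof.
move=> i1 i2 i3 i4 fg hk; rewrite pintD; first last.
- exact: pintegrableB.
- exact: pintegrableB.
by rewrite !pintB// fg hk !subrr addr0.
Qed.

Section profile.
Variable q : R -> R.
Hypothesis sq : smooth q.
Let q1 := derive1 q.
Let q2 := derive1 q1.

(* The radial field [(rX, rY)] and its partial derivatives; [rXY] is also the
   x-derivative of [rY]. *)
Definition rX d : R := d.1 * q (nrm2 d).
Definition rY d : R := d.2 * q (nrm2 d).
Definition rXX d : R := q (nrm2 d) + 2 * d.1 ^+ 2 * q1 (nrm2 d).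
Definition rYY d : R := q (nrm2 d) + 2 * d.2 ^+ 2 * q1 (nrm2 d).
Definition rXY d : R := 2 * d.1 * d.2 * q1 (nrm2 d).
Definition rXXY d : R := 2 * d.2 * q1 (nrm2 d) + 4 * d.1 ^+ 2 * d.2 * q2 (nrm2 d).
Definition rXYY d : R := 2 * d.1 * q1 (nrm2 d) + 4 * d.1 * d.2 ^+ 2 * q2 (nrm2 d).

Let sq1 : smooth q1. Proof. exact: smooth_derive1. Qed.

Lemma Ck_rad (f : R -> R) k : smooth f -> Ck k setT (fun d => f (nrm2 d)).
Proof. by move=> sf; apply: Ck_comp; [exact: sf|exact: Ck_nrm2]. Qed.

Lemma is_derive_rad (f : R -> R) d (v : R * R) : smooth f ->
  is_derive d v (fun d => f (nrm2 d)) (derive1 f (nrm2 d) * (2 * (d.1 * v.1 + d.2 * v.2))).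
Proof.
by move=> sf; apply: is_derive_comp_dir (smooth_is_derive _ sf); exact: is_derive_nrm2.
Qed.

Lemma Ck_rX k : Ck k setT rX.
Proof. by apply: Ck_mul; [exact: Ck_p1|exact: Ck_rad]. Qed.

Lemma Ck_rY k : Ck k setT rY.
Proof. by apply: Ck_mul; [exact: Ck_p2|exact: Ck_rad]. Qed.

Lemma rXX_derive d : is_derive d e1 rX (rXX d).
Proof.
have h := is_deriveM (is_derive_p1 d e1) (is_derive_rad d e1 sq).
by apply: (is_derive_eq h); rewrite /GRing.scale /rXX /q1 /=; ring.
Qed.

Lemma rXY_derive d : is_derive d e2 rX (rXY d).
Proof.
have h := is_deriveM (is_derive_p1 d e2) (is_derive_rad d e2 sq).
by apply: (is_derive_eq h); rewrite /GRing.scale /rXY /q1 /=; ring.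
Qed.

Lemma rYY_derive d : is_derive d e2 rY (rYY d).
Proof.
have h := is_deriveM (is_derive_p2 d e2) (is_derive_rad d e2 sq).
by apply: (is_derive_eq h); rewrite /GRing.scale /rYY /q1 /=; ring.
Qed.

Lemma D1rX : 'D_e1 rX = rXX.
Proof. by apply/funext => d; case: (rXX_derive d). Qed.

Lemma D2rX : 'D_e2 rX = rXY.
Proof. by apply/funext => d; case: (rXY_derive d). Qed.

Lemma D2rY : 'D_e2 rY = rYY.
Proof. by apply/funext => d; case: (rYY_derive d). Qed.

Lemma Ck_rXX k : Ck k setT rXX. Proof. by rewrite -D1rX; exact: Ck_d1 (Ck_rX k.+1). Qed.
Lemma Ck_rXY k : Ck k setT rXY. Proof. by rewrite -D2rX; exact: Ck_d2 (Ck_rX k.+1). Qed.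
Lemma Ck_rYY k : Ck k setT rYY. Proof. by rewrite -D2rY; exact: Ck_d2 (Ck_rY k.+1). Qed.

Lemma is_derive_quadratic (c : R) (m : R * R -> R) d (v : R * R) (dm : R) (f g : R -> R) :
  smooth f -> smooth g -> is_derive d v m dm ->
  is_derive d v (fun d => c * f (nrm2 d) + m d * g (nrm2 d))
    (c * (derive1 f (nrm2 d) * (2 * (d.1 * v.1 + d.2 * v.2))) +
     (dm * g (nrm2 d) + m d * (derive1 g (nrm2 d) * (2 * (d.1 * v.1 + d.2 * v.2))))).
Proof.
move=> sf sg hm.
have h1 := is_deriveZ c (is_derive_rad d v sf).
have h2 := is_deriveM hm (is_derive_rad d v sg).
by apply: (is_derive_eq (is_deriveD h1 h2)); rewrite /GRing.scale /=; ring.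
Qed.

Lemma is_derive_mono d (v : R * R) (a b c : R) :
  is_derive d v (fun d : R * R => a * (d.1 * d.1) + b * (d.1 * d.2) + c * (d.2 * d.2))
   (2 * a * d.1 * v.1 + b * (d.1 * v.2 + d.2 * v.1) + 2 * c * d.2 * v.2).
Proof.
have h1 := is_deriveM (is_derive_p1 d v) (is_derive_p1 d v).
have h2 := is_deriveM (is_derive_p2 d v) (is_derive_p2 d v).
have h3 := is_deriveM (is_derive_p1 d v) (is_derive_p2 d v).
have h := is_deriveD (is_deriveD (is_deriveZ a h1) (is_deriveZ b h3)) (is_deriveZ c h2).
by apply: (is_derive_eq h); rewrite /GRing.scale /=; ring.
Qed.

Lemma rXXY_derive d : is_derive d e2 rXX (rXXY d).
Proof.
have h := is_derive_quadratic 1 sq sq1 (is_derive_mono d e2 2 0 0).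
rewrite (_ : rXX = (fun d => 1 * q (nrm2 d) +
  (2 * (d.1 * d.1) + 0 * (d.1 * d.2) + 0 * (d.2 * d.2)) * q1 (nrm2 d))).
  by apply: (is_derive_eq h); rewrite /rXXY /q2 /q1 /=; ring.
by apply/funext => w; rewrite /rXX; ring.
Qed.

Lemma rXYX_derive d : is_derive d e1 rXY (rXXY d).
Proof.
have h := is_derive_quadratic 0 sq sq1 (is_derive_mono d e1 0 2 0).
rewrite (_ : rXY = (fun d => 0 * q (nrm2 d) +
  (0 * (d.1 * d.1) + 2 * (d.1 * d.2) + 0 * (d.2 * d.2)) * q1 (nrm2 d))).
  by apply: (is_derive_eq h); rewrite /rXXY /q2 /q1 /=; ring.
by apply/funext => w; rewrite /rXY; ring.
Qed.

Lemma rXYY_derive d : is_derive d e2 rXY (rXYY d).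
Proof.
have h := is_derive_quadratic 0 sq sq1 (is_derive_mono d e2 0 2 0).
rewrite (_ : rXY = (fun d => 0 * q (nrm2 d) +
  (0 * (d.1 * d.1) + 2 * (d.1 * d.2) + 0 * (d.2 * d.2)) * q1 (nrm2 d))).
  by apply: (is_derive_eq h); rewrite /rXYY /q2 /q1 /=; ring.
by apply/funext => w; rewrite /rXY; ring.
Qed.

Lemma rYYX_derive d : is_derive d e1 rYY (rXYY d).
Proof.
have h := is_derive_quadratic 1 sq sq1 (is_derive_mono d e1 0 0 2).
rewrite (_ : rYY = (fun d => 1 * q (nrm2 d) +
  (0 * (d.1 * d.1) + 0 * (d.1 * d.2) + 2 * (d.2 * d.2)) * q1 (nrm2 d))).
  by apply: (is_derive_eq h); rewrite /rXYY /q2 /q1 /=; ring.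
by apply/funext => w; rewrite /rYY; ring.
Qed.

Lemma D2rXY : 'D_e2 rXY = rXYY.
Proof. by apply/funext => d; case: (rXYY_derive d). Qed.

Lemma Ck_rXYY k : Ck k setT rXYY. Proof. by rewrite -D2rXY; exact: Ck_d2 (Ck_rXY k.+1). Qed.

Variable r : R.
Hypothesis r0 : 0 < r.
Hypothesis qr : forall t, r ^+ 2 <= t -> q t = 0.

Definition csupp u := forall d, ~ cbox 0 r d -> u d = 0.

Lemma csupp_rX : csupp rX.
Proof.
move=> d nd; rewrite /rX qr ?mulr0//; apply: contra_notP nd => /negP; rewrite -ltNge /nrm2 => h.
rewrite /cbox /= !subr0; split.
  rewrite -ler_sqr ?nnegrE ?(ltW r0)// real_normK ?num_real//.
  by have := sqr_ge0 d.2; lra.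
rewrite -ler_sqr ?nnegrE ?(ltW r0)// real_normK ?num_real//.
by have := sqr_ge0 d.1; lra.
Qed.

Lemma csupp_rY : csupp rY.
Proof.
move=> d nd; rewrite /rY qr ?mulr0//; apply: contra_notP nd => /negP; rewrite -ltNge /nrm2 => h.
rewrite /cbox /= !subr0; split.
  rewrite -ler_sqr ?nnegrE ?(ltW r0)// real_normK ?num_real//.
  by have := sqr_ge0 d.2; lra.
rewrite -ler_sqr ?nnegrE ?(ltW r0)// real_normK ?num_real//.
by have := sqr_ge0 d.1; lra.
Qed.

Lemma csupp_derive u (v : R * R) : csupp u -> csupp ('D_v u).
Proof. by move=> su d nd; apply: (derive_out v (@closed_cbox _ 0 r) su nd). Qed.

Lemma csupp_rXX : csupp rXX. Proof. by rewrite -D1rX; exact: csupp_derive csupp_rX. Qed.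
Lemma csupp_rXY : csupp rXY. Proof. by rewrite -D2rX; exact: csupp_derive csupp_rX. Qed.
Lemma csupp_rYY : csupp rYY. Proof. by rewrite -D2rY; exact: csupp_derive csupp_rY. Qed.
Lemma cbox_shift z w : cbox 0 r (w - z) <-> cbox z r w.
Proof. by rewrite /cbox /= !subr0. Qed.

Lemma test_function_shift (D : set (R * R)) u z : (forall k, Ck k setT u) -> csupp u ->
  cbox z r `<=` D -> test_function D (fun w => u (w - z)).
Proof.
move=> cu su zD; split; first by move=> k; exact: Ck_shift.
exists (cbox z r); split => //; first exact: compact_cbox.
by move=> p np; apply: su => /cbox_shift.
Qed.

Lemma bsupp_shift u z : csupp u -> bsupp (fun w => u (w - z)) (`|z.1| + `|z.2| + r + 1).
Proof.
move=> su p np; apply: su => /cbox_shift -[p1 p2]; apply: np.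
have := normr_ge0 z.1; have := normr_ge0 z.2 => h1 h2.
split; rewrite subr0.
  have := ler_normD (p.1 - z.1) z.1; rewrite subrK; lra.
have := ler_normD (p.2 - z.2) z.2; rewrite subrK; lra.
Qed.

Arguments bsupp_shift {u} z _ p _.

Lemma kern_shift u : continuous u -> csupp u ->
  exists C, kern (fun w z => u (w - z)) C (2 * r).
Proof.
move=> cu su; have [M M0 uM] := continuous_bounded_box 0 cu (ltW r0).
exists M; split; last 2 first.
- by rewrite mulr_ge0// ltW.
- move=> w z; have [wz|wz] := pselect (cbox 0 r (w - z)).
    rewrite bx_in ?mulr1 ?uM//; case: wz; rewrite /= !subr0 => h1 h2.
    by split; [apply: (le_lt_trans h1)|apply: (le_lt_trans h2)]; rewrite ltr_pMl ?ltr1n.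
  by rewrite su// normr0 mulr_ge0// bx_ge0.
apply: (measurableT_comp (f := u)); first exact: continuous_measurable2.
apply/measurable_fun_pairP; split.
  by apply: measurable_funB; apply: measurableT_comp.
by apply: measurable_funB; apply: measurableT_comp.
Qed.

Lemma pint_shift_integrable u z : continuous u -> csupp u -> pintegrable (fun w => u (w - z)).
Proof.
by move=> cu su; have [C kC] := kern_shift cu su; apply: sqic_integrable; split;
  [exact: (kern_sqi kC z)|exists (`|z.1| + `|z.2| + r + 1); exact: bsupp_shift].
Qed.

Lemma pint_XX0 z : pint (fun w => rXX (w - z)) = 0.
Proof.
have B0 : 0 < `|z.1| + `|z.2| + r + 1.
  by have := r0; have := normr_ge0 z.1; have := normr_ge0 z.2; lra.
apply: (pint_derive1 B0 (u := fun w => rX (w - z))).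
- by move=> p; apply: is_derive_shiftB; exact: rXX_derive.
- exact: Ck_continuous (Ck_shift z (Ck_rXX 0)).
- exact: (bsupp_shift z csupp_rX).
- exact: (bsupp_shift z csupp_rXX).
Qed.

Lemma pint_YY0 z : pint (fun w => rYY (w - z)) = 0.
Proof.
have B0 : 0 < `|z.1| + `|z.2| + r + 1.
  by have := r0; have := normr_ge0 z.1; have := normr_ge0 z.2; lra.
apply: (pint_derive2 B0 (u := fun w => rY (w - z))).
- by move=> p; apply: is_derive_shiftB; exact: rYY_derive.
- exact: Ck_continuous (Ck_shift z (Ck_rYY 0)).
- exact: (bsupp_shift z csupp_rY).
- exact: (bsupp_shift z csupp_rYY).
Qed.

Lemma pint_XY0 z : pint (fun w => rXY (w - z)) = 0.
Proof.
have B0 : 0 < `|z.1| + `|z.2| + r + 1.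
  by have := r0; have := normr_ge0 z.1; have := normr_ge0 z.2; lra.
apply: (pint_derive2 B0 (u := fun w => rX (w - z))).
- by move=> p; apply: is_derive_shiftB; exact: rXY_derive.
- exact: Ck_continuous (Ck_shift z (Ck_rXY 0)).
- exact: (bsupp_shift z csupp_rX).
- exact: (bsupp_shift z csupp_rXY).
Qed.

Lemma csupp_prod_integrable k u v z z' : Ck k setT u -> Ck k setT v -> csupp u ->
  pintegrable (fun w => u (w - z) * v (w - z')).
Proof.
move=> cu cv su; apply: (@continuous_bsupp_integrable _ _ (`|z.1| + `|z.2| + r + 1)).
- by apply: (@Ck_continuous _ k); apply: Ck_mul; exact: Ck_shift.
- by move=> p np; rewrite (bsupp_shift z su _ np) mul0r.
- by have := r0; have := normr_ge0 z.1; have := normr_ge0 z.2; lra.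
Qed.

(* Integration by parts twice: both sides equal minus the integral of
   [rX] against the mixed derivative [rXYY]. *)
Lemma pint_XXYY z z' :
  pint (fun w => rXX (w - z) * rYY (w - z')) = pint (fun w => rXY (w - z) * rXY (w - z')).
Proof.
have B0 : 0 < `|z.1| + `|z.2| + r + 1.
  by have := r0; have := normr_ge0 z.1; have := normr_ge0 z.2; lra.
have bs u v : csupp u -> bsupp (fun w => u (w - z) * v (w - z')) (`|z.1| + `|z.2| + r + 1).
  by move=> su p np; rewrite (bsupp_shift z su _ np) mul0r.
have i1 := csupp_prod_integrable z z' (Ck_rX 0) (Ck_rXYY 0) csupp_rX.
have i2 := csupp_prod_integrable z z' (Ck_rXX 0) (Ck_rYY 0) csupp_rXX.
have i3 := csupp_prod_integrable z z' (Ck_rXY 0) (Ck_rXY 0) csupp_rXY.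
have E1 : pint (fun w => rX (w - z) * rXYY (w - z') + rXX (w - z) * rYY (w - z')) = 0.
  apply: (pint_derive1 B0 (u := fun w => rX (w - z) * rYY (w - z'))).
  - move=> p; have h := is_deriveM (is_derive_shiftB (rXX_derive (p - z)))
      (is_derive_shiftB (rYYX_derive (p - z'))).
    by apply: (is_derive_eq h); rewrite /GRing.scale /=; ring.
  - apply: (@Ck_continuous _ 0); apply: Ck_add; apply: Ck_mul; apply: Ck_shift;
      (exact: Ck_rX || exact: Ck_rXYY || exact: Ck_rXX || exact: Ck_rYY).
  - exact: (bs _ _ csupp_rX).
  - by move=> p np; rewrite (bs _ _ csupp_rX p np) (bs _ _ csupp_rXX p np) addr0.
have E2 : pint (fun w => rX (w - z) * rXYY (w - z') + rXY (w - z) * rXY (w - z')) = 0.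
  apply: (pint_derive2 B0 (u := fun w => rX (w - z) * rXY (w - z'))).
  - move=> p; have h := is_deriveM (is_derive_shiftB (rXY_derive (p - z)))
      (is_derive_shiftB (rXYY_derive (p - z'))).
    by apply: (is_derive_eq h); rewrite /GRing.scale /=; ring.
  - apply: (@Ck_continuous _ 0); apply: Ck_add; apply: Ck_mul; apply: Ck_shift;
      (exact: Ck_rX || exact: Ck_rXYY || exact: Ck_rXY).
  - exact: (bs _ _ csupp_rX).
  - by move=> p np; rewrite (bs _ _ csupp_rX p np) (bs _ _ csupp_rXY p np) addr0.
move: E1 E2; rewrite !pintD// => E1 E2.
by apply: (addrI (pint (fun w => rX (w - z) * rXYY (w - z')))); rewrite E1 E2.
Qed.

(* With w = rX + i rY, [kP] is dw/dz and [kS1 - i kS2] is dw/dzbar. *)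
Definition kP d : R := (rXX d + rYY d) / 2.
Definition kS1 d : R := (rXX d - rYY d) / 2.
Definition kS2 d : R := - rXY d.

(** The autocorrelation of P minus that of S is half of the sum of two expressions XX YY' - XY XY',
    each with integral zero by [pint_XXYY]. This plays the part of Plancherel with a multiplier of
    modulus one. *)
Lemma kP_corr z z' :
  pint (fun w => kP (w - z) * kP (w - z') - kS1 (w - z) * kS1 (w - z')
     - kS2 (w - z) * kS2 (w - z')) = 0.
Proof.
rewrite (_ : (fun w => _) = (fun w =>
    2^-1 * (rXX (w - z) * rYY (w - z') - rXY (w - z) * rXY (w - z')) +
    2^-1 * (rXX (w - z') * rYY (w - z) - rXY (w - z') * rXY (w - z)))); last first.
  by apply/funext => w; rewrite /kP /kS1 /kS2; field.
apply: pint_half2.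
- exact: csupp_prod_integrable (Ck_rXX 0) (Ck_rYY 0) csupp_rXX.
- exact: csupp_prod_integrable (Ck_rXY 0) (Ck_rXY 0) csupp_rXY.
- exact: csupp_prod_integrable (Ck_rXX 0) (Ck_rYY 0) csupp_rXX.
- exact: csupp_prod_integrable (Ck_rXY 0) (Ck_rXY 0) csupp_rXY.
- exact: pint_XXYY.
- exact: pint_XXYY.
Qed.

(** The value of (t q)' at t = |d|^2, half the divergence of the field d q(|d|^2). A prescribed
    radial kernel is thus obtained by dividing a primitive of its profile by t. *)
Lemma kPE d : kP d = q (nrm2 d) + nrm2 d * q1 (nrm2 d).
Proof.
have -> : nrm2 d * q1 (nrm2 d) = (d.1 ^+ 2 + d.2 ^+ 2) * q1 (nrm2 d) by [].
by rewrite /kP /rXX /rYY; field.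
Qed.

Lemma csupp_kP : csupp kP.
Proof. by move=> d nd; rewrite /kP csupp_rXX// csupp_rYY// addr0 mul0r. Qed.

Lemma csupp_kS1 : csupp kS1.
Proof. by move=> d nd; rewrite /kS1 csupp_rXX// csupp_rYY// subrr mul0r. Qed.

Lemma csupp_kS2 : csupp kS2.
Proof. by move=> d nd; rewrite /kS2 csupp_rXY// oppr0. Qed.

Lemma continuous_kP : continuous kP.
Proof.
apply: (@Ck_continuous _ 0); rewrite (_ : kP = (fun d => (rXX d + rYY d) * 2^-1))//.
by apply: Ck_mul; [apply: Ck_add; [exact: Ck_rXX|exact: Ck_rYY]|exact: Ck_cst].
Qed.

Lemma continuous_kS1 : continuous kS1.
Proof.
apply: (@Ck_continuous _ 0).
rewrite (_ : kS1 = (fun d => (rXX d + (-1) * rYY d) * 2^-1)); last first.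
  by apply/funext => d; rewrite /kS1 mulN1r.
apply: Ck_mul; last exact: Ck_cst.
by apply: Ck_add; [exact: Ck_rXX|apply: Ck_mul; [exact: Ck_cst|exact: Ck_rYY]].
Qed.

Lemma continuous_kS2 : continuous kS2.
Proof.
apply: (@Ck_continuous _ 0).
rewrite (_ : kS2 = (fun d => (-1) * rXY d)); last by apply/funext => d; rewrite /kS2 mulN1r.
by apply: Ck_mul; [exact: Ck_cst|exact: Ck_rXY].
Qed.

Lemma nrm2N d : nrm2 (- d) = nrm2 d.
Proof. by rewrite /nrm2 /= !sqrrN. Qed.

Lemma rXX_even d : rXX (- d) = rXX d.
Proof. by rewrite /rXX nrm2N /= sqrrN. Qed.

Lemma rYY_even d : rYY (- d) = rYY d.
Proof. by rewrite /rYY nrm2N /= sqrrN. Qed.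

Lemma rXY_even d : rXY (- d) = rXY d.
Proof. by rewrite /rXY nrm2N /=; ring. Qed.

Lemma kP_sym z w : kP (w - z) = kP (z - w).
Proof. by rewrite /kP -(opprB z w) rXX_even rYY_even. Qed.

Lemma kS1_sym z w : kS1 (w - z) = kS1 (z - w).
Proof. by rewrite /kS1 -(opprB z w) rXX_even rYY_even. Qed.

Lemma kS2_sym z w : kS2 (w - z) = kS2 (z - w).
Proof. by rewrite /kS2 -(opprB z w) rXY_even. Qed.

Lemma pint_kP0 z : pint (fun w => kP (w - z)) = 0.
Proof.
have i1 := pint_shift_integrable z (Ck_continuous (Ck_rXX 0)) csupp_rXX.
have i2 := pint_shift_integrable z (Ck_continuous (Ck_rYY 0)) csupp_rYY.
rewrite (_ : (fun w => _) = (fun w => 2^-1 * (rXX (w - z) + rYY (w - z)))); last first.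
  by apply/funext => w; rewrite /kP mulrC.
rewrite pintZ; last exact: pintegrableD.
by rewrite (pintD i1 i2) pint_XX0 pint_YY0 addr0 mulr0.
Qed.

Lemma pint_kS10 z : pint (fun w => kS1 (w - z)) = 0.
Proof.
have i1 := pint_shift_integrable z (Ck_continuous (Ck_rXX 0)) csupp_rXX.
have i2 := pint_shift_integrable z (Ck_continuous (Ck_rYY 0)) csupp_rYY.
rewrite (_ : (fun w => _) = (fun w => 2^-1 * (rXX (w - z) - rYY (w - z)))); last first.
  by apply/funext => w; rewrite /kS1 mulrC.
rewrite pintZ; last exact: pintegrableB.
by rewrite (pintB i1 i2) pint_XX0 pint_YY0 subr0 mulr0.
Qed.

Lemma pint_kS20 z : pint (fun w => kS2 (w - z)) = 0.
Proof.
have i1 := pint_shift_integrable z (Ck_continuous (Ck_rXY 0)) csupp_rXY.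
by rewrite /kS2 (pintN i1) pint_XY0 oppr0.
Qed.

(** The integrals run over the whole plane: functions will be extended by zero, and [D] only
    restricts the test functions. *)
Definition wderiv (v : R * R) (D : set (R * R)) (u g : R * R -> R) : Prop :=
  forall phi, test_function D phi ->
    pint (fun p => u p * 'D_v phi p) = - pint (fun p => g p * phi p).

Lemma derive_shift (u : R * R -> R) (v z p : R * R) (du : R * R -> R) :
  (forall d, is_derive d v u (du d)) -> 'D_v (fun w => u (w - z)) p = du (p - z).
Proof. by move=> h; case: (is_derive_shiftB (h (p - z))). Qed.

(** Both sides are minus the integral of u against the same mixed derivative [rXXY]. *)
Lemma wderiv_commX D u ux uy z : wderiv e1 D u ux -> wderiv e2 D u uy ->
  cbox z r `<=` D ->
  pint (fun w => ux w * rXY (w - z)) = pint (fun w => uy w * rXX (w - z)).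
Proof.
move=> hx hy zD.
have h1 := hx _ (test_function_shift Ck_rXY csupp_rXY zD).
have h2 := hy _ (test_function_shift Ck_rXX csupp_rXX zD).
apply: oppr_inj; rewrite -h1 -h2; apply: pint_ext => p; congr (_ * _).
by rewrite (derive_shift z p rXYX_derive) (derive_shift z p rXXY_derive).
Qed.

Lemma wderiv_commY D u ux uy z : wderiv e1 D u ux -> wderiv e2 D u uy ->
  cbox z r `<=` D ->
  pint (fun w => ux w * rYY (w - z)) = pint (fun w => uy w * rXY (w - z)).
Proof.
move=> hx hy zD.
have h1 := hx _ (test_function_shift Ck_rYY csupp_rYY zD).
have h2 := hy _ (test_function_shift Ck_rXY csupp_rXY zD).
apply: oppr_inj; rewrite -h1 -h2; apply: pint_ext => p; congr (_ * _).
by rewrite (derive_shift z p rYYX_derive) (derive_shift z p rXYY_derive).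
Qed.

(** [kP] is half a divergence, so an integration by parts moves it onto the gradient of u. This
    compares mollifications of u at two scales. *)
Lemma wderiv_kP D u ux uy z : sqi u -> sqi ux -> sqi uy ->
  wderiv e1 D u ux -> wderiv e2 D u uy -> cbox z r `<=` D ->
  pint (fun w => u w * kP (w - z)) =
  - 2^-1 * pint (fun w => ux w * rX (w - z) + uy w * rY (w - z)).
Proof.
move=> su sux suy hx hy zD.
have K v : (forall k, Ck k setT v) -> csupp v -> sqi (fun w => v (w - z)).
  by move=> cv sv; have [C kC] := kern_shift (Ck_continuous (cv 0%N)) sv; exact: (kern_sqi kC z).
have h1 := hx _ (test_function_shift Ck_rX csupp_rX zD).
have h2 := hy _ (test_function_shift Ck_rY csupp_rY zD).
rewrite (_ : (fun w => _ * kP _) = (fun w => 2^-1 * (u w * rXX (w - z) + u w * rYY (w - z)))); last first.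
  by apply/funext => w; rewrite /kP; field.
have iX := sqi_mul su (K _ Ck_rXX csupp_rXX).
have iY := sqi_mul su (K _ Ck_rYY csupp_rYY).
have jX := sqi_mul sux (K _ Ck_rX csupp_rX).
have jY := sqi_mul suy (K _ Ck_rY csupp_rY).
rewrite pintZ ?pintD//; last exact: pintegrableD.
rewrite mulNr -mulrN opprD -h1 -h2; congr (_ * (_ + _)); apply: pint_ext => p; congr (_ * _).
  by rewrite (derive_shift z p rXX_derive).
by rewrite (derive_shift z p rYY_derive).
Qed.

Section system.
Variables (D : set (R * R)) (u v ux uy vx vy : R * R -> R).
Hypotheses (sux : sqi ux) (suy : sqi uy) (svx : sqi vx) (svy : sqi vy).
Hypotheses (hux : wderiv e1 D u ux) (huy : wderiv e2 D u uy).
Hypotheses (hvx : wderiv e1 D v vx) (hvy : wderiv e2 D v vy).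

(** With f = rX - i rY, the equality of the mixed derivatives of h = u + iv says that h_z tested
    against f_zbar = P equals h_zbar tested against f_z = kS1 + i kS2; these are the real and
    imaginary parts, doubled. *)
Lemma weak_cauchy_riemann z : cbox z r `<=` D ->
  pint (fun w => (ux w + vy w) * kP (w - z)) =
    pint (fun w => (ux w - vy w) * kS1 (w - z)) - pint (fun w => (vx w + uy w) * kS2 (w - z)) /\
  pint (fun w => (vx w - uy w) * kP (w - z)) =
    pint (fun w => (vx w + uy w) * kS1 (w - z)) + pint (fun w => (ux w - vy w) * kS2 (w - z)).
Proof.
move=> zD.
have K f : (forall k, Ck k setT f) -> csupp f -> sqi (fun w => f (w - z)).
  by move=> cv sv; have [C kC] := kern_shift (Ck_continuous (cv 0%N)) sv; exact: (kern_sqi kC z).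
have K' f : continuous f -> csupp f -> sqi (fun w => f (w - z)).
  by move=> cv sv; have [C kC] := kern_shift cv sv; exact: (kern_sqi kC z).
have kXX := K _ Ck_rXX csupp_rXX; have kYY := K _ Ck_rYY csupp_rYY.
have kXY := K _ Ck_rXY csupp_rXY.
have kkP := K' _ continuous_kP csupp_kP; have kkS1 := K' _ continuous_kS1 csupp_kS1.
have kkS2 := K' _ continuous_kS2 csupp_kS2.
have uX := wderiv_commX hux huy zD; have uY := wderiv_commY hux huy zD.
have vX := wderiv_commX hvx hvy zD; have vY := wderiv_commY hvx hvy zD.
have sA : sqi (fun w => ux w + vy w) by exact: sqiD.
have sB : sqi (fun w => ux w - vy w) by exact: sqiB.
have sC : sqi (fun w => vx w + uy w) by exact: sqiD.
have sE : sqi (fun w => vx w - uy w) by exact: sqiB.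
have iXX f : sqi f -> pintegrable (fun w => f w * rXX (w - z)) by move=> sf; exact: sqi_mul.
have iYY f : sqi f -> pintegrable (fun w => f w * rYY (w - z)) by move=> sf; exact: sqi_mul.
have iXY f : sqi f -> pintegrable (fun w => f w * rXY (w - z)) by move=> sf; exact: sqi_mul.
split; apply/eqP; rewrite -subr_eq0; apply/eqP.
  rewrite -pintB; [|exact: sqi_mul|exact: sqi_mul].
  rewrite -pintB; [|exact: sqi_mul|by apply: pintegrableB; exact: sqi_mul].
  rewrite (_ : (fun p => _) = (fun w => (ux w * rYY (w - z) - uy w * rXY (w - z)) +
     (vy w * rXX (w - z) - vx w * rXY (w - z)))); last first.
    by apply/funext => w; rewrite /kP /kS1 /kS2; field.
  by apply: pint_diff2; auto.
rewrite -pintD; [|exact: sqi_mul|exact: sqi_mul].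
rewrite -pintB; [|exact: sqi_mul|by apply: pintegrableD; exact: sqi_mul].
rewrite (_ : (fun p => _) = (fun w => (vx w * rYY (w - z) - vy w * rXY (w - z)) +
     (ux w * rXY (w - z) - uy w * rXX (w - z)))); last first.
  by apply/funext => w; rewrite /kP /kS1 /kS2; field.
by apply: pint_diff2; auto.
Qed.

End system.

End profile.

End radial.

(** * Mollifiers *)

Section mollifier.
Context {R : realType}.
Local Notation mu2 := ((@lebesgue_measure R) \x (@lebesgue_measure R))%E.
Implicit Types (u v : R * R -> R) (p z w d : R * R) (e r : R).

(** A bump on the annulus e^2/2 <= |d|^2 <= e^2; the factor e^-2 makes its integral independent of
    e. *)
Definition rho0 e d : R := e ^- 2 * cutg (e ^- 2 * nrm2 d).

(** Equal to pi in polar coordinates. The value is left unevaluated: normalisation asks only that it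
    be positive. *)
Definition mass : R := pint (rho0 1).

Definition rho e d : R := mass^-1 * rho0 e d.

(* The profile for which [kP] is [rho e - rho r]. *)
Definition qk e r (t : R) : R :=
  mass^-1 * (e ^- 2 * cutH (e ^- 2 * t) - r ^- 2 * cutH (r ^- 2 * t)).

Lemma smooth_scale (c : R) f : smooth f -> smooth (fun t : R => f (c * t)).
Proof.
move=> sf k; apply: (@Dk_comp _ k f); first exact: sf.
by apply: (@Dk_mul _ k (cst c) id); [exact: Dk_cst|exact: Dk_id].
Qed.

Lemma smooth_qk e r : smooth (qk e r).
Proof.
move=> k; apply: (@Dk_mul _ k (cst mass^-1)); first exact: Dk_cst.
rewrite (_ : (fun t => _) = (fun t => e ^- 2 * cutH (e ^- 2 * t) + (- r ^- 2) * cutH (r ^- 2 * t))).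
  apply: Dk_add.
    by apply: (@Dk_mul _ k (cst (e ^- 2))); [exact: Dk_cst|apply: smooth_scale; exact: cutH_smooth].
  by apply: (@Dk_mul _ k (cst (- r ^- 2))); [exact: Dk_cst|apply: smooth_scale; exact: cutH_smooth].
by apply/funext => t; rewrite mulNr.
Qed.

(** Both terms of [qk] equal 1/t beyond their own scale, so they cancel beyond the larger one. *)
Lemma qk_out e r t : 0 < e -> e <= r -> r ^+ 2 <= t -> qk e r t = 0.
Proof.
move=> e0 er rt; have r0 : 0 < r by lra.
have et : e ^+ 2 <= t by apply: le_trans rt; rewrite lerXn2r// nnegrE ltW.
have t0 : 0 < t by apply: lt_le_trans rt; rewrite exprn_gt0.
have P s : 0 < s -> s ^+ 2 <= t -> s ^- 2 * cutH (s ^- 2 * t) = t^-1.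
  move=> s0 st; rewrite cutH_inv; last first.
    by rewrite mulrC ler_pdivlMr ?exprn_gt0// mul1r.
  by rewrite [(_ * t)^-1]invfM mulrA divff ?mul1r// invr_eq0 gt_eqF// exprn_gt0.
by rewrite /qk !P// subrr mulr0.
Qed.

(** By [kPE] the left side is the derivative of t [qk] t, and t [qk] t is a difference of rescaled
    copies of [cutG]. *)
Lemma kP_qk e r d : kP (qk e r) d = rho e d - rho r d.
Proof.
rewrite kPE /rho /rho0; move: (nrm2 d) => t.
pose F t := mass^-1 * (cutG (e ^- 2 * t) - cutG (r ^- 2 * t)).
have FE : (fun t => t * qk e r t) = F.
  by apply/funext => s; rewrite /F -!cutHE /qk; ring.
have dF : is_derive t 1 F (mass^-1 * (cutg (e ^- 2 * t) * e ^- 2 - cutg (r ^- 2 * t) * r ^- 2)).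
  have L (c : R) : is_derive t 1 (fun t => c * t) c.
    have := is_deriveZ (f := id) c (is_derive_id t (1 : R)).
    by rewrite /GRing.scale /= mulr1.
  have d1 := @is_derive1_comp _ cutG (fun t => e ^- 2 * t) t _ _ (cutg_derive _) (L (e ^- 2)).
  have d2 := @is_derive1_comp _ cutG (fun t => r ^- 2 * t) t _ _ (cutg_derive _) (L (r ^- 2)).
  exact: (is_deriveZ mass^-1 (is_deriveB d1 d2)).
have dq : is_derive t 1 F (t * derive1 (qk e r) t + qk e r t * 1).
  rewrite -FE; exact: (is_deriveM (is_derive_id t (1 : R)) (smooth_is_derive t (smooth_qk e r))).
case: dF dq => _ h1 [_ h2].
transitivity ('D_1 F t); first by rewrite h2 mulr1 addrC.
by rewrite h1 mulrBr; congr (_ * _ - _ * _); exact: mulrC.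
Qed.

Lemma Ck_rho0 k e : Ck k setT (rho0 e).
Proof.
apply: Ck_mul; first exact: Ck_cst.
apply: (@Ck_rad R (fun t => cutg (e ^- 2 * t)) k).
by apply: smooth_scale; exact: cutg_smooth.
Qed.

Lemma rho0_ge0 e d : 0 <= rho0 e d.
Proof. by rewrite mulr_ge0 ?cutg_ge0// invr_ge0 exprn_even_ge0. Qed.

Lemma rho0_out e d : 0 < e -> ~ box 0 e d -> rho0 e d = 0.
Proof.
move=> e0 nd; rewrite /rho0 cutg_eq0r ?mulr0// mulrC ler_pdivlMr ?exprn_gt0// mul1r.
rewrite leNgt; apply/negP => h; apply: nd; rewrite /box /= !subr0; split.
  rewrite -ltr_sqr ?nnegrE ?(ltW e0)// real_normK ?num_real//.
  by apply: le_lt_trans h; rewrite /nrm2; have := sqr_ge0 d.2; lra.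
rewrite -ltr_sqr ?nnegrE ?(ltW e0)// real_normK ?num_real//.
by apply: le_lt_trans h; rewrite /nrm2; have := sqr_ge0 d.1; lra.
Qed.

Lemma cutg_bounded : exists2 M, 0 <= M & forall t : R, `|cutg t| <= M.
Proof.
have [M M0 fM] := smooth_bounded 0 1 (@cutg_smooth R).
exists M => // t; have [t0|t0] := leP t (1 / 2); first by rewrite cutg_eq0l// normr0.
have [t1|t1] := leP 1 t; first by rewrite cutg_eq0r// normr0.
by apply: fM; apply/andP; split; lra.
Qed.

Lemma cutg_lipschitz : exists2 M, 0 <= M & forall s t : R, `|cutg s - cutg t| <= M * `|s - t|.
Proof.
have [M M0 gM] := smooth_bounded 0 1 (smooth_derive1 (@cutg_smooth R)).
have loc s t : 0 <= s -> s <= t -> t <= 1 -> `|cutg t - cutg s| <= M * (t - s).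
  move=> s0 st t1.
  have [c] := @MVT_segment R cutg (derive1 cutg) s t st
    (fun x _ => smooth_is_derive x (@cutg_smooth R))
    (continuous_subspaceT (smooth_continuous (@cutg_smooth R))).
  rewrite in_itv /= => /andP[c1 c2] ->.
  by rewrite normrM (ger0_norm (_ : 0 <= t - s)) ?subr_ge0// ler_wpM2r ?subr_ge0// gM//; apply/andP; split; lra.
have pos s t : s <= t -> `|cutg t - cutg s| <= M * (t - s).
  move=> st; have ts0 : 0 <= t - s by rewrite subr_ge0.
  have [s0|s0] := leP (1 / 2) s; last first.
    rewrite (@cutg_eq0l _ s); last lra.
    have [t0|t0] := leP t (1 / 2); first by rewrite cutg_eq0l// subr0 normr0 mulr_ge0.
    have [t1|t1] := leP 1 t; first by rewrite cutg_eq0r// subr0 normr0 mulr_ge0.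
    have := loc (1 / 2) t; rewrite (@cutg_eq0l _ (1 / 2))// => h.
    by apply: le_trans (h _ _ _) _; try lra; rewrite ler_wpM2l//; lra.
  have [t1|t1] := leP t 1; first by apply: loc; lra.
  rewrite (@cutg_eq0r _ t); last lra.
  have [s1|s1] := leP 1 s; first by rewrite cutg_eq0r// subr0 normr0 mulr_ge0.
  have := loc s 1; rewrite (@cutg_eq0r _ 1)// => h.
  by apply: le_trans (h _ _ _) _; try lra; rewrite ler_wpM2l//; lra.
exists M => // s t; have [st|/ltW ts] := leP s t.
  by rewrite distrC (distrC s) (ger0_norm (_ : 0 <= t - s)) ?subr_ge0//; exact: pos.
by rewrite (ger0_norm (_ : 0 <= s - t)) ?subr_ge0//; exact: pos.
Qed.

Lemma rho0_bounded : exists2 M, 0 <= M & forall e d, 0 < e ->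
  `|rho0 e d| <= M * e ^- 2 * bx 0 e d.
Proof.
have [M M0 gM] := cutg_bounded; exists M => // e d e0.
have [de|de] := pselect (box 0 e d).
  rewrite bx_in// mulr1 /rho0 normrM ger0_norm ?invr_ge0 ?exprn_even_ge0// mulrC.
  by rewrite ler_wpM2r// invr_ge0 exprn_even_ge0.
by rewrite rho0_out// normr0 !mulr_ge0 ?bx_ge0// invr_ge0 exprn_even_ge0.
Qed.

Lemma rho0_lipschitz : exists2 M, 0 <= M & forall e d d', 0 < e ->
  `|d.1 - d'.1| <= e -> `|d.2 - d'.2| <= e ->
  `|rho0 e d - rho0 e d'| <= M * e ^- 3 * (`|d.1 - d'.1| + `|d.2 - d'.2|) * bx 0 (2 * e) d.
Proof.
have [M M0 gM] := cutg_lipschitz; exists (6 * M); first by lra.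
move=> e d d' e0 h1 h2.
set x := `|d.1 - d'.1| in h1 *; set y := `|d.2 - d'.2| in h2 *.
have x0 : 0 <= x by exact: normr_ge0.
have y0 : 0 <= y by exact: normr_ge0.
have [de|de] := pselect (box 0 (2 * e) d); last first.
  rewrite !rho0_out// ?subrr ?normr0.
  - by rewrite !mulr_ge0 ?bx_ge0 ?addr_ge0// invr_ge0 exprn_ge0// ltW.
  - rewrite /box /= !subr0 => -[k1 k2]; apply: de; rewrite /box /= !subr0.
    have := ler_normD (d.1 - d'.1) d'.1; have := ler_normD (d.2 - d'.2) d'.2.
    by rewrite !subrK -/x -/y => ? ?; split; lra.
  - rewrite /box /= !subr0 => -[k1 k2]; apply: de; rewrite /box /= !subr0.
    by split; lra.
rewrite bx_in// mulr1 /rho0 -mulrBr normrM ger0_norm ?invr_ge0 ?exprn_even_ge0//.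
have e2 : 0 <= e ^- 2 by rewrite invr_ge0 exprn_even_ge0.
apply: (@le_trans _ _ (e ^- 2 * (M * (e ^- 2 * (6 * e * (x + y)))))); last first.
  by rewrite le_eqVlt; apply/orP; left; apply/eqP; field; rewrite gt_eqF.
apply: ler_wpM2l => //; apply: (le_trans (gM _ _)); apply: ler_wpM2l => //.
rewrite -mulrBr normrM (ger0_norm e2) ler_wpM2l//.
case: de; rewrite /= !subr0 => k1 k2.
have -> : nrm2 d - nrm2 d' = (d.1 - d'.1) * (d.1 + d'.1) + (d.2 - d'.2) * (d.2 + d'.2).
  by rewrite /nrm2; ring.
apply: (le_trans (ler_normD _ _)); rewrite !normrM -/x -/y mulrDr.
have b1 : `|d.1 + d'.1| <= 6 * e.
  have := ler_normB (2 * d.1) (d.1 - d'.1).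
  rewrite (_ : 2 * d.1 - (d.1 - d'.1) = d.1 + d'.1); last ring.
  by rewrite normrM (ger0_norm (_ : 0 <= 2))// -/x; lra.
have b2 : `|d.2 + d'.2| <= 6 * e.
  have := ler_normB (2 * d.2) (d.2 - d'.2).
  rewrite (_ : 2 * d.2 - (d.2 - d'.2) = d.2 + d'.2); last ring.
  by rewrite normrM (ger0_norm (_ : 0 <= 2))// -/y; lra.
by apply: lerD; rewrite mulrC ler_wpM2r.
Qed.

Lemma rho0_kern : exists2 M, 0 <= M & forall e, 0 < e ->
  kern (fun w z => rho0 e (w - z)) (M * e ^- 2) e.
Proof.
have [M M0 rM] := rho0_bounded; exists M => // e e0; split.
- apply: (measurableT_comp (f := rho0 e)).
    apply: continuous_measurable2; exact: Ck_continuous (Ck_rho0 0 e).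
  apply/measurable_fun_pairP; split.
    by apply: measurable_funB; apply: measurableT_comp.
  by apply: measurable_funB; apply: measurableT_comp.
- exact: ltW.
- move=> w z; apply: (le_trans (rM e (w - z) e0)).
  rewrite (_ : bx 0 e (w - z) = bx z e w)// /bx !indicE; congr (_ %:R); congr nat_of_bool.
  by apply/idP/idP; rewrite !inE /box /= !subr0.
Qed.

Lemma mass_gt0 : 0 < mass.
Proof.
have m0 : 0 <= mass by apply: pint_ge0 => d; exact: rho0_ge0.
rewrite lt_def m0 andbT; apply/eqP => mE.
have i0 : pintegrable (rho0 1).
  apply: (@continuous_bsupp_integrable _ _ 1) => //.
    exact: Ck_continuous (Ck_rho0 0 1).
  by move=> p; apply: rho0_out.
have [A [mA A0 hA]] := pint_eq0_ae i0 (rho0_ge0 1) mE.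
(* On the square of radius 1/16 about c one has 1/2 < |p|^2 < 1, the range in which [cutg] is
   positive. *)
pose c : R * R := (3 / 4, 1 / 4).
have sub : box c (1 / 16) `<=` A.
  move=> p [p1 p2]; apply: hA => /= h; move: p1 p2; rewrite /= !ltr_distl => /andP[a1 a2] /andP[b1 b2].
  suff : 0 < rho0 1 p by rewrite h ltxx.
  rewrite /rho0 expr1n invr1 !mul1r cutg_gt0// /nrm2; nra.
have : (mu2 (box c (1 / 16)) <= mu2 A)%E.
  by apply: le_measure => //; rewrite inE//; exact: measurable_box.
by rewrite A0 mu2_box// lee_fin leNgt; move/negP; apply; lra.
Qed.

Definition mol e w z : R := rho e (w - z).

Lemma mol_kern : exists2 M, 0 <= M & forall e, 0 < e -> kern (mol e) (M * e ^- 2) e.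
Proof.
have [M M0 kM] := rho0_kern; exists (mass^-1 * M).
  by rewrite mulr_ge0// invr_ge0 ltW// mass_gt0.
move=> e e0; have := kernZ mass^-1 (kM e e0).
by rewrite (ger0_norm (_ : 0 <= mass^-1)) ?mulrA// invr_ge0 ltW// mass_gt0.
Qed.

Lemma mol_sqi e z : 0 < e -> sqi (mol e ^~ z).
Proof. by have [M _ kM] := mol_kern => e0; exact: (kern_sqi (kM e e0) z). Qed.

Lemma mol_sqic e z : 0 < e -> sqic (mol e ^~ z).
Proof.
have [M _ kM] := mol_kern => e0; split; first exact: (kern_sqi (kM e e0) z).
exists (`|z.1| + `|z.2| + e) => p np.
have := kern_bd (kM e e0) p z; rewrite bx_out; last by move=> /box_sub.
by rewrite mulr0 normr_le0 => /eqP.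
Qed.

Lemma mol_integrable e z : 0 < e -> pintegrable (mol e ^~ z).
Proof. by move=> e0; exact: sqic_integrable (mol_sqic z e0). Qed.

Lemma mol_ge0 e w z : 0 <= mol e w z.
Proof. by rewrite mulr_ge0 ?rho0_ge0// invr_ge0 ltW// mass_gt0. Qed.

Lemma mol_out e w z : 0 < e -> ~ box z e w -> mol e w z = 0.
Proof.
have [M _ kM] := mol_kern => e0 wz; apply/eqP; rewrite -normr_le0.
by apply: (le_trans (kern_bd (kM e e0) w z)); rewrite bx_out// mulr0.
Qed.

Lemma mol_lipschitz : exists2 M, 0 <= M & forall e w z z', 0 < e ->
  `|z.1 - z'.1| <= e -> `|z.2 - z'.2| <= e ->
  `|mol e w z - mol e w z'| <= M * e ^- 3 * (`|z.1 - z'.1| + `|z.2 - z'.2|) * bx z (2 * e) w.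
Proof.
have [M M0 rM] := rho0_lipschitz; have m0 := mass_gt0.
have im0 : 0 <= mass^-1 by rewrite invr_ge0 ltW.
exists (mass^-1 * M); first by rewrite mulr_ge0.
move=> e w z z' e0 h1 h2.
have E1 : (w - z).1 - (w - z').1 = z'.1 - z.1 by rewrite /=; ring.
have E2 : (w - z).2 - (w - z').2 = z'.2 - z.2 by rewrite /=; ring.
have := rM e (w - z) (w - z') e0; rewrite E1 E2 (distrC z'.1) (distrC z'.2) => /(_ h1 h2) h.
rewrite /mol /rho -mulrBr normrM (ger0_norm im0) -!mulrA ler_wpM2l// !mulrA.
apply: (le_trans h); rewrite (_ : bx 0 (2 * e) (w - z) = bx z (2 * e) w)//.
rewrite /bx !indicE; congr (_ %:R); congr nat_of_bool.
by apply/idP/idP; rewrite !inE /box /= !subr0.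
Qed.

(** Takes the place of a change of scale in the integral: the difference of the two kernels is a
    divergence with bounded support. *)
Lemma mol_mass_le e r z : 0 < e -> e <= r ->
  pint (mol e ^~ z) = pint (mol r ^~ z).
Proof.
move=> e0 er; have r0 : 0 < r by lra.
have := pint_kP0 (@smooth_qk e r) r0 (fun t => qk_out e0 er) z.
under pint_ext do rewrite kP_qk.
by rewrite pintB; [move/eqP; rewrite subr_eq0 => /eqP|exact: mol_integrable|exact: mol_integrable].
Qed.

(** Translation invariance, again without a change of variables: the mass can be computed at any
    large scale r, where the kernels centred at 0 and at z differ in L^1 by O(|z| / r). *)
Lemma mol_mass1 z : pint (mol 1 ^~ z) = pint (mol 1 ^~ 0).
Proof.
have [M M0 lM] := mol_lipschitz.
set s := `|z.1| + `|z.2|; have s0 : 0 <= s by rewrite addr_ge0.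
have hr r : 1 + s <= r -> `|pint (mol 1 ^~ 0) - pint (mol 1 ^~ z)| <= 16 * M * s * r^-1.
  move=> sr; have r0 : 0 < r by lra.
  rewrite (@mol_mass_le 1 r 0 ltr01); last lra.
  rewrite (@mol_mass_le 1 r z ltr01); last lra.
  have i0 := mol_integrable 0 r0; have iz := mol_integrable z r0.
  rewrite -(pintB i0 iz); apply: (le_trans (pint_norm (pintegrableB i0 iz))).
  apply: (@le_trans _ _ (pint (fun w => (M * r ^- 3 * s) * bx 0 (2 * r) w))).
    apply: pint_le; first exact: pintegrable_norm (pintegrableB i0 iz).
      by apply: pintegrableZ; exact: pintegrable_bx.
    move=> w; have := lM r w 0 z r0; rewrite /= !sub0r !normrN; apply.
      by have := normr_ge0 z.2; rewrite /s in sr; lra.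
    by have := normr_ge0 z.1; rewrite /s in sr; lra.
  rewrite pintZ; last exact: pintegrable_bx.
  rewrite pint_bx; last lra.
  by rewrite le_eqVlt; apply/orP; left; apply/eqP; field; rewrite gt_eqF.
apply/eqP; rewrite eq_sym -subr_eq0 -normr_le0; apply/ler_addgt0Pr => x x0; rewrite add0r.
(* Large enough for the kernels to be comparable and for the bound 16 M s / r to be at most x. *)
pose r := 1 + s + 16 * M * s / x.
have K0 : 0 <= 16 * M * s by rewrite !mulr_ge0.
have r1 : 1 + s <= r by rewrite lerDl divr_ge0// ltW.
apply: (le_trans (hr r r1)).
have r0 : 0 < r by lra.
rewrite ler_pdivrMr//; have -> : x * r = x * (1 + s) + 16 * M * s.
  by rewrite /r; field; rewrite gt_eqF.
by rewrite lerDr mulr_ge0//; lra.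
Qed.

Lemma mol_mass e z : 0 < e -> pint (mol e ^~ z) = 1.
Proof.
move=> e0.
have -> : pint (mol e ^~ z) = pint (mol 1 ^~ z).
  by have [e1|/ltW e1] := leP e 1; [exact: mol_mass_le|rewrite (@mol_mass_le 1 e z)].
rewrite mol_mass1 (_ : (fun w => _) = (fun w => mass^-1 * rho0 1 w)); last first.
  by apply/funext => w; rewrite /mol /rho subr0.
have := mol_integrable 0 ltr01; rewrite (_ : (fun w => _) = (fun w => mass^-1 * rho0 1 w)); last first.
  by apply/funext => w; rewrite /mol /rho subr0.
have m0 : mass != 0 by rewrite gt_eqF ?mass_gt0.
move=> /(pintegrableZ mass).
rewrite (_ : (fun w => _) = rho0 1); last by apply/funext => w; rewrite mulrA divff// mul1r.
by move=> i0; rewrite pintZ// mulVf.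
Qed.

End mollifier.

(** * Strong convergence of mollifications *)

Section strong.
Context {R : realType}.
Local Notation mu2 := ((@lebesgue_measure R) \x (@lebesgue_measure R))%E.
Implicit Types (u v : R * R -> R) (p z w d : R * R) (e r x : R).

Lemma pint_sqrD u v : sqi u -> sqi v ->
  pint (fun p => (u p + v p) ^+ 2) <=
  2 * pint (fun p => u p ^+ 2) + 2 * pint (fun p => v p ^+ 2).
Proof.
move=> su sv; have [_ iu] := su; have [_ iv] := sv.
rewrite -(pintZ 2 iu) -(pintZ 2 iv) -pintD; try exact: pintegrableZ.
apply: pint_le; first by case: (sqiD su sv).
  by apply: pintegrableD; exact: pintegrableZ.
move=> p /=; rewrite -subr_ge0.
have -> : 2 * u p ^+ 2 + 2 * v p ^+ 2 - (u p + v p) ^+ 2 = (u p - v p) ^+ 2 by ring.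
exact: sqr_ge0.
Qed.

Lemma convD S C r u v z : kern S C r -> sqi u -> sqi v ->
  conv S (fun p => u p + v p) z = conv S u z + conv S v z.
Proof.
move=> kS su sv; have sS := kern_sqi kS z.
rewrite /conv -(pintD (sqi_mul su sS) (sqi_mul sv sS)).
by apply: pint_ext => w; rewrite mulrDl.
Qed.

Lemma convZ S C r c u z : kern S C r -> sqi u ->
  conv S (fun p => c * u p) z = c * conv S u z.
Proof.
move=> kS su; rewrite /conv -(pintZ c (sqi_mul su (kern_sqi kS z))).
by apply: pint_ext => w; rewrite mulrA.
Qed.

Lemma convB S C r u v z : kern S C r -> sqi u -> sqi v ->
  conv S (fun p => u p - v p) z = conv S u z - conv S v z.
Proof.
move=> kS su sv; have sS := kern_sqi kS z.
rewrite /conv -(pintB (sqi_mul su sS) (sqi_mul sv sS)).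
by apply: pint_ext => w; rewrite mulrBl.
Qed.

(** Stated as a property of u because it is shown to be stable under linear combinations and L^2
    limits, then carried from rectangles to measurable sets, simple functions and all of [sqic]. *)
Definition mol_cvg u : Prop := sqic u /\
  forall x, 0 < x -> exists2 d, 0 < d & forall e, 0 < e -> e < d ->
    pint (fun z => (conv (mol e) u z - u z) ^+ 2) <= x.

Lemma mol_cvgD u v : mol_cvg u -> mol_cvg v -> mol_cvg (fun p => u p + v p).
Proof.
move=> [su hu] [sv hv]; split; first exact: sqicD.
move=> x x0; have x4 : 0 < x / 4 by lra.
have [d d0 hd] := hu _ x4; have [d' d'0 hd'] := hv _ x4.
have [M _ kM] := @mol_kern R.
exists (Num.min d d'); first by rewrite lt_min d0.
move=> e e0; rewrite lt_min => /andP[ed ed'].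
have kS := kM e e0.
rewrite (_ : (fun z => _) = (fun z => ((conv (mol e) u z - u z) + (conv (mol e) v z - v z)) ^+ 2)).
  apply: (le_trans (pint_sqrD (sqiB (conv_sqic kS su).1 su.1) (sqiB (conv_sqic kS sv).1 sv.1))).
  by have := hd e e0 ed; have := hd' e e0 ed'; lra.
by apply/funext => z; rewrite (convD z kS su.1 sv.1); congr (_ ^+ 2); ring.
Qed.

Lemma mol_cvgZ c u : mol_cvg u -> mol_cvg (fun p => c * u p).
Proof.
move=> [su hu]; split; first exact: sqicZ.
move=> x x0; have x4 : 0 < x / (c ^+ 2 + 1).
  by rewrite divr_gt0// ltr_wpDl// sqr_ge0.
have [d d0 hd] := hu _ x4; have [M _ kM] := @mol_kern R.
exists d => // e e0 ed; have kS := kM e e0.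
rewrite (_ : (fun z => _) = (fun z => c ^+ 2 * (conv (mol e) u z - u z) ^+ 2)).
  rewrite pintZ; last by case: (sqiB (conv_sqic kS su).1 su.1).
  have := hd e e0 ed; rewrite ler_pdivlMr ?ltr_wpDl ?sqr_ge0//.
  set P := pint _ => h; have P0 : 0 <= P by apply: pint_ge0 => p; exact: sqr_ge0.
  lra.
by apply/funext => z; rewrite (convZ c z kS su.1) -mulrBr exprMn.
Qed.

Lemma mol_cvgB u v : mol_cvg u -> mol_cvg v -> mol_cvg (fun p => u p - v p).
Proof.
move=> hu hv; have := mol_cvgD hu (mol_cvgZ (-1) hv).
by congr mol_cvg; apply/funext => p; ring.
Qed.

Lemma mol_bound : exists2 K, 0 <= K & forall e u, 0 < e -> sqic u ->
  pint (fun z => conv (mol e) u z ^+ 2) <= K * pint (fun p => u p ^+ 2).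
Proof.
have [M M0 kM] := @mol_kern R; exists ((M * 4) ^+ 2); first exact: sqr_ge0.
move=> e u e0 su; apply: (le_trans (conv_young (kM e e0) su)).
rewrite (_ : M * e ^- 2 * (4 * e ^+ 2) = M * 4)//; field.
by rewrite gt_eqF.
Qed.

(** The mollifications are bounded on L^2 uniformly in e, so an approximation of u in L^2 is
    enough. *)
Lemma mol_cvg_closed u : sqic u ->
  (forall x, 0 < x -> exists2 v, mol_cvg v & pint (fun p => (u p - v p) ^+ 2) <= x) ->
  mol_cvg u.
Proof.
move=> su hu; split=> // x x0; have [K K0 hK] := mol_bound.
have [M _ kM] := @mol_kern R.
(* The approximation error enters with the factor 4 K + 4 and contributes x/2; the mollification
   error of v contributes the other half. *)
have y0 : 0 < x / (8 * K + 8) by rewrite divr_gt0//; lra.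
have [v [sv hv] uv] := hu _ y0.
have x4 : 0 < x / 4 by lra.
have [d d0 hd] := hv _ x4; exists d => // e e0 ed; have kS := kM e e0.
have suv := sqicB su sv; have scv := conv_sqic kS suv.
rewrite (_ : (fun z => _) = (fun z =>
    ((conv (mol e) (fun p => u p - v p) z - (u z - v z)) + (conv (mol e) v z - v z)) ^+ 2)); last first.
  by apply/funext => z; rewrite (convB z kS su.1 sv.1); congr (_ ^+ 2); ring.
apply: (le_trans (pint_sqrD (sqiB scv.1 suv.1) (sqiB (conv_sqic kS sv).1 sv.1))).
have h1 := hd e e0 ed.
have h2 := pint_sqrD scv.1 (sqiZ (-1) suv.1).
have h3 := hK e _ e0 suv.
have E : pint (fun p => (-1 * (u p - v p)) ^+ 2) = pint (fun p => (u p - v p) ^+ 2).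
  by apply: pint_ext => p; rewrite mulN1r sqrrN.
rewrite E in h2.
have E2 : pint (fun z => (conv (mol e) (fun p => u p - v p) z - (u z - v z)) ^+ 2) =
  pint (fun z => (conv (mol e) (fun p => u p - v p) z + -1 * (u z - v z)) ^+ 2).
  by apply: pint_ext => p; rewrite mulN1r.
rewrite E2; move: uv h1 h2 h3.
set A := pint _; set B := pint _; set C := pint _; set D := pint _.
rewrite ler_pdivlMr; last lra.
by move=> ? ? ? ?; lra.
Qed.

Lemma pint_dominated (f : nat -> R * R -> R) (g : R * R -> R) :
  (forall n, measurable_fun setT (f n)) -> pintegrable g ->
  (forall n p, `|f n p| <= g p) -> (forall p, f n p @[n --> \oo] --> 0) ->
  forall x, 0 < x -> exists n, pint (f n) <= x.
Proof.
move=> mf ig fg f0 x x0.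
have H1 n : measurable_fun setT (EFin \o f n) by exact/measurable_EFinP.
have H2 : measurable_fun setT (cst 0%E : R * R -> \bar R) by exact: measurable_cst.
have H3 : {ae mu2, forall p, setT p -> (EFin \o f n) p @[n --> \oo] --> (cst 0%E : R * R -> \bar R) p}.
  by apply: aeW => p _; apply: cvg_EFin; [exact: nearW|exact: f0].
have H5 : {ae mu2, forall p n, setT p -> (`|(EFin \o f n) p| <= (EFin \o g) p)%E}.
  by apply: aeW => p n _ /=; rewrite lee_fin.
have [_ _ ] := @dominated_convergence _ _ R mu2 setT measurableT (fun n => EFin \o f n) _ _
  H1 H2 H3 ig H5.
rewrite integral0 => /fine_cvg h.
have := cvgr_le 0 h x x0 => -[N _ hN]; exists N.
exact: (hN N (leqnn N)).
Qed.

Definition rect (a b c d : R) : set (R * R) :=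
  [set p | a < p.1 < b /\ c < p.2 < d].

Lemma rectE (a b c d : R) : rect a b c d = `]a, b[%classic `*` `]c, d[%classic.
Proof. by apply/seteqP; split => p; rewrite /rect /= !in_itv. Qed.

Lemma measurable_rect (a b c d : R) : measurable (rect a b c d).
Proof. by rewrite rectE; apply: measurableX; exact: measurable_itv. Qed.

Lemma mu2_rect (a b c d : R) : a <= b -> c <= d -> mu2 (rect a b c d) = ((b - a) * (d - c))%:E.
Proof.
move=> ab cd; rewrite rectE product_measure1E; try exact: measurable_itv.
have L (s t : R) : s <= t -> @lebesgue_measure R `]s, t[%classic = (t - s)%:E.
  rewrite le_eqVlt => /orP[/eqP ->|st]; first by rewrite lebesgue_measure_itv /= lte_fin ltxx subrr.
  by rewrite lebesgue_measure_itv /= lte_fin st EFinB.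
transitivity ((b - a)%:E * (d - c)%:E)%E; last by rewrite EFinM.
by congr (_ * _)%E; exact: L.
Qed.

Lemma sqic_indic (A : set (R * R)) (B : R) : measurable A -> A `<=` box 0 B -> sqic (\1_A).
Proof.
move=> mA AB; split.
  apply: (@sqi_le _ _ (bx 0 B)); [exact: measurable_indic|exact: sqi_bx|].
  move=> p; rewrite (ger0_norm (bx_ge0 0 B p)) indicE; have [pA|pA] := boolP (p \in A).
    by rewrite normr1 bx_in//; apply: AB; rewrite inE in pA.
  by rewrite normr0 bx_ge0.
exists B => p np; rewrite indicE memNset// => /AB; exact: np.
Qed.

Lemma rect_bounded (a b c d : R) : exists B, rect a b c d `<=` box 0 B.
Proof.
exists (`|a| + `|b| + `|c| + `|d|) => p [/andP[p1 p2] /andP[p3 p4]].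
have ha := normr_ge0 a; have hb := normr_ge0 b; have hc := normr_ge0 c; have hd := normr_ge0 d.
have na := ler_norm (- a); have nb := ler_norm b; have nc := ler_norm (- c); have nd := ler_norm d.
rewrite !normrN in na nc.
by split; rewrite subr0 ltr_norml; apply/andP; split; lra.
Qed.

(** Mollification stays between 0 and 1 and changes the indicator only within distance e of the
    boundary, on a frame of area 4 e (l + m). *)
Lemma mol_cvg_rect (a b c d : R) : mol_cvg (\1_(rect a b c d)).
Proof.
have [B QB] := rect_bounded a b c d.
have sQ := sqic_indic (measurable_rect a b c d) QB.
split => // x x0.
have [ab|ba] := ltP a b; last first.
  have E : \1_(rect a b c d) = (fun=> 0) :> (R * R -> R).
    by apply/funext => p; rewrite indicE memNset//= => -[/andP[h1 h2] _]; lra.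
  exists 1 => // e e0 _; rewrite E (_ : (fun z => _) = (fun=> 0)) ?pint0 ?ltW//.
  apply/funext => z; rewrite /conv (_ : (fun w => _) = (fun=> 0)) ?pint0 ?subr0 ?expr0n//.
  by apply/funext => w; rewrite mul0r.
have [cd|dc] := ltP c d; last first.
  have E : \1_(rect a b c d) = (fun=> 0) :> (R * R -> R).
    by apply/funext => p; rewrite indicE memNset//= => -[_ /andP[h1 h2]]; lra.
  exists 1 => // e e0 _; rewrite E (_ : (fun z => _) = (fun=> 0)) ?pint0 ?ltW//.
  apply/funext => z; rewrite /conv (_ : (fun w => _) = (fun=> 0)) ?pint0 ?subr0 ?expr0n//.
  by apply/funext => w; rewrite mul0r.
set l := b - a; set m := d - c.
have l0 : 0 < l by rewrite subr_gt0.
have m0 : 0 < m by rewrite subr_gt0.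
have k0 : 0 < x / (4 * (l + m)) by rewrite divr_gt0//; lra.
exists (Num.min (Num.min (l / 2) (m / 2)) (x / (4 * (l + m)))).
  by rewrite !lt_min k0 !divr_gt0.
move=> e e0; rewrite !lt_min => /andP[/andP[el em] ek].
have [M _ kM] := @mol_kern R; have kS := kM e e0.
pose O := rect (a - e) (b + e) (c - e) (d + e).
pose J := rect (a + e) (b - e) (c + e) (d - e).
have iO : pintegrable (\1_O : R * R -> R).
  by apply: pintegrable_indic; [exact: measurable_rect|rewrite mu2_rect ?ltry//; lra].
have iJ : pintegrable (\1_J : R * R -> R).
  apply: pintegrable_indic; first exact: measurable_rect.
  by rewrite mu2_rect ?ltry//; rewrite /l /m in el em *; lra.
apply: (@le_trans _ _ (pint (fun z => \1_O z - \1_J z))); last first.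
  rewrite (pintB iO iJ) !pint_indic; try exact: measurable_rect.
  rewrite mu2_rect; [|lra|lra].
  rewrite mu2_rect /=; [|rewrite /l in el; lra|rewrite /m in em; lra].
  move: ek; rewrite ltr_pdivlMr; last lra.
  by rewrite /l /m; nra.
apply: pint_le.
- by case: (sqiB (conv_sqic kS sQ).1 sQ.1).
- exact: pintegrableB.
move=> z.
have c0 : 0 <= conv (mol e) \1_(rect a b c d) z.
  by apply: pint_ge0 => w; rewrite mulr_ge0 ?mol_ge0// indicE.
have c1 : conv (mol e) \1_(rect a b c d) z <= 1.
  rewrite -(mol_mass z e0); apply: pint_le.
  - exact: sqi_mul sQ.1 (mol_sqi z e0).
  - exact: mol_integrable.
  - by move=> w; rewrite ler_piMl ?mol_ge0// indicE lern1; case: (w \in _).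
have [zJ|zJ] := pselect (J z).
  have zO : O z by move: zJ => [/andP[? ?] /andP[? ?]]; split; apply/andP; split; lra.
  have zQ : rect a b c d z by move: zJ => [/andP[? ?] /andP[? ?]]; split; apply/andP; split; lra.
  have -> : conv (mol e) \1_(rect a b c d) z = 1.
    rewrite -(mol_mass z e0); apply: pint_ext => w.
    have [zw|zw] := pselect (box z e w); last by rewrite mol_out// mulr0.
    rewrite indicE mem_set ?mul1r//; move: zw zJ => [] /=; rewrite !ltr_distl.
    move=> /andP[? ?] /andP[? ?] [/andP[? ?] /andP[? ?]].
    by split; apply/andP; split; lra.
  by rewrite !indicE !mem_set//= !subrr expr0n.
have [zO|zO] := pselect (O z).
  rewrite [\1_O z]indicE [\1_J z]indicE mem_set// memNset//= subr0.
  have [q0 q1] : 0 <= (\1_(rect a b c d) z : R) /\ (\1_(rect a b c d) z : R) <= 1.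
    by rewrite indicE; case: (z \in _); split.
  by nra.
have zQ : ~ rect a b c d z.
  by move=> [/andP[? ?] /andP[? ?]]; apply: zO; split; apply/andP; split; lra.
have -> : conv (mol e) \1_(rect a b c d) z = 0.
  rewrite /conv (_ : (fun w => _) = (fun=> 0)) ?pint0//; apply/funext => w.
  have [zw|zw] := pselect (box z e w); last by rewrite mol_out// mulr0.
  rewrite indicE memNset ?mul0r// => -[/andP[? ?] /andP[? ?]]; apply: zO.
  move: zw => [] /=; rewrite !ltr_distl => /andP[? ?] /andP[? ?].
  by split; apply/andP; split; lra.
by rewrite !indicE !memNset//= subrr expr0n.
Qed.

Definition rects : set (set (R * R)) := [set A | exists a b c (d : R), A = rect a b c d].

Lemma rects_setI : setI_closed rects.
Proof.
move=> _ _ [a [b [c [d ->]]]] [a' [b' [c' [d' ->]]]].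
exists (Num.max a a'), (Num.min b b'), (Num.max c c'), (Num.min d d').
apply/seteqP; split => p.
  move=> [[/andP[h1 h2] /andP[h3 h4]] [/andP[k1 k2] /andP[k3 k4]]].
  by split; rewrite /= gt_max lt_min ?h1 ?h2 ?h3 ?h4 ?k1 ?k2 ?k3 ?k4.
move=> [/=]; rewrite !gt_max !lt_min => /andP[/andP[h1 k1] /andP[h2 k2]].
move=> /andP[/andP[h3 k3] /andP[h4 k4]].
by split; split; rewrite ?h1 ?h2 ?h3 ?h4 ?k1 ?k2 ?k3 ?k4.
Qed.

(** Both projections are measurable for the sigma-algebra generated by open rectangles, a half-plane
    being a countable union of rectangles; hence so is the identity into the product. *)
Lemma measurable_rects (A : set (R * R)) : measurable A -> <<s rects >> A.
Proof.
move=> mA.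
pose T' := g_sigma_algebraType rects.
have U (F : (set (R * R))^nat) : (forall n, rects (F n)) -> <<s rects >> (\bigcup_n F n).
  move=> hF; apply: (@bigcup_measurable _ T') => n _.
  exact: sub_sigma_algebra.
have m1 : measurable_fun setT (fst : T' -> R).
  apply: (measurability _ (RGenOInfty.measurableE R)) => //.
  move=> _ [_ [x ->] <-]; rewrite setTI.
  rewrite (_ : _ @^-1` _ = \bigcup_n rect x (x + n%:R) (- n%:R) n%:R).
    by apply: U => n; exists x, (x + n%:R), (- n%:R), n%:R.
  apply/seteqP; split => [p|p [n _] [/andP[h _] _]]; rewrite /= in_itv /= andbT//.
  move=> xp; pose M := Num.max `|p.1 - x| `|p.2|.
  exists (Num.truncn M).+1 => //.
  have := truncnS_gt M; rewrite gt_max => /andP[k1 k2].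
  split; rewrite ?xp /=; last by rewrite -ltr_norml.
  by rewrite -ltrBlDl (le_lt_trans (ler_norm _)).
have m2 : measurable_fun setT (snd : T' -> R).
  apply: (measurability _ (RGenOInfty.measurableE R)) => //.
  move=> _ [_ [x ->] <-]; rewrite setTI.
  rewrite (_ : _ @^-1` _ = \bigcup_n rect (- n%:R) n%:R x (x + n%:R)).
    by apply: U => n; exists (- n%:R), n%:R, x, (x + n%:R).
  apply/seteqP; split => [p|p [n _] [_ /andP[h _]]]; rewrite /= in_itv /= andbT//.
  move=> xp; pose M := Num.max `|p.2 - x| `|p.1|.
  exists (Num.truncn M).+1 => //.
  have := truncnS_gt M; rewrite gt_max => /andP[k1 k2].
  split; rewrite ?xp /=; first by rewrite -ltr_norml.
  by rewrite -ltrBlDl (le_lt_trans (ler_norm _)).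
have mid : measurable_fun setT (id : T' -> R * R) by apply/measurable_fun_pairP.
by have := mid measurableT A mA; rewrite setTI.
Qed.

(** Dynkin's lemma: rectangles are closed under intersection, and the good sets are closed under
    proper differences and, by dominated convergence, increasing unions. Intersecting with a fixed
    box keeps the indicators in L^2. *)
Lemma mol_cvg_set (B : R) (A : set (R * R)) : 0 <= B -> measurable A -> mol_cvg (\1_(A `&` box 0 B)).
Proof.
move=> B0 mA.
pose H := [set A : set (R * R) | measurable A /\ mol_cvg (\1_(A `&` box 0 B))].
suff : <<s rects >> `<=` H by move=> /(_ _ (measurable_rects mA)) [].
have boxR : box 0 B = rect (- B) B (- B) B.
  by apply/seteqP; split => p; rewrite /box /rect /= !subr0 !ltr_norml.
apply: lambda_system_subset => //.
- exact: rects_setI.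
- split => //.
  + by split => //; rewrite setTI boxR; exact: mol_cvg_rect.
  + move=> X Y YX [mX hX] [mY hY]; split; first exact: measurableD.
    have := mol_cvgB hX hY; congr mol_cvg; apply/funext => p.
    rewrite setDE (indicI _ X (box 0 B)) (indicI _ Y (box 0 B)) (indicI _ (X `&` ~` Y) (box 0 B)) (indicI _ X) /= -mulrBl !indicE in_setC; congr (_ * _).
    have : p \in Y -> p \in X by rewrite !inE; exact: YX.
    by case: (p \in X); case: (p \in Y) => //= h; rewrite ?subrr ?subr0 ?mulr0 ?mulr1//; move: (h isT).
  + move=> F ndF hF; have mU : measurable (\bigcup_i F i).
      by apply: bigcup_measurable => n _; case: (hF n).
    split => //; apply: mol_cvg_closed.
      by apply: (@sqic_indic _ B); [apply: measurableI => //; exact: measurable_box|move=> p []].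
    move=> x x0.
    pose f n p : R := (\1_(\bigcup_i F i `&` box 0 B) p - \1_(F n `&` box 0 B) p) ^+ 2.
    have mf n : measurable_fun setT (f n).
      have mFn : measurable (F n) by case: (hF n).
      apply: measurable_funX; apply: measurable_funB; apply: measurable_indic.
        by apply: measurableI => //; exact: measurable_box.
      by apply: measurableI => //; exact: measurable_box.
    have fle n p : `|f n p| <= bx 0 B p.
      rewrite ger0_norm ?sqr_ge0// /f (indicI _ (\bigcup_i F i) (box 0 B)) (indicI _ (F n) (box 0 B)).
      rewrite /= -mulrBl exprMn [X in _ * X]expr2 -[X in _ * X]/(bx 0 B p * bx 0 B p).
      rewrite bx_idem ler_piMl ?bx_ge0//.
    have f0 p : f n p @[n --> \oo] --> 0.
      have [[n _ np]|nU] := pselect ((\bigcup_i F i) p); last first.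
        have E n : f n p = 0.
          rewrite /f !indicE !memNset ?subrr ?expr0n//; first by move=> [h _]; apply: nU; exists n.
          by move=> [h _]; apply: nU.
        by under eq_fun do rewrite E; exact: cvg_cst.
      apply: cvg_near_cst; exists n => // m /= nm.
      have mp : F m p by move: np; exact/subsetPset/ndF.
      rewrite /f (indicI _ (\bigcup_i F i) (box 0 B)) (indicI _ (F m) (box 0 B)) /=.
      rewrite [\1_(\bigcup_i F i) p]indicE [\1_(F m) p]indicE !mem_set ?subrr ?expr0n//.
      by exists n.
    have [n hn] := pint_dominated mf (pintegrable_bx 0 B) fle f0 x0.
    by exists (\1_(F n `&` box 0 B)) => //; case: (hF n).
- move=> _ [a [b [c [d ->]]]]; split; first exact: measurable_rect.
  have [a' [b' [c' [d' ->]]]] : rects (rect a b c d `&` box 0 B).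
    by apply: rects_setI; [exists a, b, c, d|rewrite boxR; exists (- B), B, (- B), B].
  exact: mol_cvg_rect.
Qed.

Lemma mol_cvg0 : mol_cvg (fun=> 0).
Proof.
have := mol_cvgZ 0 (mol_cvg_rect 0 0 0 0).
by congr mol_cvg; apply/funext => p; rewrite mul0r.
Qed.

Import HBNNSimple.

Lemma mol_cvg_nnsfun (f : {nnsfun (measurableTypeR R * measurableTypeR R)%type >-> R}) (B : R) :
  0 <= B -> mol_cvg (fun p => f p * bx 0 B p).
Proof.
move=> B0; rewrite (_ : (fun p => _) =
  (fun p => \sum_(y <- finmap.enum_fset (fset_set (range f))) (y * \1_(f @^-1` [set y] `&` box 0 B) p))); last first.
  apply/funext => p; rewrite fimfunE fsbig_finite//= big_distrl /=.
  by apply: eq_bigr => y _; rewrite -mulrA /bx indicI.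
elim: (finmap.enum_fset (fset_set (range f))) => [|y s IH].
  by have := mol_cvg0; congr mol_cvg; apply/funext => p; rewrite big_nil.
under eq_fun do rewrite big_cons.
apply: mol_cvgD => //; apply: mol_cvgZ; apply: mol_cvg_set => //.
have mf : measurable_fun setT f by exact: measurable_funPT.
by rewrite -[X in measurable X]setTI; exact: (mf measurableT _ (measurable_set1 y)).
Qed.

Lemma mol_cvg_ge0 u : sqic u -> (forall p, 0 <= u p) -> mol_cvg u.
Proof.
move=> su u0; have [B B0 uB] := sqicW su.
apply: mol_cvg_closed => // x x0.
have mu : measurable_fun setT (EFin \o u).
  by apply/measurable_EFinP; exact: sqi_measurable su.1.
have [g [ndg gu]] := @approximation _ (measurableTypeR R * measurableTypeR R)%type R setT
  measurableT _ mu (fun p _ => u0 p : (0 <= (EFin \o u) p)%E).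
have gcvg p : g n p @[n --> \oo] --> u p.
  by have := gu p Logic.I; move=> /fine_cvg.
have gle n p : g n p <= u p.
  apply: (cvgr_to_ge (gcvg p)); exists n => // m /= nm.
  by have /lefP := ndg _ _ nm; exact.
pose f n p : R := (u p - g n p * bx 0 B p) ^+ 2.
have mf n : measurable_fun setT (f n).
  apply: measurable_funX; apply: measurable_funB; first exact: sqi_measurable su.1.
  have mg : measurable_fun setT (g n) by exact: measurable_funPT.
  by apply: measurable_funM; [exact: mg|exact: measurable_bx].
have fle n p : `|f n p| <= u p ^+ 2.
  have h : g n p * bx 0 B p <= u p by apply: le_trans (gle n p); rewrite ler_piMr ?bx_le1.
  have h0 : 0 <= g n p * bx 0 B p by rewrite mulr_ge0 ?bx_ge0.
  by rewrite ger0_norm ?sqr_ge0// lerXn2r ?nnegrE ?u0//; lra.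
have f0 p : f n p @[n --> \oo] --> 0.
  have [pB|pB] := pselect (box 0 B p); last first.
    rewrite /f; under eq_fun do rewrite bx_out// uB// mulr0 subrr expr0n.
    exact: cvg_cst.
  rewrite /f; under eq_fun do rewrite bx_in// mulr1 expr2.
  have h : u p - g n p @[n --> \oo] --> u p - u p.
    by apply: (@cvgB _ R^o); [exact: cvg_cst|exact: gcvg].
  have hh : (u p - g n p) * (u p - g n p) @[n --> \oo] --> (u p - u p) * (u p - u p) by exact: cvgM.
  move: hh; rewrite subrr mulr0; exact.
have iu : pintegrable (fun p => u p ^+ 2) by case: su => -[].
have [n hn] := pint_dominated mf iu fle f0 x0.
by exists (fun p => g n p * bx 0 B p) => //; exact: mol_cvg_nnsfun.
Qed.

Lemma mollify_strong u : sqic u -> mol_cvg u.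
Proof.
move=> su; have mu := sqi_measurable su.1; have [_ [B uB]] := su.
have s1 : sqic (fun p => Num.max (u p) 0).
  split.
    apply: (@sqi_le _ _ u) su.1 _; first exact: measurable_maxr.
    by move=> p; rewrite /Num.max; case: ifPn => _; rewrite ?normr0.
  by exists B => p np; rewrite uB// maxxx.
have s2 : sqic (fun p => Num.max (- u p) 0).
  split.
    apply: (@sqi_le _ _ u) su.1 _; first by apply: measurable_maxr => //; exact: measurable_funN.
    by move=> p; rewrite /Num.max; case: ifPn => _; rewrite ?normr0 ?normrN.
  by exists B => p np; rewrite uB// oppr0 maxxx.
have := mol_cvgB (mol_cvg_ge0 s1 _) (mol_cvg_ge0 s2 _).
rewrite (_ : (fun p => _ - _) = u).
  by apply => p; rewrite le_max lexx orbT.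
apply/funext => p; rewrite /Num.max oppr_lt0.
by case: ifPn => h; case: ifPn => h'; lra.
Qed.

End strong.

(** * Excess decay *)

Section excess.
Context {R : realType}.
Local Notation mu2 := ((@lebesgue_measure R) \x (@lebesgue_measure R))%E.
Implicit Types (u v f g : R * R -> R) (p z w d : R * R) (e r s c : R).

Lemma sqic_kern S C r z : kern S C r -> sqic (S ^~ z).
Proof.
move=> kS; split; first exact: kern_sqi kS z.
exists (`|z.1| + `|z.2| + r) => p np.
have := kern_bd kS p z; rewrite bx_out; last by move=> /box_sub.
by rewrite mulr0 normr_le0 => /eqP.
Qed.

Lemma conv_sqr_autocorr S C r g : kern S C r -> sqic g ->
  pint (fun z => conv S g z ^+ 2) =
  pint (fun w => g w * pint (fun w' => g w' * pint (fun z => S w' z * S w z))).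
Proof.
move=> kS sg.
rewrite (_ : (fun z => _) = (fun z => conv S g z * conv S g z)); last first.
  by apply/funext => z; rewrite expr2.
rewrite (conv_adjoint kS sg (conv_sqic kS sg)); apply: pint_ext => w; congr (_ * _).
rewrite -(conv_adjoint kS sg (sqic_kern w (kern_swap kS))).
by apply: pint_ext => z; rewrite mulrC.
Qed.

(** The L^2 norm of an integral operator applied to g depends on the kernel only through its
    autocorrelation. *)
Lemma isometry S S1 S2 C C1 C2 r g : kern S C r -> kern S1 C1 r -> kern S2 C2 r -> sqic g ->
  (forall w w', pint (fun z => S w z * S w' z) =
     pint (fun z => S1 w z * S1 w' z) + pint (fun z => S2 w z * S2 w' z)) ->
  pint (fun z => conv S g z ^+ 2) =
  pint (fun z => conv S1 g z ^+ 2) + pint (fun z => conv S2 g z ^+ 2).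
Proof.
move=> kS k1 k2 sg corr.
rewrite (conv_sqr_autocorr kS sg) (conv_sqr_autocorr k1 sg) (conv_sqr_autocorr k2 sg).
have i1 T c w : kern T c r -> pintegrable (fun w' => g w' * pint (fun z => T w' z * T w z)).
  move=> kT; apply: sqi_mul sg.1 _.
  have [] := conv_sqic (kern_swap kT) (sqic_kern w (kern_swap kT)).
  by rewrite /conv => h _; move: h; congr sqi; apply/funext => w'; apply: pint_ext => z; rewrite mulrC.
have i2 T c : kern T c r ->
    pintegrable (fun w => g w * pint (fun w' => g w' * pint (fun z => T w' z * T w z))).
  move=> kT; apply: sqi_mul sg.1 _.
  have [] := conv_sqic (kern_swap kT) (conv_sqic kT sg).
  rewrite {1}/conv => h _; move: h; congr sqi; apply/funext => w.
  rewrite -(conv_adjoint kT sg (sqic_kern w (kern_swap kT))).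
  by apply: pint_ext => z.
rewrite -pintD; [|exact: i2 k1|exact: i2 k2].
apply: pint_ext => w; rewrite -mulrDr; congr (_ * _).
rewrite -pintD; [|exact: i1 k1|exact: i1 k2].
by apply: pint_ext => w'; rewrite corr mulrDr.
Qed.

Definition nrmL f z s : R := pint (fun p => f p ^+ 2 * bx z s p).

Lemma nrmL_integrable f z s : sqi f -> pintegrable (fun p => f p ^+ 2 * bx z s p).
Proof.
move=> sf; have [_] := sqi_bxM z s sf.
by congr pintegrable; apply/funext => p; rewrite exprMn [bx _ _ _ ^+ 2]expr2 bx_idem.
Qed.

Lemma nrmLE f z s : nrmL f z s = pint (fun p => (f p * bx z s p) ^+ 2).
Proof. by apply: pint_ext => p; rewrite exprMn [bx _ _ _ ^+ 2]expr2 bx_idem. Qed.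

Lemma nrmL_ge0 f z s : 0 <= nrmL f z s.
Proof. by apply: pint_ge0 => p; rewrite mulr_ge0 ?sqr_ge0 ?bx_ge0. Qed.

Lemma box_subset z z' s s' : `|z.1 - z'.1| + s <= s' -> `|z.2 - z'.2| + s <= s' ->
  box z s `<=` box z' s'.
Proof.
move=> h1 h2 p [p1 p2]; split.
  by have := ler_distD z.1 p.1 z'.1; lra.
by have := ler_distD z.2 p.2 z'.2; lra.
Qed.

Lemma bx_le z z' s s' p : box z s `<=` box z' s' -> bx z s p <= bx z' s' p.
Proof.
move=> zz; have [h|h] := pselect (box z s p); first by rewrite !bx_in//; exact: zz.
by rewrite bx_out// bx_ge0.
Qed.

Lemma nrmL_sub f z z' s s' : sqi (fun p => f p * bx z' s' p) -> box z s `<=` box z' s' ->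
  nrmL f z s <= nrmL f z' s'.
Proof.
move=> sf zz; rewrite !nrmLE.
have E : (fun p => f p * bx z s p) = (fun p => (f p * bx z' s' p) * bx z s p).
  apply/funext => p; have [h|h] := pselect (box z s p); last by rewrite [bx z s p]bx_out// !mulr0.
  by rewrite [bx z' s' p]bx_in ?mulr1//; exact: zz.
have s2 : sqi (fun p => f p * bx z s p) by rewrite E; exact: sqi_bxM.
apply: pint_le; [by case: s2|by case: sf|move=> p].
by rewrite !exprMn ler_wpM2l ?sqr_ge0// lerXn2r ?nnegrE ?bx_ge0// bx_le.
Qed.

(** Local square integrability, since f - c is not in L^2 of the plane for a constant c other than
    0. *)
Definition lsqi f : Prop := measurable_fun setT f /\ forall z s, sqi (fun p => f p * bx z s p).

Lemma sqi_lsqi f : sqi f -> lsqi f.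
Proof. by move=> sf; split; [case: sf|move=> z s; exact: sqi_bxM]. Qed.

Lemma lsqi_cst c : lsqi (fun=> c).
Proof. by split; [exact: measurable_cst|move=> z s; exact: sqiZ (sqi_bx z s)]. Qed.

Lemma lsqiB f g : lsqi f -> lsqi g -> lsqi (fun p => f p - g p).
Proof.
move=> [mf sf] [mg sg]; split; first exact: measurable_funB.
by move=> z s; have := sqiB (sf z s) (sg z s); congr sqi; apply/funext => p; rewrite mulrBl.
Qed.

Lemma lsqi_sqic f z s : lsqi f -> sqic (fun p => f p * bx z s p).
Proof.
move=> [_ sf]; have := sqic_bxM z s (sf z s).
by congr sqic; apply/funext => p; rewrite -mulrA bx_idem.
Qed.

Lemma nrmL_sub' f z z' s s' : lsqi f -> box z s `<=` box z' s' -> nrmL f z s <= nrmL f z' s'.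
Proof. by move=> [_ sf]; exact: nrmL_sub. Qed.

Lemma nrmL_add f g z s : lsqi f -> lsqi g ->
  nrmL (fun p => f p + g p) z s <= 2 * nrmL f z s + 2 * nrmL g z s.
Proof.
move=> [_ sf] [_ sg]; rewrite !nrmLE.
apply: le_trans (pint_sqrD (sf z s) (sg z s)).
by rewrite le_eqVlt; apply/orP; left; apply/eqP; apply: pint_ext => p; rewrite mulrDl.
Qed.

Section kernels.
Variables e r : R.
Hypotheses (e0 : 0 < e) (er : e <= r).

Let r0 : 0 < r. Proof. by apply: lt_le_trans er. Qed.
Let q := qk e r.
Let sq : smooth q := @smooth_qk R e r.
Let qr t : r ^+ 2 <= t -> q t = 0. Proof. exact: qk_out. Qed.

(** [kP_corr] integrates over the first argument and the operators over the second; the kernels are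
    even, so the two agree. *)
Lemma kernels_isometry g : sqic g ->
  pint (fun z => conv (fun w z => kP q (w - z)) g z ^+ 2) =
  pint (fun z => conv (fun w z => kS1 q (w - z)) g z ^+ 2) +
  pint (fun z => conv (fun w z => kS2 q (w - z)) g z ^+ 2).
Proof.
move=> sg.
have [C kP_] := kern_shift r0 (continuous_kP sq) (csupp_kP sq r0 qr).
have [C1 k1] := kern_shift r0 (continuous_kS1 sq) (csupp_kS1 sq r0 qr).
have [C2 k2] := kern_shift r0 (continuous_kS2 sq) (csupp_kS2 sq r0 qr).
apply: (isometry kP_ k1 k2 sg) => w w'.
have I T c : kern T c (2 * r) -> pintegrable (fun z => T w z * T w' z).
  by move=> kT; apply: sqi_mul; exact: kern_sqir kT _.
apply/eqP; rewrite -subr_eq0 opprD addrA; apply/eqP.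
rewrite -(pintB (I _ _ kP_) (I _ _ k1)).
rewrite -(pintB (pintegrableB (I _ _ kP_) (I _ _ k1)) (I _ _ k2)).
rewrite -[RHS](kP_corr sq r0 qr w w'); apply: pint_ext => z.
by rewrite !(kP_sym q z) !(kS1_sym q z) !(kS2_sym q z).
Qed.

Lemma conv_kP g z : sqic g ->
  conv (fun w z => kP q (w - z)) g z = conv (mol e) g z - conv (mol r) g z.
Proof.
move=> sg; rewrite /conv -pintB; [|exact: sqi_mul sg.1 (mol_sqi z e0)|exact: sqi_mul sg.1 (mol_sqi z r0)].
by apply: pint_ext => w; rewrite /q kP_qk mulrBr.
Qed.

End kernels.

End excess.

(** * Distance in L^2 between a function and its mollification *)

Section oscillation.
Context {R : realType}.
Local Notation mu2 := ((@lebesgue_measure R) \x (@lebesgue_measure R))%E.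
Implicit Types (D : set (R * R)) (u v f g : R * R -> R) (p z w d : R * R) (e r s c : R).

Lemma nrmL_ext f g z s : (forall p, box z s p -> f p = g p) -> nrmL f z s = nrmL g z s.
Proof.
move=> fg; apply: pint_ext => p; have [h|h] := pselect (box z s p); first by rewrite fg.
by rewrite bx_out// !mulr0.
Qed.

Definition rad_kern (k : R * R -> R) w z : R := k (w - z).

(* The conclusion of [weak_cauchy_riemann], for every admissible kernel. *)
Definition singular_pair D f g1 g2 : Prop := forall e r z, 0 < e -> e <= r -> cbox z r `<=` D ->
  conv (rad_kern (kP (qk e r))) f z =
  conv (rad_kern (kS1 (qk e r))) g1 z + conv (rad_kern (kS2 (qk e r))) g2 z.

Lemma in_box_cbox z0 z w r s t : s + t <= r -> box z0 s z -> cbox z t w -> box z0 r w.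
Proof.
move=> str [z1 z2] [w1 w2]; split.
  by have := ler_distD z.1 w.1 z0.1; lra.
by have := ler_distD z.2 w.2 z0.2; lra.
Qed.

(** A kernel of mean zero does not see constants, and one supported within t does not see a
    truncation at distance t. Hence only the oscillation of g on the larger square matters. *)
Lemma conv_rad_local (k : R * R -> R) t g z0 z r s c : continuous k -> csupp t k -> 0 < t -> sqi g ->
  pint (fun w => k (w - z)) = 0 -> s + t <= r -> box z0 s z ->
  conv (rad_kern k) (fun p => (g p - c) * bx z0 r p) z = conv (rad_kern k) g z.
Proof.
move=> ck sk t0 sg k0 str zs; have [C kC] := kern_shift t0 ck sk.
have i1 : pintegrable (fun w => g w * k (w - z)) by exact: sqi_mul sg (kern_sqi kC z).
have i2 := pint_shift_integrable t0 z ck sk.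
rewrite /conv (_ : (fun w => _) = (fun w => g w * k (w - z) - c * k (w - z))); last first.
  apply/funext => w; rewrite /rad_kern; have [h|h] := pselect (cbox z t w).
    by rewrite bx_in; [rewrite mulr1; ring|exact: in_box_cbox str zs h].
  have -> : k (w - z) = 0 by apply: sk => /cbox_shift.
  by rewrite !mulr0 subrr.
by rewrite (pintB i1 (pintegrableZ c i2)) (pintZ c i2) k0 mulr0 subr0.
Qed.

Lemma conv_mol_local f z0 z e r s : 0 < e -> s + e <= r -> box z0 s z ->
  conv (mol e) (fun p => f p * bx z0 r p) z = conv (mol e) f z.
Proof.
move=> e0 ser zs; apply: pint_ext => w; have [h|h] := pselect (box z e w).
  by rewrite bx_in ?mulr1//; apply: in_box_cbox ser zs (box_cbox h).
by rewrite mol_out// !mulr0.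
Qed.

(** On the small square, the mollification of f at scale e minus that at scale t is S1 g1 + S2 g2.
    The direct kernel bounds of S1 and S2 degenerate as e tends to 0, but by the isometry their
    norms are controlled by P, a difference of two mollifiers, uniformly in e. Then e tends to 0 by
    strong convergence. *)
Lemma oscillation_bound : exists2 K, 0 <= K & forall D f g1 g2 z0 r s t c1 c2,
  sqi f -> sqi g1 -> sqi g2 -> singular_pair D f g1 g2 ->
  0 < t -> s + t <= r -> box z0 r `<=` D ->
  nrmL (fun p => conv (mol t) f p - f p) z0 s <=
  K * (nrmL (fun p => g1 p - c1) z0 r + nrmL (fun p => g2 p - c2) z0 r).
Proof.
have [K K0 hK] := @mol_bound R; exists (16 * K); first by lra.
move=> D f g1 g2 z0 r s t c1 c2 sf sg1 sg2 sp t0 str zD.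
pose fh p := f p * bx z0 r p.
have sfh : sqic fh by apply: lsqi_sqic; exact: sqi_lsqi.
pose gh (g : R * R -> R) c p := (g p - c) * bx z0 r p.
have sgh g c : sqi g -> sqic (gh g c).
  by move=> sg; apply: lsqi_sqic; apply: lsqiB; [exact: sqi_lsqi|exact: lsqi_cst].
have gN g c : pint (fun p => gh g c p ^+ 2) = nrmL (fun p => g p - c) z0 r by rewrite nrmLE.
rewrite -!gN; set N1 := pint (fun p => gh g1 c1 p ^+ 2); set N2 := pint (fun p => gh g2 c2 p ^+ 2).
rewrite (_ : nrmL _ z0 s = nrmL (fun p => conv (mol t) fh p - fh p) z0 s); last first.
  apply: nrmL_ext => z zs; rewrite /fh (conv_mol_local f t0 str zs); congr (_ - _).
  by rewrite bx_in ?mulr1//; apply: (in_box_cbox (t := 0)) zs _; [lra|split; rewrite subrr normr0].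
apply/ler_addgt0Pr => x x0.
have [d d0 hd] := (mollify_strong sfh).2 (x / 2) ltac:(lra).
pose e := Num.min (d / 2) t.
have e0 : 0 < e by rewrite lt_min t0 andbT; lra.
have ed : e < d by rewrite gt_min; apply/orP; left; lra.
have et : e <= t by rewrite ge_min lexx orbT.
have {hd} hx := hd e e0 ed.
have sq := @smooth_qk R e t; have qo := fun s => @qk_out R e t s e0 et.
pose S1 := rad_kern (kS1 (qk e t)); pose S2 := rad_kern (kS2 (qk e t)).
have [C1 k1] := kern_shift t0 (continuous_kS1 sq) (csupp_kS1 sq t0 qo).
have [C2 k2] := kern_shift t0 (continuous_kS2 sq) (csupp_kS2 sq t0 qo).
have [Ct _ /(_ _ t0) kt] := @mol_kern R.
have [Ce _ /(_ _ e0) ke] := @mol_kern R.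
pose T z := conv S1 (gh g1 c1) z + conv S2 (gh g2 c2) z.
have sT : sqic T by apply: sqicD; [exact: conv_sqic k1 _ (sgh _ _ sg1)|exact: conv_sqic k2 _ (sgh _ _ sg2)].
have TE z : box z0 s z -> T z = conv (mol e) fh z - conv (mol t) fh z.
  move=> zs; rewrite /T /S1 /S2.
  rewrite (conv_rad_local c1 (continuous_kS1 sq) (csupp_kS1 sq t0 qo) t0 sg1 (pint_kS10 sq t0 qo z) str zs).
  rewrite (conv_rad_local c2 (continuous_kS2 sq) (csupp_kS2 sq t0 qo) t0 sg2 (pint_kS20 sq t0 qo z) str zs).
  rewrite -sp//; last by move=> w wz; apply: zD; exact: in_box_cbox str zs wz.
  rewrite /fh (conv_mol_local f t0 str zs) (conv_mol_local f e0 _ zs); last by lra.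
  rewrite /conv -pintB; [|exact: sqi_mul sf (mol_sqi z e0)|exact: sqi_mul sf (mol_sqi z t0)].
  by apply: pint_ext => w; rewrite /rad_kern kP_qk mulrBr.
have T2 : pint (fun z => T z ^+ 2) <= 8 * K * (N1 + N2).
  (* The isometry trades the singular kernels for mollifiers at scales e and t, each of squared norm
     at most K. *)
  have B g c (sg : sqi g) : pint (fun z => conv S1 (gh g c) z ^+ 2) + pint (fun z => conv S2 (gh g c) z ^+ 2) <=
      4 * K * pint (fun p => gh g c p ^+ 2).
    have sh := sgh g c sg; rewrite -(kernels_isometry e0 et sh).
    rewrite (_ : (fun z => _) = (fun z => (conv (mol e) (gh g c) z + (- 1) * conv (mol t) (gh g c) z) ^+ 2)); last first.
      by apply/funext => z; rewrite conv_kP// mulN1r.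
    have st := (sqicZ (-1) (conv_sqic kt sh)).1.
    apply: (le_trans (pint_sqrD (conv_sqic ke sh).1 st)).
    have -> : pint (fun p => (- 1 * conv (mol t) (gh g c) p) ^+ 2) = pint (fun p => conv (mol t) (gh g c) p ^+ 2).
      by apply: pint_ext => p; rewrite exprMn sqrrN expr1n mul1r.
    have aux (a b k n : R) : a <= k * n -> b <= k * n -> 2 * a + 2 * b <= 4 * k * n by lra.
    exact: aux (hK e _ e0 sh) (hK t _ t0 sh).
  apply: (le_trans (pint_sqrD (conv_sqic k1 (sgh g1 c1 sg1)).1 (conv_sqic k2 (sgh g2 c2 sg2)).1)).
  have P (h : R * R -> R) : 0 <= pint (fun z => h z ^+ 2) by apply: pint_ge0 => z; exact: sqr_ge0.
  have aux (a b a' b' k n n' : R) : a + b <= 4 * k * n -> a' + b' <= 4 * k * n' -> 0 <= b -> 0 <= a' ->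
    2 * a + 2 * b' <= 8 * k * (n + n') by lra.
  exact: aux (B g1 c1 sg1) (B g2 c2 sg2) (P _) (P _).
pose h z := conv (mol e) fh z - fh z.
have sh : sqic h := sqicB (conv_sqic ke sfh) sfh.
have sT' := sqicZ (-1) sT.
rewrite (_ : nrmL _ z0 s = nrmL (fun z => h z + (- 1) * T z) z0 s); last first.
  apply: nrmL_ext => z zs; rewrite TE// /h.
  have aux (a b c : R) : b - c = a - c + -1 * (a - b) by ring.
  exact: aux.
apply: (@le_trans _ _ (pint (fun z => (h z + (- 1) * T z) ^+ 2))).
  apply: pint_le; [exact: nrmL_integrable (sqiD sh.1 sT'.1)|by have [] := sqiD sh.1 sT'.1|].
  move=> p; rewrite ler_piMr ?sqr_ge0 ?bx_le1//.
apply: (le_trans (pint_sqrD sh.1 sT'.1)).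
have -> : pint (fun p => (- 1 * T p) ^+ 2) = pint (fun p => T p ^+ 2).
  by apply: pint_ext => p; rewrite exprMn sqrrN expr1n mul1r.
have aux (a b k n : R) : a <= x / 2 -> b <= 8 * k * n -> 2 * a + 2 * b <= 16 * k * n + x by lra.
exact: aux hx T2.
Qed.

End oscillation.

(** * Decay of the excess under one change of scale *)

Section decay.
Context {R : realType}.
Local Notation mu2 := ((@lebesgue_measure R) \x (@lebesgue_measure R))%E.
Implicit Types (D : set (R * R)) (u v f g k : R * R -> R) (p z w d : R * R) (e r s c A : R).

Lemma nrmLC f g z s : nrmL (fun p => f p - g p) z s = nrmL (fun p => g p - f p) z s.
Proof. by apply: pint_ext => p; rewrite -sqrrN opprB. Qed.

Lemma nrmL_lintegrable f z s : lsqi f -> pintegrable (fun p => f p ^+ 2 * bx z s p).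
Proof.
move=> [_ sf]; have [_] := sf z s.
by congr pintegrable; apply/funext => p; rewrite exprMn [bx _ _ _ ^+ 2]expr2 bx_idem.
Qed.

(** The support of k localises g, so local square integrability is enough; it is applied to f - A,
    where A is constant. *)
Lemma weighted_cauchy_schwarz g k c z r : lsqi g -> measurable_fun setT k -> 0 <= r ->
  (forall w, `|k w| <= c * bx z r w) ->
  pint (fun w => g w * k w) ^+ 2 <= c ^+ 2 * (4 * r ^+ 2) * nrmL g z r.
Proof.
move=> lg mk r0 kb; have sb : sqi (fun w => c * bx z r w) by exact: sqiZ (sqi_bx z r).
have sk : sqi k.
  apply: sqi_le mk sb _ => w; apply: (le_trans (kb w)); exact: ler_norm.
have sg := (lsqi_sqic z r lg).1.
rewrite (_ : (fun w => g w * k w) = (fun w => (g w * bx z r w) * k w)); last first.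
  apply/funext => w; have [h|h] := pselect (box z r w); first by rewrite bx_in ?mulr1.
  have -> : k w = 0 by apply/eqP; rewrite -normr_le0 (le_trans (kb w))// bx_out ?mulr0.
  by rewrite !mulr0.
apply: (le_trans (cauchy_schwarz sg sk)); rewrite -nrmLE mulrC ler_wpM2r ?nrmL_ge0//.
have -> : c ^+ 2 * (4 * r ^+ 2) = pint (fun w => (c * bx z r w) ^+ 2).
  rewrite -(pint_bx z r0) -pintZ; last exact: pintegrable_bx.
  by apply: pint_ext => w; rewrite exprMn [bx _ _ _ ^+ 2]expr2 bx_idem.
apply: pint_le => [||w]; [by case: sk|by case: sb|].
by rewrite -real_normK ?num_real// lerXn2r ?nnegrE//; exact: le_trans (kb w).
Qed.

Lemma conv_mol_cst f A t z : 0 < t -> sqi f ->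
  conv (mol t) f z - A = pint (fun w => (f w - A) * mol t w z).
Proof.
move=> t0 sf; have i1 := sqi_mul sf (mol_sqi z t0); have i2 := mol_integrable z t0.
rewrite (_ : (fun w => _) = (fun w => f w * mol t w z - A * mol t w z)); last first.
  by apply/funext => w; rewrite mulrBl.
by rewrite (pintB i1 (pintegrableZ A i2)) (pintZ A i2) mol_mass// mulr1.
Qed.

(** The kernel has mass one, so A can be subtracted under the integral; the second bound also uses
    that the kernel is Lipschitz with constant of order t^-3. *)
Lemma conv_mol_oscillation : exists2 K, 0 <= K & forall f A z0 t, sqi f -> 0 < t ->
  (conv (mol t) f z0 - A) ^+ 2 <= K * t ^- 2 * nrmL (fun p => f p - A) z0 t /\
  (forall z s, s <= t -> box z0 s z ->
  (conv (mol t) f z - conv (mol t) f z0) ^+ 2 <=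
    K * s ^+ 2 * t ^- 4 * nrmL (fun p => f p - A) z0 (2 * t)).
Proof.
have [M M0 kM] := @mol_kern R; have [L L0 lL] := @mol_lipschitz R.
exists (4 * M ^+ 2 + 64 * L ^+ 2); first by rewrite addr_ge0// mulr_ge0// sqr_ge0.
move=> f A z0 t sf t0.
have lf : lsqi (fun p => f p - A) by apply: lsqiB; [exact: sqi_lsqi|exact: lsqi_cst].
have mm z : measurable_fun setT (mol t ^~ z) by case: (mol_sqi z t0).
split=> [|z s st zs].
  rewrite conv_mol_cst//.
  apply: (le_trans (weighted_cauchy_schwarz lf (mm z0) (ltW t0) (fun w => kern_bd (kM t t0) w z0))).
  rewrite ler_wpM2r ?nrmL_ge0//.
  have -> : (M * t ^- 2) ^+ 2 * (4 * t ^+ 2) = 4 * M ^+ 2 * t ^- 2 by field; lra.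
  by rewrite ler_wpM2r ?invr_ge0 ?sqr_ge0// lerDl mulr_ge0// sqr_ge0.
have s0 : 0 <= s by case: zs => zs _; apply: le_trans (ltW zs).
have -> : conv (mol t) f z - conv (mol t) f z0 = pint (fun w => (f w - A) * (mol t w z - mol t w z0)).
  have aux (a b c : R) : a - b = (a - c) - (b - c) by ring.
  rewrite [LHS](aux _ _ A).
  have I y : pintegrable (fun w => (f w - A) * mol t w y).
    have := pintegrableB (sqi_mul sf (mol_sqi y t0)) (pintegrableZ A (mol_integrable y t0)).
    by congr pintegrable; apply/funext => w; rewrite mulrBl.
  apply: (etrans (congr2 (fun a b => a - b) (conv_mol_cst A z t0 sf) (conv_mol_cst A z0 t0 sf))).
  have E := pintB (I z) (I z0).
  apply: (etrans (esym E)).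
  by apply: pint_ext => w; rewrite [RHS]mulrBr.
have [z1 z2] := zs; rewrite distrC in z1; rewrite distrC in z2.
have kb w : `|mol t w z - mol t w z0| <= (2 * L * s * t ^- 3) * bx z0 (2 * t) w.
  rewrite distrC.
  have lb := lL t w z0 z t0 (ltW (lt_le_trans z1 st)) (ltW (lt_le_trans z2 st)).
  apply: (le_trans lb).
  rewrite ler_wpM2r ?bx_ge0//.
  have -> : 2 * L * s * t ^- 3 = L * t ^- 3 * (s + s) by move: (t ^- 3) => ti; ring.
  rewrite ler_wpM2l//; first by rewrite mulr_ge0// invr_ge0 exprn_ge0// ltW.
  exact: lerD (ltW z1) (ltW z2).
apply: (le_trans (weighted_cauchy_schwarz lf _ _ kb)); [exact: measurable_funB|lra|].
rewrite ler_wpM2r ?nrmL_ge0//.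
have -> : (2 * L * s * t ^- 3) ^+ 2 * (4 * (2 * t) ^+ 2) = 64 * L ^+ 2 * s ^+ 2 * t ^- 4 by field; lra.
rewrite ler_wpM2r ?invr_ge0 ?exprn_even_ge0// ler_wpM2r ?sqr_ge0//.
by rewrite lerDr mulr_ge0// sqr_ge0.
Qed.

(** Split f - A' as (f - f_t) + (f_t - f_t(z0)) with t = r/4. The first part is the oscillation
    bound; the second is Lipschitz, so its square is of order x^2 on a square of area of order x^2,
    whence x^4. *)
Lemma excess_decay : exists2 K, 0 <= K & forall D f g1 g2 z0 r x A c1 c2,
  sqi f -> sqi g1 -> sqi g2 -> singular_pair D f g1 g2 ->
  0 < r -> 0 < x -> x <= 4^-1 -> box z0 r `<=` D ->
  let A' := conv (mol (r / 4)) f z0 in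
  (A' - A) ^+ 2 <= K * r ^- 2 * nrmL (fun p => f p - A) z0 r /\
  nrmL (fun p => f p - A') z0 (x * r) <=
  K * (nrmL (fun p => g1 p - c1) z0 r + nrmL (fun p => g2 p - c2) z0 r) +
  K * x ^+ 4 * nrmL (fun p => f p - A) z0 r.
Proof.
have aux (k l y n a b c : R) : 0 <= k -> 0 <= l -> 0 <= y -> 0 <= n -> 0 <= c -> a <= k * c ->
    b <= 1024 * l * y * n -> 2 * a + 2 * b <= (2 * k + 2048 * l) * c + (2 * k + 2048 * l) * y * n.
  move=> k0 l0 y0 n0 c0 h h'.
  have := mulr_ge0 l0 c0; have := mulr_ge0 k0 (mulr_ge0 y0 n0); lra.
have [K K0 hK] := @oscillation_bound R; have [L L0 hL] := conv_mol_oscillation.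
exists (2 * K + 2048 * L); first by lra.
move=> D f g1 g2 z0 r x A c1 c2 sf sg1 sg2 sp r0 x0 x4 zD A'.
set t := r / 4 in A' *; have t0 : 0 < t by rewrite /t; lra.
have [h1 h2] := hL f A z0 t sf t0.
have lf a : lsqi (fun p => f p - a) by apply: lsqiB; [exact: sqi_lsqi|exact: lsqi_cst].
have box1 s : s <= r -> box z0 s `<=` box z0 r.
  by move=> sr; apply: box_subset; rewrite subrr normr0 add0r.
have n1 : nrmL (fun p => f p - A) z0 t <= nrmL (fun p => f p - A) z0 r.
  by apply: nrmL_sub' => //; apply: box1; rewrite /t; lra.
have n2 : nrmL (fun p => f p - A) z0 (2 * t) <= nrmL (fun p => f p - A) z0 r.
  by apply: nrmL_sub' => //; apply: box1; rewrite /t; lra.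
split.
  apply: (le_trans h1).
  have -> : L * t ^- 2 = 16 * L * r ^- 2 by rewrite /t; field; lra.
  apply: ler_pM; rewrite ?nrmL_ge0//.
    by rewrite mulr_ge0 ?invr_ge0 ?sqr_ge0//; lra.
  by rewrite ler_wpM2r ?invr_ge0 ?sqr_ge0//; lra.
have xr : x * r <= t by rewrite /t mulrC ler_wpM2l// ltW.
have osc := hK D f g1 g2 z0 r (x * r) t c1 c2 sf sg1 sg2 sp t0 ltac:(rewrite /t in xr *; lra) zD.
(* Truncating f before mollifying makes F square integrable on the plane without changing it on the
   small square. *)
pose F z := conv (mol t) (fun p => f p * bx z0 r p) z.
have sF : sqi F.
  have [M _ kM] := @mol_kern R.
  exact: (conv_sqic (kM t t0) (lsqi_sqic z0 r (sqi_lsqi sf))).1.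
have FE z : box z0 (x * r) z -> F z = conv (mol t) f z.
  by move=> zs; apply: conv_mol_local t0 _ zs; rewrite /t in xr *; lra.
have lF a : lsqi (fun p => F p - a) by apply: lsqiB; [exact: sqi_lsqi|exact: lsqi_cst].
have -> : nrmL (fun p => f p - A') z0 (x * r) = nrmL (fun p => (f p - F p) + (F p - A')) z0 (x * r).
  by apply: nrmL_ext => p _; rewrite addrA subrK.
apply: (le_trans (nrmL_add _ _ (lsqiB (sqi_lsqi sf) (sqi_lsqi sF)) (lF A'))).
have o1 : nrmL (fun p => f p - F p) z0 (x * r) <=
    K * (nrmL (fun p => g1 p - c1) z0 r + nrmL (fun p => g2 p - c2) z0 r).
  by rewrite nrmLC (nrmL_ext (g := fun p => conv (mol t) f p - f p))// => p /FE ->.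
(* The constant is 4 * 4^4: the area 4 (x r)^2 times t^-4 = 4^4 r^-4. *)
have o2 : nrmL (fun p => F p - A') z0 (x * r) <= 1024 * L * x ^+ 4 * nrmL (fun p => f p - A) z0 r.
  set N := nrmL _ z0 r in n1 n2 *.
  have xr0 : 0 <= x * r by rewrite mulr_ge0// ltW.
  apply: (@le_trans _ _ (pint (fun p => (L * (x * r) ^+ 2 * t ^- 4 * N) * bx z0 (x * r) p))).
    apply: pint_le; [exact: nrmL_lintegrable|by apply: pintegrableZ; exact: pintegrable_bx|].
    move=> p; have [h|h] := pselect (box z0 (x * r) p); last by rewrite bx_out// !mulr0.
    rewrite ler_wpM2r ?bx_ge0// FE//; apply: (le_trans (h2 p _ xr h)).
    apply: ler_wpM2l n2; apply: mulr_ge0; last by rewrite invr_ge0 exprn_even_ge0.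
    by apply: mulr_ge0 => //; exact: sqr_ge0.
  rewrite pintZ; last exact: pintegrable_bx.
  rewrite pint_bx// le_eqVlt; apply/orP; left; apply/eqP; rewrite /t; field; lra.
have x40 : 0 <= x ^+ 4 by exact: exprn_even_ge0.
apply: (aux _ _ _ _ _ _ _ K0 L0 x40 _ _ o1 o2); first exact: nrmL_ge0.
by apply: addr_ge0; exact: nrmL_ge0.
Qed.

End decay.

(** * Iteration along scales *)

Section iteration.
Context {R : realType}.
Local Notation mu2 := ((@lebesgue_measure R) \x (@lebesgue_measure R))%E.
Implicit Types (D : set (R * R)) (u v f g k : R * R -> R) (p z w d : R * R) (e r s c A : R).

(** Halving the excess contracts its square root by 3/4, because (3/4)^2 >= 1/2. *)
Lemma sqrt_half_le (a b : R) : 0 <= a -> 0 <= b ->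
  Num.sqrt (a / 2 + b) <= 3 / 4 * Num.sqrt a + Num.sqrt b.
Proof.
move=> a0 b0; have sa := sqrtr_ge0 a; have sb := sqrtr_ge0 b.
have h : 0 <= 3 / 4 * Num.sqrt a + Num.sqrt b by lra.
rewrite -[leRHS](ger0_norm h) -sqrtr_sqr; apply: ler_wsqrtr.
rewrite -{1}(sqr_sqrtr a0) -{1}(sqr_sqrtr b0).
have := mulr_ge0 sa sb; have := sqr_ge0 (Num.sqrt a).
by move: (Num.sqrt a) (Num.sqrt b) sa sb {h} => x y x0 y0; nra.
Qed.

(* The potential [N n + 4 k sqrt (e n) + Z mu ^ n] does not increase while
   [N n] is at least [kap]. *)
Lemma iteration_bounded (C k D kap Y mu : R) : 0 <= C -> 0 <= k -> 0 <= D -> 0 <= kap -> 0 <= Y ->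
  0 <= mu -> mu < 1 -> exists2 V, 0 <= V & forall e N : nat -> R,
  (forall n, 0 <= e n) -> N 0%N <= 0 -> e 0%N <= Y ->
  (forall n, e n.+1 <= C + e n / 4) ->
  (forall n, N n.+1 <= N n + k * Num.sqrt (e n)) ->
  (forall n, kap <= N n -> e n.+1 <= e n / 2 + D ^+ 2 * mu ^+ n ^+ 2) ->
  forall n, N n <= V /\ e n <= V.
Proof.
move=> C0 k0 D0 kap0 Y0 mu0 mu1.
pose Y' := Y + 2 * C; have Y'0 : 0 <= Y' by rewrite /Y'; lra.
pose W := Num.sqrt Y'; have W0 : 0 <= W by exact: sqrtr_ge0.
(* Chosen so that the drop Z mu^n - Z mu^(n+1) = 4 k D mu^n pays for the forcing term. The
   coefficient 4 does the same for the growth of [N], as 4 (1 - 3/4) = 1. *)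
pose Z := 4 * k * D / (1 - mu).
have Z0 : 0 <= Z by rewrite divr_ge0 ?mulr_ge0//; lra.
have ZE : Z * (1 - mu) = 4 * k * D by rewrite /Z mulfVK// subr_eq0 gt_eqF.
have kW : 0 <= k * W by exact: mulr_ge0.
(* The largest potential just after a step with [N n < kap]: [N] is then at most kap + k W, and the
   two other terms are at most 4 k W and Z. *)
pose V := kap + 5 * (k * W) + Z.
exists (V + Y'); first by rewrite /V; lra.
move=> e N e0 N0 eY h1 h2 h3.
have eY' n : e n <= Y'.
  by elim: n => [|n IH]; [rewrite /Y'; lra|have := h1 n; rewrite /Y' in IH *; lra].
have wW n : Num.sqrt (e n) <= W by apply: ler_wsqrtr.
have w0 n := sqrtr_ge0 (e n).
have mn n : 0 <= mu ^+ n /\ mu ^+ n <= 1 by split; [exact: exprn_ge0|apply: exprn_ile1 => //; exact: ltW].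
suff VB n : N n + 4 * (k * Num.sqrt (e n)) + Z * mu ^+ n <= V.
  move=> n; have := VB n; have [m0 _] := mn n; have := eY' n; have := e0 n.
  have := mulr_ge0 k0 (w0 n); have := mulr_ge0 Z0 m0; rewrite /V; split; lra.
elim: n => [|n IH].
  have := ler_wpM2l k0 (wW 0%N); rewrite expr0 mulr1 /V; lra.
have [m0 m1] := mn n; have [m0' m1'] := mn n.+1.
have kw := ler_wpM2l k0 (wW n); have kw' := ler_wpM2l k0 (wW n.+1).
have [kN|kN] := leP kap (N n); last first.
  have := h2 n; have := ler_wpM2l Z0 m1'; rewrite mulr1 /V; lra.
have Dm : 0 <= D * mu ^+ n by exact: mulr_ge0.
have : Num.sqrt (e n.+1) <= 3 / 4 * Num.sqrt (e n) + D * mu ^+ n.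
  have -> : D * mu ^+ n = Num.sqrt (D ^+ 2 * mu ^+ n ^+ 2) by rewrite -exprMn sqrtr_sqr ger0_norm.
  apply: le_trans (sqrt_half_le (e0 n) _); last by rewrite mulr_ge0// sqr_ge0.
  by apply: ler_wsqrtr; exact: h3.
move=> /(ler_wpM2l k0); rewrite mulrDr.
have := h2 n; rewrite exprS; move: ZE IH.
move: (Num.sqrt (e n)) (Num.sqrt (e n.+1)) (mu ^+ n) => a b m ZE IH hN hb.
have : Z * (1 - mu) * m = 4 * k * D * m by rewrite ZE.
lra.
Qed.

(* (b - c) A^* = b (A - a)^* + (a b^* - F)^* for the number c with c A^* = F^*. *)
Lemma hopf_perturb (a1 a2 b1 b2 A1 A2 F1 F2 T : R) : T = A1 ^+ 2 + A2 ^+ 2 -> 0 < T ->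
  ((b1 - (F1 * A1 + F2 * A2) / T) ^+ 2 + (b2 - (F1 * A2 - F2 * A1) / T) ^+ 2) <=
  2 * T^-1 * ((b1 ^+ 2 + b2 ^+ 2) * ((a1 - A1) ^+ 2 + (a2 - A2) ^+ 2) +
   ((a1 * b1 + a2 * b2 - F1) ^+ 2 + (a2 * b1 - a1 * b2 - F2) ^+ 2)).
Proof.
move=> TE T0; have Tn : T != 0 by rewrite gt_eqF.
pose X := b1 * (A1 - a1) + b2 * (A2 - a2); pose X' := a1 * b1 + a2 * b2 - F1.
pose Y := b2 * (A1 - a1) - b1 * (A2 - a2); pose Y' := - (a2 * b1 - a1 * b2 - F2).
have -> : (b1 - (F1 * A1 + F2 * A2) / T) ^+ 2 + (b2 - (F1 * A2 - F2 * A1) / T) ^+ 2 =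
   T^-1 * ((X + X') ^+ 2 + (Y + Y') ^+ 2).
  by move: Tn; rewrite /X /X' /Y /Y' TE => Tn; field.
rewrite -mulrA mulrCA ler_wpM2l//; first by rewrite invr_ge0 ltW.
have -> : (b1 ^+ 2 + b2 ^+ 2) * ((a1 - A1) ^+ 2 + (a2 - A2) ^+ 2) +
   (X' ^+ 2 + (a2 * b1 - a1 * b2 - F2) ^+ 2) = X ^+ 2 + Y ^+ 2 + (X' ^+ 2 + Y' ^+ 2).
  by rewrite /X /Y /Y'; ring.
clearbody X X' Y Y'; have := sqr_ge0 (X - X'); have := sqr_ge0 (Y - Y'); clear; nra.
Qed.

Lemma nrmL2_le_ae D f g u v z r a b : lsqi f -> lsqi g -> lsqi u -> lsqi v -> 0 <= r ->
  box z r `<=` D ->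
  {ae mu2, forall p, D p -> box z r p -> f p ^+ 2 + g p ^+ 2 <= a * (u p ^+ 2 + v p ^+ 2) + b} ->
  nrmL f z r + nrmL g z r <= a * (nrmL u z r + nrmL v z r) + b * (4 * r ^+ 2).
Proof.
move=> lf lg lu lv r0 zD h.
have I k : lsqi k -> pintegrable (fun p => k p ^+ 2 * bx z r p) by exact: nrmL_lintegrable.
have Il := pintegrableD (I _ lf) (I _ lg).
have Iuv := pintegrableD (I _ lu) (I _ lv).
have Ib := pintegrable_bx z r.
have Ir := pintegrableD (pintegrableZ a Iuv) (pintegrableZ b Ib).
have E1 := pintD (I _ lf) (I _ lg).
have E2 := pintD (I _ lu) (I _ lv).
have E3 := pintD (pintegrableZ a Iuv) (pintegrableZ b Ib).
have E4 := pintZ a Iuv; have E5 := pintZ b Ib.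
have E : pint (fun p => a * (u p ^+ 2 * bx z r p + v p ^+ 2 * bx z r p) + b * bx z r p) =
    a * (nrmL u z r + nrmL v z r) + b * (4 * r ^+ 2).
  by apply: (etrans E3); rewrite E4 E5 E2 pint_bx.
rewrite -E; rewrite /nrmL -E1; apply: pint_le_ae => //.
apply: filterS h => p hp; have [zp|zp] := pselect (box z r p).
  by rewrite bx_in// !mulr1; apply: hp => //; exact: zD.
by rewrite bx_out// !mulr0 addr0 mulr0 addr0.
Qed.

(** The decay estimate holds for any constants subtracted from b. With 0 it gives a bound valid at
    every scale; with the constants of [hopf_perturb] it gives a bound whose factor 1/|A|^2 is small
    when the average is large. *)
Lemma excess_step : exists2 K, 0 <= K & forall D a1 a2 b1 b2 F1 F2 z (M h : R) r x A1 A2,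
  sqi a1 -> sqi a2 -> sqi b1 -> sqi b2 ->
  singular_pair D a1 b1 (fun p => - b2 p) -> singular_pair D a2 b2 b1 ->
  {ae mu2, forall p, D p -> b1 p ^+ 2 + b2 p ^+ 2 <= M} ->
  {ae mu2, forall p, D p -> F1 p = a1 p * b1 p + a2 p * b2 p /\ F2 p = a2 p * b1 p - a1 p * b2 p} ->
  (forall p, box z r p -> (F1 p - F1 z) ^+ 2 + (F2 p - F2 z) ^+ 2 <= h) ->
  0 < r -> 0 < x -> x <= 4^-1 -> box z r `<=` D ->
  let A1' := conv (mol (r / 4)) a1 z in let A2' := conv (mol (r / 4)) a2 z in
  let E := nrmL (fun p => a1 p - A1) z r + nrmL (fun p => a2 p - A2) z r in
  let E' := nrmL (fun p => a1 p - A1') z (x * r) + nrmL (fun p => a2 p - A2') z (x * r) in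
  [/\ (A1' - A1) ^+ 2 <= K * r ^- 2 * E, (A2' - A2) ^+ 2 <= K * r ^- 2 * E,
    E' <= 8 * K * M * r ^+ 2 + K * x ^+ 4 * E &
    forall T, T = A1 ^+ 2 + A2 ^+ 2 -> 0 < T ->
      E' <= 4 * K * T^-1 * (M * E + h * (4 * r ^+ 2)) + K * x ^+ 4 * E].
Proof.
have [K K0 hK] := @excess_decay R; exists K => //.
move=> D a1 a2 b1 b2 F1 F2 z M h r x A1 A2 sa1 sa2 sb1 sb2 sp1 sp2 bM aF Fh r0 x0 x4 zD A1' A2'.
have nb2 : sqi (fun p => - b2 p).
  by have := sqiZ (-1) sb2; congr sqi; apply/funext => p; rewrite mulN1r.
have lc f c : sqi f -> lsqi (fun p => f p - c).
  by move=> sf; apply: lsqiB; [exact: sqi_lsqi|exact: lsqi_cst].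
have main c1 c2 := hK D a1 b1 (fun p => - b2 p) z r x A1 c1 (- c2) sa1 sb1 nb2 sp1 r0 x0 x4 zD.
have main' c1 c2 := hK D a2 b2 b1 z r x A2 c2 c1 sa2 sb2 sb1 sp2 r0 x0 x4 zD.
have nE c : nrmL (fun p => - b2 p - - c) z r = nrmL (fun p => b2 p - c) z r.
  by apply: pint_ext => p; rewrite -opprD sqrrN.
move: (main 0 0).1 (main' 0 0).1.
have {main main'} : forall c1 c2,
   nrmL (fun p => a1 p - A1') z (x * r) + nrmL (fun p => a2 p - A2') z (x * r) <=
   2 * K * (nrmL (fun p => b1 p - c1) z r + nrmL (fun p => b2 p - c2) z r) +
   K * x ^+ 4 * (nrmL (fun p => a1 p - A1) z r + nrmL (fun p => a2 p - A2) z r).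
  move=> c1 c2; have [_ h1] := main c1 c2; have [_ h2] := main' c1 c2.
  apply: (le_trans (lerD h1 h2)); rewrite nE.
  move: (nrmL _ _ _) (nrmL _ _ _) (nrmL _ _ _) (nrmL _ _ _) (x ^+ 4) => n1 n2 n3 n4 y.
  by rewrite le_eqVlt; apply/orP; left; apply/eqP; clear; ring.
have P f c : 0 <= nrmL (fun p => f p - c) z r by exact: nrmL_ge0.
have c0 : 0 <= K * r ^- 2 by rewrite mulr_ge0// invr_ge0 sqr_ge0.
(* The choice c = 0, using only that |b|^2 <= M. *)
have B0 : nrmL (fun p => b1 p - 0) z r + nrmL (fun p => b2 p - 0) z r <= 4 * M * r ^+ 2.
  have := @nrmL2_le_ae D (fun p => b1 p - 0) (fun p => b2 p - 0) (fun p => b1 p - 0) (fun p => b2 p - 0) z r 0 M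
    (lc _ 0 sb1) (lc _ 0 sb2) (lc _ 0 sb1) (lc _ 0 sb2) (ltW r0) zD.
  rewrite mul0r add0r => /(_ _)/le_trans; apply; last by rewrite mulrCA mulrA.
  by apply: filterS bM => p hp Dp _; rewrite !subr0 mul0r add0r; exact: hp.
(* The choice c = conj(phi(z)) / conj(A), in coordinates. *)
have BT T : T = A1 ^+ 2 + A2 ^+ 2 -> 0 < T ->
    nrmL (fun p => b1 p - (F1 z * A1 + F2 z * A2) / T) z r +
    nrmL (fun p => b2 p - (F1 z * A2 - F2 z * A1) / T) z r <=
    2 * T^-1 * M * (nrmL (fun p => a1 p - A1) z r + nrmL (fun p => a2 p - A2) z r) + 2 * T^-1 * h * (4 * r ^+ 2).
  move=> TE T0; apply: (nrmL2_le_ae (lc _ _ sb1) (lc _ _ sb2) (lc _ _ sa1) (lc _ _ sa2) (ltW r0) zD).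
  apply: filterS2 bM aF => p hM hF Dp zp.
  apply: (le_trans (hopf_perturb (a1 p) (a2 p) (b1 p) (b2 p) (F1 z) (F2 z) TE T0)).
  have [<- <-] := hF Dp; rewrite -[_ * M * _]mulrA -[leRHS]mulrDr.
  apply: ler_wpM2l; first by rewrite mulr_ge0// invr_ge0 ltW.
  apply: lerD (Fh p zp).
  by apply: ler_wpM2r (hM Dp); rewrite addr_ge0// sqr_ge0.
move: (P a1 A1) (P a2 A2) B0 BT.
move: (nrmL (fun p => a1 p - A1) z r) (nrmL (fun p => a2 p - A2) z r) => n1 n2 n10 n20 B0 BT hE h1 h2 E E'.
split.
- by apply: (le_trans h1); rewrite ler_wpM2l// lerDl.
- by apply: (le_trans h2); rewrite ler_wpM2l// lerDr.
- apply: (le_trans (hE 0 0)); rewrite lerD2r.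
  have -> : 8 * K * M * r ^+ 2 = 2 * K * (4 * M * r ^+ 2) by clear; ring.
  by apply: ler_wpM2l B0; rewrite mulr_ge0.
- move=> T TE T0; apply: (le_trans (hE _ _)); rewrite lerD2r.
  have -> : 4 * K * T^-1 * (M * E + h * (4 * r ^+ 2)) =
    2 * K * (2 * T^-1 * M * E + 2 * T^-1 * h * (4 * r ^+ 2)) by clearbody E; clear; move: T^-1 => t; ring.
  by apply: ler_wpM2l (BT T TE T0); rewrite mulr_ge0.
Qed.

End iteration.

(** * Mean bounds on the gradient, uniform in scale and centre *)

Section morrey.
Context {R : realType}.
Local Notation mu2 := ((@lebesgue_measure R) \x (@lebesgue_measure R))%E.
Implicit Types (D : set (R * R)) (u v f g k : R * R -> R) (p z w d : R * R) (e r s c A : R).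

Lemma geometric_radius (r0 x r : R) : 0 < x -> x < 1 -> 0 < r0 -> 0 < r -> r <= r0 ->
  exists n, r <= r0 * x ^+ n /\ r0 * x ^+ n * x < r.
Proof.
move=> x0 x1 r00 r_gt0 rr.
have ex : exists n, r0 * x ^+ n * x < r.
  have /cvgrPdist_lt : (fun n : nat => x ^+ n) @ \oo --> (0 : R) by apply: cvg_expr; rewrite ger0_norm ?ltW.
  move=> /(_ (r / r0)) []; first exact: divr_gt0.
  move=> n _ /(_ n (leqnn n)); rewrite /= sub0r normrN ger0_norm ?exprn_ge0 ?(ltW x0)// => h.
  exists n; rewrite -mulrA mulrC -ltr_pdivlMr//; apply: le_lt_trans h.
  by rewrite ler_piMr ?exprn_ge0 ?ltW.
have := ex_minnP ex => -[n hn nmin]; exists n; split => //.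
case: n hn nmin => [|n] hn nmin; first by rewrite expr0 mulr1.
rewrite leNgt; apply/negP => h; have := nmin n.
by rewrite ltnn -mulrA -exprSr h => /(_ isT).
Qed.

(** Index n + 1 is the new average produced by [excess_step] at radius [rad n]. The value 0 at index
    0 starts the iteration with [N 0 = 0] and an excess bounded by the global L^2 norm. *)
Definition averages f z (rad : nat -> R) n : R :=
  if n is n'.+1 then conv (mol (rad n' / 4)) f z else 0.

(** V is fixed before the domain, the functions and the centre, which is the uniformity needed
    later. The exponent [al] belongs to the squared oscillation of F, so it is twice the Hoelder
    exponent. *)
Lemma gradient_morrey (M H al r0 G : R) : 0 <= M -> 0 <= H -> 0 < al -> 0 < r0 -> 0 <= G ->
  exists2 V, 0 <= V & forall D a1 a2 b1 b2 F1 F2 z,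
  sqi a1 -> sqi a2 -> sqi b1 -> sqi b2 ->
  singular_pair D a1 b1 (fun p => - b2 p) -> singular_pair D a2 b2 b1 ->
  {ae mu2, forall p, D p -> b1 p ^+ 2 + b2 p ^+ 2 <= M} ->
  {ae mu2, forall p, D p -> F1 p = a1 p * b1 p + a2 p * b2 p /\ F2 p = a2 p * b1 p - a1 p * b2 p} ->
  (forall r p, r <= r0 -> box z r p -> (F1 p - F1 z) ^+ 2 + (F2 p - F2 z) ^+ 2 <= H * r `^ al) ->
  box z r0 `<=` D ->
  pint (fun p => a1 p ^+ 2) + pint (fun p => a2 p ^+ 2) <= G ->
  forall r, 0 < r -> r <= r0 -> nrmL a1 z r + nrmL a2 z r <= V * r ^+ 2.
Proof.
move=> M0 H0 al0 r00 G0; have [K K0 hK] := @excess_step R.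
(* The ratio of consecutive radii: after division by the area the term K x^4 becomes K x^2, which
   must be at most 1/4. *)
pose x := (4 * (K + 1))^-1.
have K1 : 0 < 4 * (K + 1) by lra.
have x0 : 0 < x by rewrite invr_gt0.
have x4 : x <= 4^-1 by rewrite lef_pV2 ?posrE//; lra.
have Kx : K * x ^+ 2 <= 1 / 4.
  have h : x * (K + 1) = 4^-1 by rewrite /x; field; lra.
  have h' : K * x <= 4^-1 by rewrite -h mulrC ler_wpM2l ?ltW//; lra.
  rewrite expr2 mulrA; apply: (le_trans (ler_wpM2r (ltW x0) h')); lra.
pose y := x ^- 2; have y0 : 0 < y by rewrite invr_gt0 exprn_gt0.
(* Once |A|^2 >= T0 the feedback term 4 K M y e / |A|^2 is at most e/4; with the other quarter the
   excess is halved. *)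
pose T0 := 16 * K * M * y + 1.
have KMy : 0 <= K * M * y by rewrite !mulr_ge0// ltW.
have T01 : 1 <= T0 by rewrite /T0; lra.
(* Then (rad n)^al = r0^al mu^(2n), the form of forcing that [iteration_bounded] expects. *)
pose mu := x `^ (al / 2).
have mu1 : mu < 1.
  have h : x `^ (al / 2) < 1 `^ (al / 2) by apply: gt0_ltr_powR; rewrite ?nnegrE ?ltW//; lra.
  by rewrite powR1 in h.
pose D2 := 16 * K * H * y * r0 `^ al.
have D20 : 0 <= D2 by rewrite /D2 !mulr_ge0 ?powR_ge0// ltW.
have [V V0 hV] := @iteration_bounded R (8 * K * M * y) (2 * Num.sqrt K) (Num.sqrt D2) (2 * T0) (G / r0 ^+ 2) mu
  ltac:(lra) ltac:(by rewrite mulr_ge0// sqrtr_ge0) (sqrtr_ge0 _) ltac:(lra) ltac:(by rewrite divr_ge0// sqr_ge0)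
  (powR_ge0 _ _) mu1.
exists ((2 * V + 8 * V ^+ 2) * y).
  by rewrite mulr_ge0 ?(ltW y0)// addr_ge0 ?mulr_ge0// sqr_ge0.
move=> D a1 a2 b1 b2 F1 F2 z sa1 sa2 sb1 sb2 sp1 sp2 bM aF Fh zD aG.
pose rad n := r0 * x ^+ n.
have rad0 n : 0 < rad n by rewrite mulr_gt0// exprn_gt0.
have rad1 n : rad n <= r0 by rewrite ler_piMr ?(ltW r00)// exprn_ile1 ?ltW//; lra.
have radS n : x * rad n = rad n.+1 by rewrite /rad exprS mulrCA.
pose A1 := averages a1 z rad; pose A2 := averages a2 z rad.
pose E n := nrmL (fun p => a1 p - A1 n) z (rad n) + nrmL (fun p => a2 p - A2 n) z (rad n).
have E0 n : 0 <= E n by apply: addr_ge0; exact: nrmL_ge0.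
pose e n := E n / rad n ^+ 2.
pose N n := `|A1 n| + `|A2 n|.
have rs0 n : 0 < rad n ^+ 2 by exact: exprn_gt0.
have Ee n : E n = e n * rad n ^+ 2 by rewrite /e divfK// gt_eqF.
have e0 n : 0 <= e n by rewrite divr_ge0// ltW.
have step n : [/\ (A1 n.+1 - A1 n) ^+ 2 <= K * e n, (A2 n.+1 - A2 n) ^+ 2 <= K * e n,
    e n.+1 <= 8 * K * M * y + e n / 4 &
    forall T, T = A1 n ^+ 2 + A2 n ^+ 2 -> 0 < T ->
      e n.+1 <= 4 * K * y * T^-1 * (M * e n + 4 * (H * rad n `^ al)) + e n / 4].
  have zr : box z (rad n) `<=` D.
    by move=> p zp; apply: zD; move: p zp; apply: box_subset; rewrite subrr normr0 add0r.
  have [s1 s2 s3 s4] := hK D a1 a2 b1 b2 F1 F2 z M (H * rad n `^ al) (rad n) x (A1 n) (A2 n)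
    sa1 sa2 sb1 sb2 sp1 sp2 bM aF (fun p => Fh _ p (rad1 n)) (rad0 n) x0 x4 zr.
  have eS Q : E n.+1 <= Q -> e n.+1 <= y * (Q / rad n ^+ 2).
    move=> h; have -> : y * (Q / rad n ^+ 2) = Q / rad n.+1 ^+ 2.
      by rewrite -(radS n) (exprMn 2 x (rad n)) [in RHS]invfM mulrCA.
    by rewrite /e ler_wpM2r// invr_ge0 ltW.
  rewrite radS -/(E n) -/(E n.+1) in s3 s4.
  rewrite -/(E n) in s1 s2.
  have rn : rad n ^+ 2 != 0 by rewrite gt_eqF.
  have KE : K * rad n ^- 2 * E n = K * e n by rewrite /e; ring.
  have ex2 : K * x ^+ 4 * E n / rad n ^+ 2 * y <= e n / 4.
    have -> : K * x ^+ 4 * E n / rad n ^+ 2 * y = K * x ^+ 2 * e n.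
      by rewrite /e /y; field; rewrite !gt_eqF.
    by apply: (le_trans (ler_wpM2r (e0 n) Kx)); rewrite div1r mulrC.
  have AS1 : A1 n.+1 = conv (mol (rad n / 4)) a1 z by [].
  have AS2 : A2 n.+1 = conv (mol (rad n / 4)) a2 z by [].
  split; [by rewrite AS1 -KE|by rewrite AS2 -KE| |].
    apply: (le_trans (eS _ s3)).
    have -> : y * ((8 * K * M * rad n ^+ 2 + K * x ^+ 4 * E n) / rad n ^+ 2) =
       8 * K * M * y + K * x ^+ 4 * E n / rad n ^+ 2 * y by field; rewrite !gt_eqF.
    by rewrite lerD2l.
  move=> T TE T_gt0; apply: (le_trans (eS _ (s4 T TE T_gt0))).
  have -> : y * ((4 * K / T * (M * E n + H * rad n `^ al * (4 * rad n ^+ 2)) + K * x ^+ 4 * E n) / rad n ^+ 2) =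
     4 * K * y * T^-1 * (M * e n + 4 * (H * rad n `^ al)) + K * x ^+ 4 * E n / rad n ^+ 2 * y.
    by rewrite Ee; field; rewrite !gt_eqF.
  by rewrite lerD2l.
have NS n : N n.+1 <= N n + 2 * Num.sqrt K * Num.sqrt (e n).
  have [s1 s2 _ _] := step n.
  have B (a b : R) : (a - b) ^+ 2 <= K * e n -> `|a| <= `|b| + Num.sqrt K * Num.sqrt (e n).
    move=> h; rewrite -sqrtrM// -lerBlDl; apply: le_trans (lerB_dist _ _) _.
    by rewrite -sqrtr_sqr; exact: ler_wsqrtr.
  by rewrite /N; have := B _ _ s1; have := B _ _ s2; clear; lra.
have big n : 2 * T0 <= N n -> e n.+1 <= e n / 2 + Num.sqrt D2 ^+ 2 * mu ^+ n ^+ 2.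
  move=> hN; have [_ _ _ /(_ _ erefl)] := step n; set T := _ + _ => hT.
  (* N^2 <= 2 |A|^2, so N >= 2 T0 gives |A|^2 >= 2 T0^2, which exceeds T0 because T0 >= 1. *)
  have TT : T0 <= T.
    have h1 : (2 * T0) ^+ 2 <= N n ^+ 2 by rewrite lerXn2r// nnegrE ?addr_ge0//; lra.
    have h2 : N n ^+ 2 <= 2 * T.
      rewrite /N /T -(real_normK (num_real (A1 n))) -(real_normK (num_real (A2 n))).
      by have := sqr_ge0 (`|A1 n| - `|A2 n|); clear; nra.
    have aux (t m v : R) : 1 <= t -> (2 * t) ^+ 2 <= m -> m <= 2 * v -> t <= v by clear; nra.
    exact: aux T01 h1 h2.
  have T_gt0 : 0 < T by lra.
  apply: (le_trans (hT T_gt0)); rewrite sqr_sqrtr//.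
  have -> : mu ^+ n ^+ 2 = (x ^+ n) `^ al.
    have mu2E : mu ^+ 2 = x `^ al by rewrite /mu -powR_mulrn ?powR_ge0// -powRrM divfK.
    rewrite -exprM mulnC exprM mu2E -powR_mulrn ?powR_ge0// -powRrM mulrC powRrM.
    by rewrite powR_mulrn// ltW.
  have -> : rad n `^ al = r0 `^ al * (x ^+ n) `^ al by rewrite powRM// ?exprn_ge0 ?ltW.
  have Tinv : T^-1 <= T0^-1 by rewrite lef_pV2 ?posrE//; lra.
  have T0inv : T0^-1 <= 1 by rewrite invf_le1//; lra.
  set P := (x ^+ n) `^ al; have P0 : 0 <= P by exact: powR_ge0.
  have h1 : 4 * K * y * T^-1 * (M * e n) <= e n / 4.
    have -> : 4 * K * y * T^-1 * (M * e n) = (16 * (K * M * y)) * T^-1 * (e n / 4) by field; lra.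
    apply: ler_piMl; first by rewrite divr_ge0.
    rewrite ler_pdivrMr// mul1r; apply: le_trans TT; rewrite /T0.
    have -> : 16 * (K * M * y) = 16 * K * M * y by clear; ring.
    by rewrite lerDl.
  have h2 : 4 * K * y * T^-1 * (4 * (H * (r0 `^ al * P))) <= D2 * P.
    have -> : 4 * K * y * T^-1 * (4 * (H * (r0 `^ al * P))) = D2 * P * T^-1 by rewrite /D2; move: T^-1 => t; ring.
    by apply: ler_piMr; [exact: mulr_ge0|exact: le_trans Tinv T0inv].
  have aux (a b c E' : R) : a <= E' / 4 -> b <= c -> (a + b) + E' / 4 <= E' / 2 + c by clear; lra.
  have := aux _ _ _ _ h1 h2; congr (_ + _ <= _); rewrite -mulrDr.
  by [].
have N0 : N 0%N <= 0 by rewrite /N /A1 /A2 /= normr0 addr0.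
have eY : e 0%N <= G / r0 ^+ 2.
  rewrite /e /rad expr0 mulr1 ler_wpM2r ?invr_ge0 ?sqr_ge0//; apply: le_trans aG.
  have B f : sqi f -> nrmL (fun p => f p - 0) z (rad 0%N) <= pint (fun p => f p ^+ 2).
    move=> [mf sf]; apply: pint_le => // [|p]; last by rewrite subr0 ler_piMr ?sqr_ge0// bx_le1.
    have := nrmL_integrable z (rad 0%N) (conj mf sf).
    by congr pintegrable; apply/funext => p; rewrite subr0.
  by rewrite /E; apply: lerD; exact: B.
have hVn := hV e N e0 N0 eY (fun n => let: And4 _ _ h _ := step n in h) NS big.
move=> r r_gt0 rr.
(* Any radius lies between two consecutive ones; passing to the larger square costs the factor y =
   x^-2. *)
have [n [rn nr]] := geometric_radius x0 ltac:(lra) r00 r_gt0 rr.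
have [NV eV] := hVn n; rewrite -/(rad n) in rn nr.
have la f c : sqi f -> lsqi (fun p => f p - c).
  by move=> sf; apply: lsqiB; [exact: sqi_lsqi|exact: lsqi_cst].
have B f c : sqi f -> nrmL f z r <= 2 * nrmL (fun p => f p - c) z (rad n) + 2 * (c ^+ 2 * (4 * rad n ^+ 2)).
  move=> sf; apply: (le_trans (nrmL_sub' (z' := z) (s' := rad n) (sqi_lsqi sf) _)).
    by apply: box_subset; rewrite subrr normr0 add0r.
  have := nrmL_add z (rad n) (la f c sf) (lsqi_cst c).
  have -> : nrmL (fun=> c) z (rad n) = c ^+ 2 * (4 * rad n ^+ 2).
    by rewrite /nrmL (pintZ _ (pintegrable_bx _ _)) pint_bx// ltW.
  by apply: le_trans; rewrite (nrmL_ext (g := f))// => p _; rewrite subrK.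
apply: (le_trans (lerD (B a1 (A1 n) sa1) (B a2 (A2 n) sa2))).
have NT : A1 n ^+ 2 + A2 n ^+ 2 <= V ^+ 2.
  have h : N n ^+ 2 <= V ^+ 2 by rewrite lerXn2r// nnegrE addr_ge0.
  apply: le_trans h; rewrite /N -(real_normK (num_real (A1 n))) -(real_normK (num_real (A2 n))).
  by have := mulr_ge0 (normr_ge0 (A1 n)) (normr_ge0 (A2 n)); clear; nra.
have : (2 * V + 8 * V ^+ 2) * rad n ^+ 2 <= (2 * V + 8 * V ^+ 2) * y * r ^+ 2.
  rewrite -mulrA ler_wpM2l ?addr_ge0 ?mulr_ge0 ?sqr_ge0//.
  rewrite /y mulrC ler_pdivlMr ?exprn_gt0// -exprMn lerXn2r//; last exact: ltW.
    by rewrite nnegrE; apply: mulr_ge0; exact: ltW.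
  by rewrite nnegrE ltW.
move=> h; apply: le_trans h.
have := ler_wpM2r (ltW (rs0 n)) eV; rewrite -Ee /E.
have := ler_wpM2r (ltW (rs0 n)) NT.
move: (nrmL _ _ _) (nrmL _ _ _) (rad n ^+ 2) (A1 n ^+ 2) (A2 n ^+ 2) (V ^+ 2) => n1 n2 q a b v; clear; lra.
Qed.

End morrey.

(** * The Lipschitz representative *)

Section lipschitz.
Context {R : realType}.
Local Notation mu2 := ((@lebesgue_measure R) \x (@lebesgue_measure R))%E.
Local Notation e1 := ((1, 0) : R * R).
Local Notation e2 := ((0, 1) : R * R).
Implicit Types (D : set (R * R)) (u f g k : R * R -> R) (p v z w d : R * R) (e r s c A : R).

Lemma cutH_bounded : exists2 M, 0 <= M & forall t : R, 0 <= t -> `|cutH t| <= M.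
Proof.
have [M M0 hM] := smooth_bounded 0 1 (@cutH_smooth R); exists (M + 1); first by lra.
move=> t t0; have [t1|t1] := leP t 1.
  by apply: (le_trans (hM t _)); [rewrite t0|lra].
rewrite cutH_inv; last exact: ltW.
rewrite ger0_norm ?invr_ge0//; have : t^-1 <= 1 by rewrite invf_le1//; lra.
by lra.
Qed.

Lemma qk_bounded : exists2 M, 0 <= M & forall r t, 0 < r -> 0 <= t ->
  `|qk (r / 2) r t| <= M * r ^- 2.
Proof.
have [M M0 hM] := cutH_bounded; have m0 := @mass_gt0 R.
exists (5 * mass^-1 * M); first by rewrite !mulr_ge0// invr_ge0 ltW.
move=> r t r0 t0; rewrite /qk normrM ger0_norm; last by rewrite invr_ge0 ltW.
have i0 : 0 <= r ^- 2 by rewrite invr_ge0 sqr_ge0.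
have -> : (r / 2) ^- 2 = 4 * r ^- 2 by field; lra.
have h1 : `|4 * r ^- 2 * cutH (4 * r ^- 2 * t)| <= 4 * r ^- 2 * M.
  rewrite normrM ger0_norm ?mulr_ge0// ler_wpM2l ?mulr_ge0// hM// !mulr_ge0//.
have h2 : `|r ^- 2 * cutH (r ^- 2 * t)| <= r ^- 2 * M.
  by rewrite normrM ger0_norm// ler_wpM2l// hM// mulr_ge0.
have -> : 5 * mass^-1 * M * r ^- 2 = mass^-1 * (4 * r ^- 2 * M + r ^- 2 * M) by ring.
rewrite ler_wpM2l ?invr_ge0 ?(ltW m0)//.
by apply: (le_trans (ler_normB _ _)); exact: lerD.
Qed.

(** The field d q(|d|^2) is supported where |d| <= r, and q is of order r^-2 for the scales r/2 and
    r. *)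
Lemma rX_bounded : exists2 M, 0 <= M & forall r w z, 0 < r ->
  `|rX (qk (r / 2) r) (w - z)| <= M * r^-1 * bx z (2 * r) w /\
  `|rY (qk (r / 2) r) (w - z)| <= M * r^-1 * bx z (2 * r) w.
Proof.
have [M M0 hM] := qk_bounded; exists M => // r w z r0.
have r20 : 0 < r / 2 by lra.
have r2r : r / 2 <= r by lra.
have sq := @smooth_qk R (r / 2) r; have qr := fun t => @qk_out R (r / 2) r t r20 r2r.
have M1 : 0 <= M * r^-1 by rewrite mulr_ge0// invr_ge0 ltW.
have [h|h] := pselect (cbox z r w); last first.
  have h' : ~ cbox 0 r (w - z) by move=> /cbox_shift.
  by rewrite (csupp_rX r0 qr h') (csupp_rY r0 qr h') normr0; split; apply: mulr_ge0; rewrite ?bx_ge0.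
have [w1 w2] := h.
rewrite bx_in ?mulr1; last by split; [apply: (le_lt_trans w1)|apply: (le_lt_trans w2)]; lra.
have nn : 0 <= nrm2 (w - z) by rewrite addr_ge0 ?sqr_ge0.
have E : M * r^-1 = r * (M * r ^- 2) by field; lra.
by rewrite /rX /rY E !(normrM _ (qk _ _ _)); split; apply: ler_pM => //; exact: hM.
Qed.

(** By [wderiv_kP] the difference is the gradient tested against a field of size 1/r on a square of
    side of order r; the mean bound on the gradient then yields order r. *)
Lemma scale_difference : exists2 K, 0 <= K & forall D u ux uy z r V,
  sqi u -> sqi ux -> sqi uy -> wderiv e1 D u ux -> wderiv e2 D u uy ->
  0 < r -> cbox z r `<=` D -> 0 <= V -> nrmL ux z (2 * r) + nrmL uy z (2 * r) <= V * (2 * r) ^+ 2 ->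
  `|conv (mol (r / 2)) u z - conv (mol r) u z| <= K * Num.sqrt V * r.
Proof.
have [M M0 hM] := rX_bounded; exists (8 * M); first by lra.
move=> D u ux uy z r V su sux suy hx hy r0 zD V0 hV.
have r20 : 0 < r / 2 by lra.
have r2r : r / 2 <= r by lra.
have sq := @smooth_qk R (r / 2) r; have qr := fun t => @qk_out R (r / 2) r t r20 r2r.
have -> : conv (mol (r / 2)) u z - conv (mol r) u z = pint (fun w => u w * kP (qk (r / 2) r) (w - z)).
  rewrite /conv -(pintB (sqi_mul su (mol_sqi z r20)) (sqi_mul su (mol_sqi z r0))).
  by apply: pint_ext => w; rewrite kP_qk mulrBr.
rewrite (wderiv_kP sq r0 qr su sux suy hx hy zD).
have K k : continuous k -> csupp r k -> sqi (fun w => k (w - z)).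
  by move=> ck sk; have [C kC] := kern_shift r0 ck sk; exact: (kern_sqi kC z).
have kX := K _ (Ck_continuous (Ck_rX sq 0)) (csupp_rX r0 qr).
have kY := K _ (Ck_continuous (Ck_rY sq 0)) (csupp_rY r0 qr).
rewrite (pintD (sqi_mul sux kX) (sqi_mul suy kY)).
have rr : 0 <= 2 * r by lra.
have B f k : sqi f -> sqi k -> (forall w, `|k w| <= M * r^-1 * bx z (2 * r) w) ->
   nrmL f z (2 * r) <= V * (2 * r) ^+ 2 -> `|pint (fun w => f w * k w)| <= 8 * M * Num.sqrt V * r.
  move=> sf [mk _] hk hf.
  rewrite -[leRHS]ger0_norm; last by rewrite !mulr_ge0 ?sqrtr_ge0// ltW.
  rewrite -ler_sqr ?nnegrE// !real_normK ?num_real//.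
  apply: (le_trans (weighted_cauchy_schwarz (sqi_lsqi sf) mk rr hk)).
  have -> : (8 * M * Num.sqrt V * r) ^+ 2 = (M / r) ^+ 2 * (4 * (2 * r) ^+ 2) * (V * (2 * r) ^+ 2).
    rewrite 2!exprMn sqr_sqrtr//; field; lra.
  by apply: ler_wpM2l hf; apply: mulr_ge0; [exact: sqr_ge0|rewrite mulr_ge0// sqr_ge0].
have hf1 : nrmL ux z (2 * r) <= V * (2 * r) ^+ 2 by apply: le_trans hV; rewrite lerDl nrmL_ge0.
have hf2 : nrmL uy z (2 * r) <= V * (2 * r) ^+ 2 by apply: le_trans hV; rewrite lerDr nrmL_ge0.
have B1 := B _ _ sux kX (fun w => (hM r w z r0).1) hf1.
have B2 := B _ _ suy kY (fun w => (hM r w z r0).2) hf2.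
rewrite normrM normrN (ger0_norm (_ : 0 <= 2^-1)) ?invr_ge0//.
have h := le_trans (ler_normD _ _) (lerD B1 B2).
have aux (a b : R) : a <= b + b -> 2^-1 * a <= b by clear; lra.
exact: aux h.
Qed.

Lemma Ck_rho (n : nat) r : Ck n setT (rho r).
Proof. by apply: Ck_mul; [exact: Ck_cst|exact: Ck_rho0]. Qed.

Lemma csupp_rho r : 0 < r -> csupp r (rho r).
Proof. by move=> r0 d nd; rewrite /rho rho0_out ?mulr0// => /box_cbox. Qed.

Section direction.
Variables (v : R * R) (r : R).
Hypotheses (ve : v = e1 \/ v = e2) (r0 : 0 < r).

Lemma rho_is_derive d : is_derive d v (rho r) ('D_v (rho r) d).
Proof. by case: ve => ->; [exact: Ck_is_derive1 (Ck_rho 1 r)|exact: Ck_is_derive2 (Ck_rho 1 r)]. Qed.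

Lemma continuous_rho_derive : continuous ('D_v (rho r)).
Proof.
by case: ve => ->; apply: (@Ck_continuous _ 0); [apply: Ck_d1|apply: Ck_d2]; exact: Ck_rho.
Qed.

Lemma csupp_rho_derive : csupp r ('D_v (rho r)).
Proof. by move=> d nd; apply: (derive_out v _ _ nd); [exact: closed_cbox|exact: csupp_rho]. Qed.

Lemma is_derive_mol z w t : is_derive (t : R) 1 (fun t : R => mol r w (t *: v + z))
  (- 'D_v (rho r) (w - (t *: v + z))).
Proof.
have /is_derive_dirP h := rho_is_derive (w - (t *: v + z)).
have d1 : is_derive t 1 (fun s : R => t - s) (- 1).
  have := is_deriveB (is_derive_cst t t (1 : R)) (is_derive_id t (1 : R)).
  by rewrite sub0r.
have d2 : is_derive ((fun s : R => t - s) t) 1 (fun h : R => rho r (h *: v + (w - (t *: v + z)))) ('D_v (rho r) (w - (t *: v + z))).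
  by rewrite /= subrr.
have h3 := @is_derive1_comp _ (fun h : R => rho r (h *: v + (w - (t *: v + z)))) (fun s => t - s) t _ _ d2 d1.
have E : (fun t : R => mol r w (t *: v + z)) =
    (fun h : R => rho r (h *: v + (w - (t *: v + z)))) \o (fun s => t - s).
  apply/funext => s; rewrite /= /mol; congr (rho r _).
  by rewrite scalerBl !opprD [RHS]addrCA [X in _ = _ + X]addrACA subrr add0r.
by rewrite E; apply: (is_derive_eq h3); rewrite mulrN1.
Qed.

(** Differentiation under the integral sign, with all dependence on t in the smooth kernel. *)
Lemma conv_mol_is_derive u z t : sqi u ->
  is_derive (t : R) 1 (fun t : R => conv (mol r) u (t *: v + z))
    (- pint (fun w => u w * 'D_v (rho r) (w - (t *: v + z)))).
Proof.
move=> su; pose f x w := u w * mol r w (x *: v + z).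
have df x w : is_derive (x : R) 1 (f ^~ w) (u w * - 'D_v (rho r) (w - (x *: v + z))).
  have h := is_deriveM (is_derive_cst (u w) x (1 : R)) (is_derive_mol z w x).
  by apply: (is_derive_eq h); rewrite scaler0 addr0.
have [M M0 hM] := continuous_bounded_box 0 continuous_rho_derive (ltW r0).
(* For parameters within 1 of t the kernel is supported within r + 1 of [t *: v + z]; the enlarged
   square contains all these supports. *)
pose G w := `|u w| * (M * bx (t *: v + z) (r + 2) w).
have iG : pintegrable G.
  apply: sqi_mul; last exact: sqiZ (sqi_bx _ _).
  have mu : measurable_fun setT (fun w => `|u w|) by apply: measurableT_comp => //; case: su.
  by apply: (sqi_le mu su) => w; rewrite normr_id.
have nv : `|v.1| <= 1 /\ `|v.2| <= 1 by case: ve => -> /=; rewrite normr0 normr1.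
have G_ub x w : `]t - 1, t + 1[%classic x -> setT w -> `|partial1of2 f x w| <= G w.
  rewrite /= in_itv /= => /andP[x1 x2] _.
  have [_ dE] := df x w; rewrite /partial1of2 derive1E dE normrM normrN /G ler_wpM2l//.
  have [h|h] := pselect (cbox (x *: v + z) r w); last first.
    rewrite csupp_rho_derive ?normr0 ?mulr_ge0 ?bx_ge0//.
    by move=> /cbox_shift.
  rewrite bx_in ?mulr1; first by apply: hM; apply/cbox_shift.
  have tx : `|x - t| < 1 by rewrite ltr_norml; apply/andP; split; lra.
  have K (a b c : R) : `|a| <= 1 -> `|b - (x * a + c)| <= r -> `|b - (t * a + c)| < r + 2.
    move=> a1 h1; have -> : b - (t * a + c) = (b - (x * a + c)) + (x - t) * a by ring.
    apply: (le_lt_trans (ler_normD _ _)); rewrite normrM.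
    have : `|x - t| * `|a| <= `|x - t| by rewrite ler_piMr.
    lra.
  by case: h => h1 h2; split; [exact: (K v.1 w.1 z.1 nv.1 h1)|exact: (K v.2 w.2 z.2 nv.2 h2)].
have It : `]t - 1, t + 1[%classic t by rewrite /= in_itv /=; apply/andP; split; lra.
have intf x : `]t - 1, t + 1[%classic x -> mu2.-integrable setT (EFin \o f x).
  by move=> _; exact: sqi_mul su (mol_sqi _ r0).
have derf x w : `]t - 1, t + 1[%classic x -> setT w -> derivable (f ^~ w) x 1.
  by move=> _ _; case: (df x w).
have G0 w : 0 <= G w by rewrite !mulr_ge0 ?bx_ge0.
have d := derivable_under_integral measurableT It intf derf G0 iG G_ub.
have := differentiation_under_integral measurableT It intf derf G0 iG G_ub.
rewrite derive1E => dE.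
have -> : - pint (fun w => u w * 'D_v (rho r) (w - (t *: v + z))) =
    \int[mu2]_(w in setT) partial1of2 f t w.
  rewrite -pintN; last first.
    have [C kC] := kern_shift r0 continuous_rho_derive csupp_rho_derive.
    exact: sqi_mul su (kern_sqi kC _).
  apply: pint_ext => w; have [_ h] := df t w.
  by rewrite /partial1of2 derive1E h mulrN.
rewrite -dE; exact: DeriveDef.
Qed.

End direction.

(** The derivative of the mollification is the mollification of the weak derivative, which
    Cauchy-Schwarz bounds by the mean of its square. The bound does not depend on r. *)
Lemma conv_mol_lipschitz : exists2 K, 0 <= K & forall D v u uv z r T V,
  v = e1 \/ v = e2 -> 0 < r -> 0 <= T -> 0 <= V -> sqi u -> sqi uv -> wderiv v D u uv ->
  (forall t, 0 <= t -> t <= T -> cbox (t *: v + z) r `<=` D /\ nrmL uv (t *: v + z) r <= V * r ^+ 2) ->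
  `|conv (mol r) u (T *: v + z) - conv (mol r) u z| <= K * Num.sqrt V * T.
Proof.
have [M M0 kM] := @mol_kern R; exists (2 * M); first by lra.
move=> D v u uv z r T V ve r0 T0 V0 su suv hv hV.
pose df t := - pint (fun w => u w * 'D_v (rho r) (w - (t *: v + z))).
have hd t := conv_mol_is_derive ve r0 z t su.
have [|c] := @MVT_segment R (fun t => conv (mol r) u (t *: v + z)) df 0 T T0 (fun t _ => hd t).
  apply: derivable_within_continuous => t _; by case: (hd t).
rewrite in_itv /= => /andP[c0 cT]; rewrite scale0r add0r subr0 => ->.
rewrite normrM (ger0_norm T0) ler_wpM2r//.
have [cD hc] := hV c c0 cT.
have -> : df c = pint (fun w => uv w * mol r w (c *: v + z)).
  have := hv _ (test_function_shift (fun n => Ck_rho n r) (csupp_rho r0) cD).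
  move=> h; apply: (etrans _ (opprK _)); apply: (congr1 -%R); apply: (etrans _ h).
  apply: pint_ext => w.
  exact: (congr1 (fun x => u w * x) (esym (derive_shift (c *: v + z) w (rho_is_derive r ve)))).
have m : measurable_fun setT (mol r ^~ (c *: v + z)) by case: (mol_sqi (c *: v + z) r0).
rewrite -[leRHS]ger0_norm; last by rewrite !mulr_ge0 ?sqrtr_ge0.
rewrite -ler_sqr ?nnegrE// !real_normK ?num_real//.
apply: (le_trans (weighted_cauchy_schwarz (sqi_lsqi suv) m (ltW r0) (fun w => kern_bd (kM r r0) w _))).
have -> : (2 * M * Num.sqrt V) ^+ 2 = (M * r ^- 2) ^+ 2 * (4 * r ^+ 2) * (V * r ^+ 2).
  rewrite exprMn sqr_sqrtr//; field; lra.
by apply: ler_wpM2l hc; apply: mulr_ge0; [exact: sqr_ge0|rewrite mulr_ge0// sqr_ge0].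
Qed.

End lipschitz.

(** * Limit of the dyadic mollifications *)

Section limit.
Context {R : realType}.
Local Notation mu2 := ((@lebesgue_measure R) \x (@lebesgue_measure R))%E.
Local Notation e1 := ((1, 0) : R * R).
Local Notation e2 := ((0, 1) : R * R).
Implicit Types (D : set (R * R)) (u f g k : R * R -> R) (p v z w d : R * R) (e r s c A : R).

Lemma halfpow_small (x : R) : 0 < x -> exists N, forall n, (N <= n)%N -> 2^-1 ^+ n < x.
Proof.
have /cvgrPdist_lt h : (fun n : nat => 2^-1 ^+ n) @ \oo --> (0 : R).
  by apply: cvg_expr; rewrite ger0_norm ?invr_ge0// invf_lt1// ltr1n.
move=> /h [N _ hN]; exists N => n /hN; by rewrite /= sub0r normrN ger0_norm// exprn_ge0// invr_ge0.
Qed.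

(** Defined at every point with no reference to [D], so the representatives obtained near different
    points are one and the same function. *)
Definition avg_lim u z : R := limn (fun n => conv (mol (2^-1 ^+ n)) u z).

Lemma geometric_cauchy (a : nat -> R) (C : R) (N : nat) : 0 <= C ->
  (forall n, (N <= n)%N -> `|a n.+1 - a n| <= C * 2^-1 ^+ n) ->
  (forall n m, (N <= n)%N -> (n <= m)%N -> `|a m - a n| <= 2 * C * 2^-1 ^+ n) /\ cvgn a.
Proof.
move=> C0 ha.
have h n (k : nat) : (N <= n)%N -> `|a (n + k)%N - a n| <= 2 * C * (2^-1 ^+ n - 2^-1 ^+ (n + k)).
  move=> Nn; elim: k => [|k IH]; first by rewrite addn0 !subrr normr0 mulr0.
  rewrite addnS; apply: (le_trans (ler_distD (a (n + k)%N) _ _)).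
  have := ha (n + k)%N (leq_trans Nn (leq_addr _ _)); rewrite exprS.
  by move: (2^-1 ^+ (n + k)) (2^-1 ^+ n) IH => x y; lra.
have p0 n : 0 <= 2^-1 ^+ n :> R by rewrite exprn_ge0// invr_ge0.
have h' n m : (N <= n)%N -> (n <= m)%N -> `|a m - a n| <= 2 * C * 2^-1 ^+ n.
  move=> Nn /subnKC <-; apply: (le_trans (h _ _ Nn)).
  by rewrite ler_wpM2l ?mulr_ge0// gerBl.
split; first exact: h'.
apply/cauchy_cvgP; apply: cauchy_exP => e e0.
have C1 : 0 < 2 * C + 1 by lra.
have [M hM] := halfpow_small (divr_gt0 e0 C1).
exists (a (maxn N M)); exists (maxn N M) => // m /= hm.
rewrite /ball /= distrC; apply: (le_lt_trans (h' _ _ (leq_maxl N M) hm)).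
have := hM _ (leq_maxr N M); rewrite ltr_pdivlMr// => hx; apply: le_lt_trans hx.
by rewrite mulrC ler_wpM2l//; lra.
Qed.

Section local.
Variables (D : set (R * R)) (u ux uy : R * R -> R) (z0 : R * R) (s r0 V : R).
Hypotheses (su : sqi u) (sux : sqi ux) (suy : sqi uy).
Hypotheses (hx : wderiv e1 D u ux) (hy : wderiv e2 D u uy).
Hypotheses (s0 : 0 < s) (r00 : 0 < r0) (V0 : 0 <= V).
Hypothesis zD : forall z, box z0 s z -> box z r0 `<=` D.
Hypothesis hV : forall z r, box z0 s z -> 0 < r -> r <= r0 ->
  nrmL ux z r + nrmL uy z r <= V * r ^+ 2.

Let U n := conv (mol (2^-1 ^+ n)) u.
Let h0 n : 0 < 2^-1 ^+ n :> R. Proof. by rewrite exprn_gt0// invr_gt0. Qed.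

Let cD z r : box z0 s z -> r < r0 -> cbox z r `<=` D.
Proof.
move=> zs rr w [w1 w2]; apply: (zD zs); split; [exact: le_lt_trans w1 rr|exact: le_lt_trans w2 rr].
Qed.

(** Consecutive dyadic scales differ by O(2^-n), by [scale_difference]; C and N are uniform over the
    square. *)
Lemma avg_cvg : exists2 C, 0 <= C & exists N : nat, forall z, box z0 s z ->
  (forall n m, (N <= n)%N -> (n <= m)%N -> `|U m z - U n z| <= C * 2^-1 ^+ n) /\
  U n z @[n --> \oo] --> avg_lim u z.
Proof.
have [K K0 hK] := @scale_difference R.
have KV : 0 <= K * Num.sqrt V by rewrite mulr_ge0// sqrtr_ge0.
exists (2 * (K * Num.sqrt V)); first by rewrite mulr_ge0.
have r2 : 0 < r0 / 2 by have := r00; lra.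
have [N hN] := halfpow_small r2; exists N => z zs.
apply: (@geometric_cauchy (U^~ z) (K * Num.sqrt V) N KV) => n Nn.
have hn := hN n Nn.
have nr : 2 * 2^-1 ^+ n <= r0 by move: hn; move: (2^-1 ^+ n) => x; lra.
have nr' : 2^-1 ^+ n < r0 by move: hn r2; move: (2^-1 ^+ n) => x; lra.
rewrite /U exprS [2^-1 * _]mulrC.
apply: (hK D u ux uy z (2^-1 ^+ n) V su sux suy hx hy (h0 n) (cD zs nr') V0).
by apply: hV => //; rewrite mulr_gt0.
Qed.

Lemma avg_lim_lipschitz : exists2 L, 0 <= L & forall z z', box z0 s z -> box z0 s z' ->
  `|avg_lim u z - avg_lim u z'| <= L * (`|z.1 - z'.1| + `|z.2 - z'.2|).
Proof.
have [K K0 hK] := @conv_mol_lipschitz R; have [C C0 [N hC]] := avg_cvg.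
pose L := K * Num.sqrt V; have L0 : 0 <= L by rewrite mulr_ge0// sqrtr_ge0.
exists L => //.
have dir v uv z T n : v = e1 \/ v = e2 -> sqi uv -> wderiv v D u uv ->
    (forall z r, box z0 s z -> 0 < r -> r <= r0 -> nrmL uv z r <= V * r ^+ 2) ->
    2^-1 ^+ n < r0 -> 0 <= T -> box z0 s z -> box z0 s (T *: v + z) ->
    `|U n (T *: v + z) - U n z| <= L * T.
  move=> ve suv hv hV' nr T0 [z1 z2] [z1' z2'].
  apply: (hK D v u uv z (2^-1 ^+ n) T V ve (h0 n) T0 V0 su suv hv) => t t0 tT.
  have zt : box z0 s (t *: v + z).
    have B (a b c : R) : 0 <= a -> `|b - c| < s -> `|T * a + b - c| < s -> `|t * a + b - c| < s.
      move=> a0; rewrite !ltr_norml => /andP[h1 h2] /andP[h3 h4].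
      have h5 : t * a <= T * a by rewrite ler_wpM2r.
      have h6 : 0 <= t * a by rewrite mulr_ge0.
      by apply/andP; split; lra.
    have [a1 a2] : 0 <= v.1 /\ 0 <= v.2 by case: ve => ->.
    by split; [exact: (B v.1 z.1 z0.1)|exact: (B v.2 z.2 z0.2)].
  by split; [exact: cD|apply: hV' => //; exact: ltW].
have hVx z r : box z0 s z -> 0 < r -> r <= r0 -> nrmL ux z r <= V * r ^+ 2.
  by move=> zs rp rr; apply: le_trans (hV zs rp rr); rewrite lerDl nrmL_ge0.
have hVy z r : box z0 s z -> 0 < r -> r <= r0 -> nrmL uy z r <= V * r ^+ 2.
  by move=> zs rp rr; apply: le_trans (hV zs rp rr); rewrite lerDr nrmL_ge0.
have Ux n (x x' y : R) : 2^-1 ^+ n < r0 -> box z0 s (x, y) -> box z0 s (x', y) ->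
    `|U n (x, y) - U n (x', y)| <= L * `|x - x'|.
  move=> nr; wlog xx : x x' / x' <= x.
    move=> W zx zx'; have [h|/ltW h] := leP x' x; first exact: W.
    by rewrite distrC [`|x - _|]distrC; exact: W.
  move=> zx zx'; have E : (x - x') *: e1 + (x', y) = (x, y).
    by congr pair; rewrite /GRing.scale /= ?[_%:A]mulr1 ?scaler0 ?add0r ?subrK.
  have T0 : 0 <= x - x' by rewrite subr_ge0.
  have := dir e1 ux (x', y) (x - x') n (or_introl erefl) sux hx hVx nr T0 zx'.
  by rewrite E (ger0_norm T0); apply.
have Uy n (x y y' : R) : 2^-1 ^+ n < r0 -> box z0 s (x, y) -> box z0 s (x, y') ->
    `|U n (x, y) - U n (x, y')| <= L * `|y - y'|.
  move=> nr; wlog yy : y y' / y' <= y.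
    move=> W zy zy'; have [h|/ltW h] := leP y' y; first exact: W.
    by rewrite distrC [`|y - _|]distrC; exact: W.
  move=> zy zy'; have E : (y - y') *: e2 + (x, y') = (x, y).
    by congr pair; rewrite /GRing.scale /= ?[_%:A]mulr1 ?scaler0 ?add0r ?subrK.
  have T0 : 0 <= y - y' by rewrite subr_ge0.
  have := dir e2 uy (x, y') (y - y') n (or_intror erefl) suy hy hVy nr T0 zy'.
  by rewrite E (ger0_norm T0); apply.
move=> [x y] [x' y'] zs zs' /=.
(* The path from one point to the other turns at the corner (x', y), which lies in the same
   square. *)
have zm : box z0 s (x', y) by split; [exact: zs'.1|exact: zs.2].
have [_ c1] := hC _ zs; have [_ c2] := hC _ zs'.
have c : `|U n (x, y) - U n (x', y')| @[n --> \oo] --> `|avg_lim u (x, y) - avg_lim u (x', y')|.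
  exact: cvg_norm (cvgB c1 c2).
apply: (cvgr_to_le c).
have [M hM] := halfpow_small r00; exists M => // n /= /hM nr.
apply: (le_trans (ler_distD (U n (x', y)) _ _)); rewrite mulrDr.
by apply: lerD; [exact: Ux|exact: Uy].
Qed.

(** On the square the mollifications converge uniformly to [avg_lim u] and in L^2 to u. The
    truncation [uh] supplies the bounded support that strong convergence asks for. *)
Lemma avg_lim_ae : {ae mu2, forall p, box z0 s p -> avg_lim u p = u p}.
Proof.
have [C C0 [N hC]] := avg_cvg.
pose uh p := u p * bx z0 (s + r0) p.
have suh : sqic uh by apply: lsqi_sqic; exact: sqi_lsqi.
pose F n p := conv (mol (2^-1 ^+ n)) uh p * bx z0 s p.
pose G p := avg_lim u p * bx z0 s p.
have sF n : sqi (F n).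
  have [M _ kM] := @mol_kern R.
  exact: sqi_bxM (conv_sqic (kM _ (h0 n)) suh).1.
have [N' hN'] := halfpow_small r00.
have FE n p : (N' <= n)%N -> F n p = U n p * bx z0 s p.
  move=> /hN' nr; have [h|h] := pselect (box z0 s p); last by rewrite /F bx_out// !mulr0.
  by rewrite /F /uh (conv_mol_local u (h0 n) _ h)// lerD2l ltW.
have FG p : F n p @[n --> \oo] --> G p.
  have c1 : (fun n => U n p * bx z0 s p) @ \oo --> G p.
    have [h|h] := pselect (box z0 s p); last by rewrite /G bx_out// mulr0; under eq_fun do rewrite mulr0; exact: cvg_cst.
    by apply: cvgMl; case: (hC p h).
  apply: cvg_trans c1; apply: near_eq_cvg; exists N' => // n /= nN.
  by rewrite FE.
have mG : measurable_fun setT G.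
  by apply: (measurable_fun_cvg (h := F)) => // n; case: (sF n).
have GF n p : (N <= n)%N -> (N' <= n)%N -> `|G p - F n p| <= C * 2^-1 ^+ n * bx z0 s p.
  move=> Nn N'n; rewrite FE// -mulrBl normrM (ger0_norm (bx_ge0 z0 s p)).
  have [h|h] := pselect (box z0 s p); last by rewrite bx_out// !mulr0.
  rewrite ler_wpM2r ?bx_ge0//; have [hc c1] := hC p h.
  have c : `|U m p - U n p| @[m --> \oo] --> `|avg_lim u p - U n p|.
    exact: cvg_norm (cvgB c1 (cvg_cst _)).
  apply: (cvgr_to_le c).
  by exists n => // m /= nm; exact: hc.
pose n0 := maxn N N'.
have sG : sqi G.
  have sB : sqi (fun p => G p - F n0 p).
    apply: (sqi_le _ (sqiZ (C * 2^-1 ^+ n0) (sqi_bx z0 s))).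
      by apply: measurable_funB => //; case: (sF n0).
    move=> p; apply: (le_trans (GF n0 p (leq_maxl _ _) (leq_maxr _ _))); exact: ler_norm.
  by have := sqiD sB (sF n0); congr sqi; apply/funext => p; rewrite subrK.
pose H p := G p - uh p * bx z0 s p.
have sH : sqi H by apply: sqiB => //; exact: sqi_bxM suh.1.
have H0 : pint (fun p => H p ^+ 2) = 0.
  apply/eqP; rewrite eq_le; apply/andP; split; last by apply: pint_ge0 => p; exact: sqr_ge0.
  apply/ler_addgt0Pr => x x0; rewrite add0r.
  have [d d0 hd] := (mollify_strong suh).2 (x / 4) ltac:(lra).
  (* The uniform error contributes C^2 4^-n times the area 4 s^2; since 4^-n <= 2^-n, it suffices
     that 2^-n be below this bound. *)
  have y0 : 0 < x / 4 / (C ^+ 2 * (4 * s ^+ 2) + 1).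
    by apply: divr_gt0; [lra|rewrite ltr_wpDl// mulr_ge0 ?sqr_ge0// mulr_ge0// sqr_ge0].
  have [N1 hN1] := halfpow_small y0; have [N2 hN2] := halfpow_small d0.
  pose n := maxn n0 (maxn N1 N2).
  have nN : (N <= n)%N by rewrite /n /n0 !leq_max leqnn.
  have nN' : (N' <= n)%N by rewrite /n /n0 !leq_max leqnn orbT.
  have nN1 : (N1 <= n)%N by rewrite /n !leq_max leqnn orbT.
  have nN2 : (N2 <= n)%N by rewrite /n !leq_max leqnn !orbT.
  have sB : sqi (fun p => G p - F n p) by exact: sqiB.
  have sB' : sqi (fun p => F n p - uh p * bx z0 s p) by apply: sqiB => //; exact: sqi_bxM suh.1.
  have -> : pint (fun p => H p ^+ 2) = pint (fun p => ((G p - F n p) + (F n p - uh p * bx z0 s p)) ^+ 2).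
    by apply: pint_ext => p; rewrite addrA subrK.
  apply: (le_trans (pint_sqrD sB sB')).
  have h1 : pint (fun p => (G p - F n p) ^+ 2) <= x / 4.
    apply: (@le_trans _ _ (pint (fun p => (C * 2^-1 ^+ n) ^+ 2 * bx z0 s p))).
      apply: pint_le => [||p]; [by case: sB|by apply: pintegrableZ; exact: pintegrable_bx|].
      have := GF n p nN nN'; have [h|h] := pselect (box z0 s p).
        rewrite bx_in// !mulr1 -[in X in _ -> X]real_normK ?num_real// => h'.
        by rewrite lerXn2r ?nnegrE//; exact: le_trans h'.
      by rewrite bx_out// !mulr0 normr_le0 => /eqP ->; rewrite expr0n.
    rewrite (pintZ _ (pintegrable_bx _ _)) (pint_bx _ (ltW s0)) exprMn -mulrA mulrCA.
    have hn := hN1 n nN1.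
    have hn1 : 2^-1 ^+ n <= 1 :> R by rewrite exprn_ile1 ?invr_ge0// invf_le1// ler1n.
    move: hn; rewrite ltr_pdivlMr; last by rewrite ltr_wpDl// mulr_ge0 ?sqr_ge0// mulr_ge0// sqr_ge0.
    have := h0 n; move: hn1; have : 0 <= C ^+ 2 * (4 * s ^+ 2) by rewrite mulr_ge0 ?sqr_ge0// mulr_ge0// sqr_ge0.
    move: (C ^+ 2 * (4 * s ^+ 2)) (2^-1 ^+ n) => a b a0 b1 b0 hn.
    have h : b ^+ 2 * a <= b * a by rewrite ler_wpM2r// expr2 ler_piMr// ltW.
    have aux (c1 c2 c3 : R) : c1 <= c3 -> c3 + b < c2 -> 0 < b -> c1 <= c2.
      by move=> h1 h2 h3; apply: (le_trans h1); apply: le_trans (ltW h2); rewrite lerDl ltW.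
    by apply: aux h _ b0; move: hn; rewrite mulrDr mulr1.
  have h2 : pint (fun p => (F n p - uh p * bx z0 s p) ^+ 2) <= x / 4.
    have [M _ kM] := @mol_kern R.
    have sc : sqi (fun p => conv (mol (2^-1 ^+ n)) uh p - uh p).
      exact: sqiB (conv_sqic (kM _ (h0 n)) suh).1 suh.1.
    apply: le_trans (hd _ (h0 n) (hN2 n nN2)); apply: pint_le => [||p]; [by case: sB'|by case: sc|].
    by rewrite /F -mulrBl exprMn ler_piMr ?sqr_ge0// [bx _ _ _ ^+ 2]expr2 bx_idem bx_le1.
  have aux (a b : R) : a <= x / 4 -> b <= x / 4 -> 2 * a + 2 * b <= x by lra.
  exact: aux h1 h2.
have := pint_eq0_ae sH.2 (fun p => sqr_ge0 (H p)) H0.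
apply: filterS => p /eqP; rewrite sqrf_eq0 subr_eq0 => /eqP + ps.
by rewrite /G /uh !bx_in ?mulr1//; have [p1 p2] := ps; split; [apply: (lt_trans p1)|apply: (lt_trans p2)]; rewrite ltrDl.
Qed.

End local.

End limit.

(** * Local estimates and the Lipschitz representative on an open set *)

Section regularity.
Context {R : realType}.
Local Notation mu2 := ((@lebesgue_measure R) \x (@lebesgue_measure R))%E.
Local Notation e1 := ((1, 0) : R * R).
Local Notation e2 := ((0, 1) : R * R).
Implicit Types (D : set (R * R)) (u v f g : R * R -> R) (p z w : R * R) (e r s c A : R).

Lemma open_box D z : open D -> D z -> exists2 r, 0 < r & box z r `<=` D.
Proof.
move=> oD Dz; have /nbhs_ballP[r /= r0 rD] : nbhs z D by exact: open_nbhs_nbhs.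
exists r => // p [p1 p2]; apply: rD; split; rewrite /ball /= distrC//.
Qed.

(** The Lindelof argument: countably many rational squares suffice, so the exceptional sets form a
    countable union. *)
Lemma ae_local D (P : R * R -> Prop) :
  (forall z, D z -> exists2 s, 0 < s & {ae mu2, forall p, box z s p -> P p}) ->
  {ae mu2, forall p, D p -> P p}.
Proof.
move=> loc.
pose B (c : rat * rat * nat) : set (R * R) := box (ratr c.1.1, ratr c.1.2) c.2.+1%:R^-1.
(* The hypothesis inside [Q] selects the squares on which [P] holds almost everywhere, so that one
   statement can be quantified over all codes. *)
pose Q (n : nat) p := if unpickle n is Some c then
  {ae mu2, forall p, B c p -> P p} -> B c p -> P p else True.
have : {ae mu2, forall p, forall n, Q n p}.
  apply: (@ae_foralln _ (measurableTypeR R * measurableTypeR R)%type R mu2 (fun n p => Q n p)) => n; rewrite /Q; case: (unpickle n) => [c|]; last exact: aeW.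
  have [h|h] := pselect {ae mu2, forall p, B c p -> P p}.
    by apply: filterS h => p hp _.
  by apply: aeW => p /h.
apply: filterS => p hp Dp; have [s s0 hs] := loc p Dp.
(* Then 2/(k+1) < s, so a square of radius 1/(k+1) whose centre is that close to p lies inside
   [box p s]. *)
pose k := Num.truncn (2 / s).
have ks : 2 * k.+1%:R^-1 < s.
  have := truncnS_gt (2 / s); rewrite -/k ltr_pdivrMr// => h.
  by rewrite ltr_pdivrMr// mulrC.
have k0 : 0 < k.+1%:R^-1 :> R by rewrite invr_gt0.
have rq (x : R) : exists q : rat, `|x - ratr q| < k.+1%:R^-1.
  move: k0; move: (k.+1%:R^-1) => y y0.
  have [q hq] := @rat_in_itvoo R (x - y) (x + y) ltac:(lra).
  exists q; move: hq; rewrite in_itv /= => /andP[h1 h2].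
  by rewrite ltr_norml; apply/andP; split; move: (ratr q) h1 h2 => t; lra.
have [q1 h1] := rq p.1; have [q2 h2] := rq p.2.
have := hp (pickle (q1, q2, k)); rewrite /Q pickleK; apply; last by split.
apply: filterS hs => w hw wB; apply: hw; move: w wB.
apply: box_subset => /=; rewrite distrC; move: h1 h2 ks; move: (k.+1%:R^-1) => y; clear; lra.
Qed.

Lemma lipschitz_of_hopf D u v ux uy vx vy F1 F2 (M H al : R) :
  open D -> sqi u -> sqi v -> sqi ux -> sqi uy -> sqi vx -> sqi vy ->
  wderiv e1 D u ux -> wderiv e2 D u uy -> wderiv e1 D v vx -> wderiv e2 D v vy ->
  0 <= M -> 0 <= H -> 0 < al ->
  {ae mu2, forall p, D p -> (ux p - vy p) ^+ 2 + (vx p + uy p) ^+ 2 <=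
     (ux p + vy p) ^+ 2 + (vx p - uy p) ^+ 2} ->
  {ae mu2, forall p, D p ->
    F1 p = (ux p + vy p) * (ux p - vy p) + (vx p - uy p) * (vx p + uy p) /\
    F2 p = (vx p - uy p) * (ux p - vy p) - (ux p + vy p) * (vx p + uy p)} ->
  (forall p, D p -> F1 p ^+ 2 + F2 p ^+ 2 <= M ^+ 2) ->
  (forall p q r, D p -> D q -> box q r p -> (F1 p - F1 q) ^+ 2 + (F2 p - F2 q) ^+ 2 <= H * r `^ al) ->
  {ae mu2, forall p, D p -> avg_lim u p = u p /\ avg_lim v p = v p} /\
  forall z, D z -> exists s L : R, [/\ 0 < s, 0 <= L & forall p q, box z s p -> box z s q ->
    `|avg_lim u p - avg_lim u q| + `|avg_lim v p - avg_lim v q| <= L * (`|p.1 - q.1| + `|p.2 - q.2|)].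
Proof.
move=> oD su sv sux suy svx svy hux huy hvx hvy M0 H0 al0 aJ aF bF hF.
pose a1 p := ux p + vy p; pose a2 p := vx p - uy p.
pose b1 p := ux p - vy p; pose b2 p := vx p + uy p.
have sa1 : sqi a1 by exact: sqiD. have sa2 : sqi a2 by exact: sqiB.
have sb1 : sqi b1 by exact: sqiB. have sb2 : sqi b2 by exact: sqiD.
have sp e r z : 0 < e -> e <= r -> cbox z r `<=` D -> 
  conv (rad_kern (kP (qk e r))) a1 z =
    conv (rad_kern (kS1 (qk e r))) b1 z + conv (rad_kern (kS2 (qk e r))) (fun p => - b2 p) z /\
  conv (rad_kern (kP (qk e r))) a2 z =
    conv (rad_kern (kS1 (qk e r))) b2 z + conv (rad_kern (kS2 (qk e r))) b1 z.
  move=> e0 er zD; have r0 : 0 < r by exact: lt_le_trans er.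
  have [h1 h2] := weak_cauchy_riemann (@smooth_qk R e r) r0 (fun t => @qk_out R e r t e0 er)
    sux suy svx svy hux huy hvx hvy zD.
  split; last exact: h2.
  apply: (etrans h1); congr (_ + _); rewrite /conv /rad_kern.
  have [C kC] := kern_shift r0 (continuous_kS2 (@smooth_qk R e r))
    (csupp_kS2 (@smooth_qk R e r) r0 (fun t => @qk_out R e r t e0 er)).
  by rewrite -(pintN (sqi_mul sb2 (kern_sqi kC z))); apply: pint_ext => w; rewrite mulNr.
have sp1 : singular_pair D a1 b1 (fun p => - b2 p) by move=> e r z e0 er zD; exact: (sp e r z e0 er zD).1.
have sp2 : singular_pair D a2 b2 b1 by move=> e r z e0 er zD; exact: (sp e r z e0 er zD).2.
(* From |b|^4 <= |a|^2 |b|^2 = |F|^2 <= M^2; the first inequality is the sign of the Jacobian. *)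
have bM : {ae mu2, forall p, D p -> b1 p ^+ 2 + b2 p ^+ 2 <= M}.
  apply: filterS2 aJ aF => p hJ hf Dp; have := hJ Dp; have [E1 E2] := hf Dp; have := bF p Dp.
  rewrite E1 E2 -/(a1 p) -/(a2 p) -/(b1 p) -/(b2 p).
  move: (a1 p) (a2 p) (b1 p) (b2 p) => x1 x2 y1 y2 h1 h2.
  have y0 : 0 <= y1 ^+ 2 + y2 ^+ 2 by rewrite addr_ge0// sqr_ge0.
  rewrite -(ler_sqr (x := y1 ^+ 2 + y2 ^+ 2)) ?nnegrE//; apply: le_trans h1.
  have -> : (x1 * y1 + x2 * y2) ^+ 2 + (x2 * y1 - x1 * y2) ^+ 2 =
     (x1 ^+ 2 + x2 ^+ 2) * (y1 ^+ 2 + y2 ^+ 2) by ring.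
  by rewrite expr2 ler_wpM2r.
pose G := pint (fun p => a1 p ^+ 2) + pint (fun p => a2 p ^+ 2).
have G0 : 0 <= G by apply: addr_ge0; apply: pint_ge0 => p; exact: sqr_ge0.
have loc z0 : D z0 -> exists s V : R, [/\ 0 < s, 0 <= V,
    forall z, box z0 s z -> box z s `<=` D,
    forall z r, box z0 s z -> 0 < r -> r <= s -> nrmL ux z r + nrmL uy z r <= V * r ^+ 2 &
    forall z r, box z0 s z -> 0 < r -> r <= s -> nrmL vx z r + nrmL vy z r <= V * r ^+ 2].
  move=> Dz0; have [d d0 dD] := open_box oD Dz0.
  (* Half the available distance, so that squares of radius s about every centre in [box z0 s] stay
     inside [D]. *)
  pose s := d / 2; have s0 : 0 < s by rewrite divr_gt0.
  have [V V0 hV] := @gradient_morrey R M H al s G M0 H0 al0 s0 G0.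
  have zD z : box z0 s z -> box z s `<=` D.
    move=> [z1 z2] w wz; apply: dD; move: w wz; apply: box_subset; rewrite /s in z1 z2 *; lra.
  have mor z r : box z0 s z -> 0 < r -> r <= s -> nrmL a1 z r + nrmL a2 z r <= V * r ^+ 2.
    move=> zs r0 rs; apply: (hV D a1 a2 b1 b2 F1 F2 z sa1 sa2 sb1 sb2 sp1 sp2 bM aF _ (zD z zs) (lexx _) r r0 rs).
    move=> t p ts pz; apply: hF => //; apply: (zD z zs); last first.
      by rewrite /box /= !subrr normr0.
    by move: p pz; apply: box_subset; rewrite subrr normr0 add0r.
  (* Half of |a|^2 + |b|^2 is |Du|^2 + |Dv|^2, and |b| <= |a| bounds it by |a|^2, whose means are
     controlled. *)
  have dom f g z r : sqi f -> sqi g -> (forall p, f p ^+ 2 + g p ^+ 2 <= 2^-1 *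
      ((a1 p ^+ 2 + a2 p ^+ 2) + (b1 p ^+ 2 + b2 p ^+ 2))) ->
      box z0 s z -> 0 < r -> r <= s -> nrmL f z r + nrmL g z r <= V * r ^+ 2.
    move=> sf sg fg zs r0 rs; apply: le_trans (mor z r zs r0 rs).
    have zr : box z r `<=` D.
      move=> w wz; apply: (zD z zs); move: w wz; apply: box_subset; by rewrite subrr normr0 add0r.
    have := @nrmL2_le_ae R D f g a1 a2 z r 1 0 (sqi_lsqi sf) (sqi_lsqi sg) (sqi_lsqi sa1) (sqi_lsqi sa2) (ltW r0) zr.
    rewrite mul1r mul0r addr0; apply; apply: filterS aJ => p hJ Dp _; rewrite mul1r addr0.
    apply: (le_trans (fg p)); have := hJ Dp; rewrite -/(a1 p) -/(a2 p) -/(b1 p) -/(b2 p).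
    by move: (a1 p ^+ 2 + a2 p ^+ 2) (b1 p ^+ 2 + b2 p ^+ 2) => x y; clear; lra.
  exists s, V; split => //.
    move=> z r; apply: dom => // p; rewrite /a1 /a2 /b1 /b2.
    have := sqr_ge0 (vx p); have := sqr_ge0 (vy p).
    by move: (ux p) (uy p) (vx p) (vy p) => x1 x2 x3 x4; clear; lra.
  move=> z r; apply: dom => // p; rewrite /a1 /a2 /b1 /b2.
  have := sqr_ge0 (ux p); have := sqr_ge0 (uy p).
  by move: (ux p) (uy p) (vx p) (vy p) => x1 x2 x3 x4; clear; lra.
split.
  apply: ae_local => z Dz; have [s [V [s0 V0 zD hu hv]]] := loc z Dz; exists s => //.
  have h1 := avg_lim_ae su sux suy hux huy s0 s0 V0 zD hu.
  have h2 := avg_lim_ae sv svx svy hvx hvy s0 s0 V0 zD hv.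
  by apply: filterS2 h1 h2 => p h1 h2 ps; split; [exact: h1|exact: h2].
move=> z Dz; have [s [V [s0 V0 zD hu hv]]] := loc z Dz.
have [L L0 hL] := avg_lim_lipschitz su sux suy hux huy s0 V0 zD hu.
have [L' L'0 hL'] := avg_lim_lipschitz sv svx svy hvx hvy s0 V0 zD hv.
exists s, (L + L'); split => // [|p q ps qs]; first exact: addr_ge0.
by rewrite mulrDl; apply: lerD; [exact: hL|exact: hL'].
Qed.

End regularity.

(** * Transfer to the complex plane *)

Section complex_plane.
Context {R : realType}.
Local Notation mu2 := ((@lebesgue_measure R) \x (@lebesgue_measure R))%E.
Implicit Types (Omega : set (C R)) (f g h hx hy : C R -> C R) (z w : C R) (p q : R * R).

Lemma complexP z w : complex.Re (z : R[i]%C) = complex.Re (w : R[i]%C) ->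
  complex.Im (z : R[i]%C) = complex.Im (w : R[i]%C) -> z = w.
Proof. by case: z w => [a b] [c d] /= -> ->. Qed.

Lemma cmodE z : cmod z = Num.sqrt (complex.Re (z : R[i]%C) ^+ 2 + complex.Im (z : R[i]%C) ^+ 2).
Proof. by rewrite /cmod normc_def. Qed.

Lemma cmod_sqr z : cmod z ^+ 2 = complex.Re (z : R[i]%C) ^+ 2 + complex.Im (z : R[i]%C) ^+ 2.
Proof. by rewrite cmodE sqr_sqrtr// addr_ge0// sqr_ge0. Qed.

Lemma cmod_ge0 z : 0 <= cmod z.
Proof. by rewrite cmodE sqrtr_ge0. Qed.

Lemma norm_cmod z : `|z| = ((cmod z)%:C)%C.
Proof. by rewrite cmodE -normc_def. Qed.

Lemma cmod_le_sum z : cmod z <= `|complex.Re (z : R[i]%C)| + `|complex.Im (z : R[i]%C)|.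
Proof.
rewrite -ler_sqr ?nnegrE ?cmod_ge0 ?addr_ge0// cmod_sqr.
rewrite -(real_normK (num_real (complex.Re (z : R[i]%C)))) -(real_normK (num_real (complex.Im (z : R[i]%C)))).
have := mulr_ge0 (normr_ge0 (complex.Re (z : R[i]%C))) (normr_ge0 (complex.Im (z : R[i]%C))).
by move: `|_| `|_| => a b; nra.
Qed.

Lemma Re_le_cmod z : `|complex.Re (z : R[i]%C)| <= cmod z.
Proof.
by rewrite -ler_sqr ?nnegrE ?cmod_ge0// cmod_sqr real_normK ?num_real// lerDl sqr_ge0.
Qed.

Lemma Im_le_cmod z : `|complex.Im (z : R[i]%C)| <= cmod z.
Proof.
by rewrite -ler_sqr ?nnegrE ?cmod_ge0// cmod_sqr real_normK ?num_real// lerDr sqr_ge0.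
Qed.

Definition ofC z : R * R := (complex.Re (z : R[i]%C), complex.Im (z : R[i]%C)).

Lemma ofCK z : toC (ofC z) = z.
Proof. by case: z. Qed.

Lemma cball_plane z (r : R) : 0 < r -> nbhs z [set w | box (ofC z) r (ofC w)].
Proof.
move=> r0; apply/nbhs_ballP; exists ((r%:C)%C : C R); first by rewrite /= ltcE /= eqxx.
move=> w; rewrite /ball /= -[X in X < _]/(`|z - w|) norm_cmod ltcE /= eqxx /= => zw.
split; rewrite distrC; apply: le_lt_trans zw.
  by have := Re_le_cmod (z - w); case: (z) (w) => [a b] [c d].
by have := Im_le_cmod (z - w); case: (z) (w) => [a b] [c d].
Qed.

Lemma open_plane Omega : open Omega -> open (plane Omega).
Proof.
move=> oO; rewrite openE => p Op.
have /nbhs_ballP[e /= e0 eO] : nbhs (toC p) Omega by exact: open_nbhs_nbhs.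
have := e0; rewrite ltcE /= => /andP[/eqP eI eR].
apply/nbhs_ballP; exists (complex.Re (e : R[i]%C) / 2); first by rewrite /= divr_gt0.
move=> q [q1 q2]; apply: eO; rewrite /ball /= -[X in X < _]/(`|toC p - toC q|) norm_cmod ltcE /= eI eqxx /=.
move: q1 q2; rewrite /ball /= => q1 q2.
apply: (le_lt_trans (cmod_le_sum _)); rewrite [ltRHS]splitr.
exact: ltrD q1 q2.
Qed.

Section derivatives.
Variables (hx hy : C R -> C R) (p : R * R).
Let ux := reC hx p. Let vx := imC hx p. Let uy := reC hy p. Let vy := imC hy p.

Let half (a b c d : R) : (((a +i* b) + (c +i* d)) / 2 = ((a + c) / 2 +i* ((b + d) / 2)) :> C R)%C.
Proof.
have n2 : (2 : C R) != 0 by rewrite pnatr_eq0.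
apply: (mulIf n2); rewrite divfK//.
have -> : (2 : C R) = (2 +i* 0)%C by apply: complexP; rewrite /= ?addr0.
by apply: complexP; rewrite /= ?mulr0 ?addr0 ?add0r ?subr0; field.
Qed.

Lemma d_zE : d_z hx hy (toC p) = (((ux + vy) / 2) +i* ((vx - uy) / 2))%C.
Proof.
have -> : d_z hx hy (toC p) = (((ux +i* vx) + (vy +i* (- uy))) / 2)%C; last exact: half.
rewrite /d_z; congr (_ / _); rewrite /ux /vx /uy /vy /reC /imC.
by apply: complexP; case: (hx _) (hy _) => [a b] [c d]; rewrite /= ?mul0r ?mul1r ?sub0r ?add0r ?opprK.
Qed.

Lemma d_zbarE : d_zbar hx hy (toC p) = (((ux - vy) / 2) +i* ((vx + uy) / 2))%C.
Proof.
have -> : d_zbar hx hy (toC p) = (((ux +i* vx) + ((- vy) +i* uy)) / 2)%C; last exact: half.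
rewrite /d_zbar; congr (_ / _); rewrite /ux /vx /uy /vy /reC /imC.
by apply: complexP; case: (hx _) (hy _) => [a b] [c d]; rewrite /= ?mul0r ?mul1r ?sub0r ?add0r.
Qed.

Lemma jacobian_detE : jacobian_det hx hy (toC p) =
  (((ux + vy) ^+ 2 + (vx - uy) ^+ 2) - ((ux - vy) ^+ 2 + (vx + uy) ^+ 2)) / 4.
Proof. by rewrite /jacobian_det d_zE d_zbarE !cmod_sqr /=; field. Qed.

Lemma hopfE : hopf hx hy (toC p) =
  ((((ux + vy) * (ux - vy) + (vx - uy) * (vx + uy)) / 4) +i*
   (((vx - uy) * (ux - vy) - (ux + vy) * (vx + uy)) / 4))%C.
Proof. by rewrite /hopf d_zE d_zbarE; apply: complexP => /=; field. Qed.

End derivatives.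

End complex_plane.

(** * From the complex hypotheses to real functions on the plane *)

Section transfer.
Context {R : realType}.
Local Notation mu2 := ((@lebesgue_measure R) \x (@lebesgue_measure R))%E.
Implicit Types (Omega : set (C R)) (f g h hx hy : C R -> C R) (z w : C R) (p q : R * R).

Lemma patchD (D : set (R * R)) (u : R * R -> R) p : D p -> (u \_ D) p = u p.
Proof. by move=> Dp; rewrite patchE mem_set. Qed.

Lemma L2_sqi Omega f : open Omega -> L2 Omega f ->
  sqi (reC f \_ (plane Omega)) /\ sqi (imC f \_ (plane Omega)).
Proof.
move=> oO [mr mi fi]; have oD := open_plane oO; set D := plane Omega in mr mi fi oD *.
have mD : measurable D by exact: open_measurable2.
pose U := reC f \_ D; pose V := imC f \_ D.
have mU : measurable_fun setT U by apply/(measurable_restrictT _ mD).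
have mV : measurable_fun setT V by apply/(measurable_restrictT _ mD).
have iUV : pintegrable (fun p => U p ^+ 2 + V p ^+ 2).
  apply/integrableP; split.
    by apply/measurable_EFinP; apply: measurable_funD; exact: measurable_funX.
  move: fi; rewrite integral_mkcond; apply: le_lt_trans; rewrite le_eqVlt; apply/orP; left; apply/eqP.
  apply: eq_integral => p _; rewrite /= ger0_norm ?addr_ge0 ?sqr_ge0// patchE /U /V !patchE.
  by case: ifP => _; rewrite ?cmod_sqr// expr0n addr0.
split; split => //.
  apply: (pintegrable_le _ iUV); first exact: measurable_funX.
  by move=> p; rewrite !ger0_norm ?addr_ge0 ?sqr_ge0// lerDl sqr_ge0.
apply: (pintegrable_le _ iUV); first exact: measurable_funX.
by move=> p; rewrite !ger0_norm ?addr_ge0 ?sqr_ge0// lerDr sqr_ge0.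
Qed.

Lemma weak_deriv_wderiv v (D : set (R * R)) (u g : R * R -> R) :
  weak_deriv v D u g -> wderiv v D (u \_ D) (g \_ D).
Proof.
move=> h phi tphi; have := h phi tphi.
have K (k : R * R -> R) : \int[mu2]_(p in D) k p = pint (k \_ D) by exact: Rintegral_mkcond.
have E (k k' : R * R -> R) : (fun p => k p * k' p) \_ D = (fun p => (k \_ D) p * k' p).
  by apply/funext => p; rewrite !patchE; case: ifP => _; rewrite ?mul0r.
by rewrite !K !E.
Qed.

(** Restates the Hoelder bound on sup-norm squares, where |p - q| <= 2 r, for 4 times the Hopf
    product. The bound is on squares, which doubles the exponent. *)
Lemma hoelder_box (Phi : C R -> C R) (al L r : R) (p q : R * R) : 0 < al -> 
  cmod (Phi (toC p) - Phi (toC q)) <= L * cmod (toC p - toC q) `^ al -> box q r p ->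
  (4 * reC Phi p - 4 * reC Phi q) ^+ 2 + (4 * imC Phi p - 4 * imC Phi q) ^+ 2 <=
  16 * L ^+ 2 * (2 `^ al) ^+ 2 * r `^ (al * 2).
Proof.
move=> al0 h [p1 p2]; have r0 : 0 < r by apply: le_lt_trans p1.
have -> : (4 * reC Phi p - 4 * reC Phi q) ^+ 2 + (4 * imC Phi p - 4 * imC Phi q) ^+ 2 =
    16 * cmod (Phi (toC p) - Phi (toC q)) ^+ 2.
  rewrite cmod_sqr /reC /imC; case: (Phi _) (Phi _) => [a b] [c d] /=; ring.
have -> : r `^ (al * 2) = (r `^ al) ^+ 2 by rewrite -powR_mulrn ?powR_ge0// -powRrM.
have -> : 16 * L ^+ 2 * (2 `^ al) ^+ 2 * (r `^ al) ^+ 2 = 16 * (L * (2 `^ al * r `^ al)) ^+ 2 by ring.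
rewrite ler_wpM2l// -powRM//; last exact: ltW.
set x := cmod _ in h; set y := (cmod _ `^ al) in h.
have y0 : 0 <= y by exact: powR_ge0.
have x0 : 0 <= x by exact: cmod_ge0.
have yr : y <= (2 * r) `^ al.
  apply: ge0_ler_powR; [exact: ltW|by rewrite nnegrE cmod_ge0|by rewrite nnegrE mulr_ge0// ltW|].
  apply: (le_trans (cmod_le_sum _)); rewrite mulr2n mulrDl mul1r; apply: lerD; exact: ltW.
apply: (@le_trans _ _ ((L * y) ^+ 2)); first by rewrite lerXn2r// nnegrE (le_trans x0).
by rewrite !exprMn ler_wpM2l ?sqr_ge0// lerXn2r ?nnegrE ?powR_ge0.
Qed.

Lemma lipschitz_on_box f z (s L : R) : 0 < s -> 0 <= L ->
  (forall w w', box (ofC z) s (ofC w) -> box (ofC z) s (ofC w') ->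
    cmod (f w - f w') <= L * cmod (w - w')) ->
  [lipschitz f w | w in [set w | box (ofC z) s (ofC w)]].
Proof.
move=> s0 L0 h; exists ((L%:C)%C : C R); split.
  by apply: ger0_real; rewrite lecE /= eqxx.
move=> M LM [w w'] [ws ws'] /=.
apply: (@le_trans _ _ (((L * cmod (w - w'))%:C)%C : C R)).
  by rewrite norm_cmod lecR; exact: h.
by rewrite rmorphM /= norm_cmod ler_wpM2r ?(ltW LM)// lecR cmod_ge0.
Qed.

Lemma lipschitz_regularity Omega h hx hy : domain Omega -> W12 Omega h hx hy ->
  ae_in Omega (fun z => 0 <= jacobian_det hx hy z) ->
  (exists2 Phi : C R -> C R, ae_eq_in Omega Phi (hopf hx hy) &
    [bounded Phi z | z in Omega] /\ hoelder_in Omega Phi) ->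
  exists2 f : C R -> C R, ae_eq_in Omega f h & locally_lipschitz Omega f.
Proof.
move=> [_ oO _] [l0 lx ly [hx1 hx2] [hy1 hy2]] aJ [Phi aPhi [[M0 [M0r bM0]] [al [L [al0 al1 hPhi]]]]].
rewrite /ae_in in aJ; rewrite /ae_eq_in /ae_in in aPhi.
pose D := plane Omega; have oD : open D := open_plane oO.
have [su sv] := L2_sqi oO l0; have [sux svx] := L2_sqi oO lx; have [suy svy] := L2_sqi oO ly.
(* Boundedness provides a bound by every number above M0; M0 + 1 is one, and 4 is the ratio of phi
   to the Hopf product. *)
pose M := 4 * `|complex.Re (M0 + 1 : R[i]%C)|.
have M0' : 0 <= M by rewrite mulr_ge0.
pose F1 p := 4 * reC Phi p; pose F2 p := 4 * imC Phi p.
have bF p : D p -> F1 p ^+ 2 + F2 p ^+ 2 <= M ^+ 2.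
  move=> Dp; have := bM0 (M0 + 1) ltac:(by rewrite ltrDl) _ Dp.
  rewrite /= norm_cmod lecE /= => /andP[_ h1].
  have -> : F1 p ^+ 2 + F2 p ^+ 2 = 16 * cmod (Phi (toC p)) ^+ 2.
    by rewrite cmod_sqr /F1 /F2 /reC /imC; ring.
  have -> : M ^+ 2 = 16 * `|complex.Re (M0 + 1 : R[i]%C)| ^+ 2 by rewrite /M; ring.
  rewrite ler_wpM2l// lerXn2r ?nnegrE ?cmod_ge0//.
  apply: (le_trans h1); exact: ler_norm.
have aJ' : {ae mu2, forall p, D p ->
   ((reC hx \_ D) p - (imC hy \_ D) p) ^+ 2 + ((imC hx \_ D) p + (reC hy \_ D) p) ^+ 2 <=
   ((reC hx \_ D) p + (imC hy \_ D) p) ^+ 2 + ((imC hx \_ D) p - (reC hy \_ D) p) ^+ 2}.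
  apply: filterS aJ => p hJ Dp; have := hJ Dp.
  by rewrite jacobian_detE !patchD// pmulr_lge0 ?invr_gt0// subr_ge0.
have aF : {ae mu2, forall p, D p ->
   F1 p = ((reC hx \_ D) p + (imC hy \_ D) p) * ((reC hx \_ D) p - (imC hy \_ D) p) +
          ((imC hx \_ D) p - (reC hy \_ D) p) * ((imC hx \_ D) p + (reC hy \_ D) p) /\
   F2 p = ((imC hx \_ D) p - (reC hy \_ D) p) * ((reC hx \_ D) p - (imC hy \_ D) p) -
          ((reC hx \_ D) p + (imC hy \_ D) p) * ((imC hx \_ D) p + (reC hy \_ D) p)}.
  apply: filterS aPhi => p hp Dp; rewrite !patchD// /F1 /F2 {1}/reC {5}/imC (hp Dp) hopfE /=.
  by split; rewrite mulrC divfK.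
have hF p q r : D p -> D q -> box q r p ->
    (F1 p - F1 q) ^+ 2 + (F2 p - F2 q) ^+ 2 <= 16 * L ^+ 2 * (2 `^ al) ^+ 2 * r `^ (al * 2).
  by move=> Dp Dq; apply: hoelder_box => //; exact: hPhi.
have H0 : 0 <= 16 * L ^+ 2 * (2 `^ al) ^+ 2.
  by apply: mulr_ge0; [rewrite mulr_ge0// sqr_ge0|exact: sqr_ge0].
have al20 : 0 < al * 2 by rewrite mulr_gt0.
have [ae_uv lip] := lipschitz_of_hopf oD su sv sux suy svx svy (weak_deriv_wderiv hx1) (weak_deriv_wderiv hy1)
  (weak_deriv_wderiv hx2) (weak_deriv_wderiv hy2) M0' H0 al20 aJ' aF bF hF.
pose f z : C R := (avg_lim (reC h \_ D) (ofC z) +i* avg_lim (imC h \_ D) (ofC z))%C.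
exists f.
  rewrite /ae_eq_in /ae_in; apply: filterS ae_uv => p hp Dp; have [h1 h2] := hp Dp.
  have E : ofC (toC p) = p by case: (p).
  by apply: complexP; rewrite /= E ?h1 ?h2 patchD.
move=> z Oz; have Dz : D (ofC z) by rewrite /D /plane /= ofCK.
have [s [L' [s0 L'0 hL']]] := lip _ Dz.
exists [set w | box (ofC z) s (ofC w)]; first exact: cball_plane.
(* The factor 2 passes from the sum of the coordinate differences to the modulus. *)
have := @lipschitz_on_box f z s (2 * L') s0 ltac:(by rewrite mulr_ge0).
move=> H; apply: sub_lipschitz (H _).
  by move=> A hA [w w'] [[w1 _] [w2 _]]; exact: (hA (w, w')).
move=> w w' ws ws'; apply: (le_trans (cmod_le_sum _)).
have := hL' _ _ ws ws'; rewrite /= => h1; apply: (le_trans h1).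
rewrite [2 * _]mulrC -mulrA ler_wpM2l// mulr2n mulrDl mul1r; apply: lerD.
  by have := Re_le_cmod (w - w'); case: (w) (w') => [a b] [c d].
by have := Im_le_cmod (w - w'); case: (w) (w') => [a b] [c d].
Qed.

End transfer.

(** * The folding map *)

Section fold.
Context {R : realType}.
Local Notation mu2 := ((@lebesgue_measure R) \x (@lebesgue_measure R))%E.
Local Notation e1 := ((1, 0) : R * R).
Local Notation e2 := ((0, 1) : R * R).
Implicit Types (p q : R * R) (z w : C R).

Definition square : set (C R) := [set z | box 0 1 (ofC z)].

Definition fold z : C R := (`|complex.Re (z : R[i]%C)| +i* 0)%C.

Definition sg (x : R) : R := if 0 <= x then 1 else -1.

Definition fold_x z : C R := (sg (complex.Re (z : R[i]%C)) +i* 0)%C.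

Lemma ofC_toC p : ofC (toC p) = p.
Proof. by case: p. Qed.

Lemma plane_square : plane square = box 0 1.
Proof. by apply/seteqP; split => p; rewrite /plane /square /= ofC_toC. Qed.

Lemma square_domain : domain square.
Proof.
have s0 : square 0 by rewrite /square /box /= !subrr normr0.
split; first by exists 0.
- rewrite openE => z [z1 z2].
  pose r := Num.min (1 - `|complex.Re (z : R[i]%C)|) (1 - `|complex.Im (z : R[i]%C)|).
  rewrite /= !subr0 in z1 z2.
  have r0 : 0 < r by rewrite lt_min !subr_gt0 z1 z2.
  apply: filterS (cball_plane z r0) => w; rewrite /square /=; apply: box_subset; rewrite /= subr0.
    have : r <= 1 - `|complex.Re (z : R[i]%C)| by rewrite ge_min lexx.
    by lra.
  have : r <= 1 - `|complex.Im (z : R[i]%C)| by rewrite ge_min lexx orbT.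
  by lra.
(* The square is star-shaped: it is the union of the segments from 0, all of which contain 0. *)
- pose seg z : set (C R) := (fun t : R => (t%:C)%C * z) @` `[0, 1].
  have -> : square = \bigcup_(z in square) seg z.
    apply/seteqP; split => [z sz|w [z [z1 z2] [t]]].
      by exists z => //; exists 1; rewrite /= ?in_itv /= ?ler01 ?lexx// mul1r.
    rewrite /= in_itv /= => /andP[t0 t1] <-.
    rewrite /= !subr0 in z1 z2.
    case: z z1 z2 => [a b] /= z1 z2; rewrite /square /box /= !subr0 !mul0r subr0 addr0 !normrM ger0_norm//.
    by split; [apply: le_lt_trans z1|apply: le_lt_trans z2]; rewrite ler_piMl.
  apply: bigcup_connected.
    by exists 0 => z sz; exists 0; rewrite /= ?in_itv /= ?ler01 ?lexx// mul0r.
  move=> z sz; apply: connected_continuous_connected; first exact: segment_connected.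
  apply: continuous_subspaceT => t; apply/cvgrPdist_lt => /= e e0.
  have := e0; rewrite ltcE /= => /andP[/eqP eI eR].
  have c0 : 0 < cmod z + 1 by have := cmod_ge0 z; lra.
  have d0 : 0 < complex.Re (e : R[i]%C) / (cmod z + 1) by exact: divr_gt0.
  apply/nbhs_ballP; exists (complex.Re (e : R[i]%C) / (cmod z + 1)) => // s; rewrite /ball /= => hs; rewrite -mulrBl -rmorphB /= normrM normc_def /= expr0n addr0 sqrtr_sqr norm_cmod.
  rewrite ltcE /= eI !mulr0 !mul0r addr0 eqxx subr0 /=.
  move: hs; rewrite ltr_pdivlMr// => hs; apply: le_lt_trans hs.
  by rewrite ler_wpM2l// lerDl.
Qed.

Lemma measurable_sg : measurable_fun setT sg.
Proof.
apply: measurable_fun_ifT; [exact: measurable_fun_ler|exact: measurable_cst|exact: measurable_cst].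
Qed.

Lemma L2_square (f : C R -> C R) (k : R * R -> R) : measurable_fun setT k ->
  (forall p, box 0 1 p -> `|k p| <= 1) -> (forall p, f (toC p) = (k p +i* 0)%C) -> L2 square f.
Proof.
move=> mk k1 fk.
have Rf : reC f = k by apply/funext => p; rewrite /reC fk.
have If : imC f = fun=> 0 by apply/funext => p; rewrite /imC fk.
split; rewrite ?plane_square ?Rf ?If; [exact: measurable_funTS|exact: measurable_cst|].
have ip : pintegrable (fun p => (k p * bx 0 1 p) ^+ 2).
  have sb : sqi (fun p => k p * bx 0 1 p).
    apply: (sqi_le _ (sqi_bx 0 1)).
      by apply: measurable_funM => //; exact: measurable_bx.
    move=> p; rewrite normrM; have [h|h] := pselect (box 0 1 p); last by rewrite bx_out// normr0 mulr0.
    by rewrite bx_in// normr1 mulr1 k1.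
  by have [_] := sb.
have /integrableP[_ hi] := ip.
rewrite integral_mkcond; apply: le_lt_trans hi; rewrite le_eqVlt; apply/orP; left; apply/eqP.
apply: eq_integral => p _; rewrite /= ger0_norm ?sqr_ge0// patchE.
case: ifPn => [/set_mem h|/negP h].
  by rewrite cmod_sqr fk /= expr0n addr0 bx_in// mulr1.
by rewrite bx_out ?mulr0 ?expr0n// => /mem_set.
Qed.

Lemma test_function_box (phi : R * R -> R) : test_function (box 0 1) phi ->
  (forall k, Ck k setT phi) /\ (bsupp phi 1 /\ forall v, bsupp ('D_v phi) 1).
Proof.
move=> [cphi [K [cK KD K0]]]; split => //; split => [p np|v p np].
  by apply: K0 => /KD.
apply: (derive_out v (K := K)) => // [|/KD//].
by apply: compact_closed => //; exact: norm_hausdorff.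
Qed.

Lemma continuous_absfst : continuous (fun p : R * R => `|p.1|).
Proof. by move=> p; apply: continuous_comp; [exact: cvg_fst|exact: norm_continuous]. Qed.

(** The boundary term of the half-line is f(0), assumed to be zero; this is what lets a kink on the
    line x = 0 pass unnoticed by integration by parts. *)
Lemma integral_half (f df : R -> R) (B : R) : 0 < B -> f 0 = 0 ->
  (forall x : R, is_derive x 1 f (df x)) -> continuous df ->
  (forall x, B <= `|x| -> f x = 0) -> (forall x, B <= `|x| -> df x = 0) ->
  (\int[@lebesgue_measure R]_x (df x * (if 0 <= x then 1 else 0))%:E = 0)%E.
Proof.
move=> B0 f00 fdf cdf f0 df0.
have -> : (\int[@lebesgue_measure R]_x (df x * (if 0 <= x then 1 else 0))%:E =
    \int[@lebesgue_measure R]_(x in `[0%R, B]) (df x)%:E)%E.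
  rewrite [RHS]integral_mkcond; apply: eq_integral => x _.
  rewrite patchE; case: (leP 0 x) => x0.
    rewrite mulr1; case: ifPn => //; rewrite notin_setE /= in_itv /= x0 /= => /negP.
    by rewrite -ltNge => xB; rewrite df0// ger0_norm// ltW.
  rewrite mulr0; case: ifPn => // xI; have := set_mem xI.
  by rewrite /= in_itv /= leNgt x0.
have cf : continuous f.
  by move=> x; apply: differentiable_continuous; apply/derivable1_diffP; case: (fdf x).
rewrite (@continuous_FTC2 _ df f); first 1 last.
- by [].
- exact: continuous_subspaceT.
- split.
  + by move=> x _; case: (fdf x).
  + by apply: cvg_at_right_filter; exact: cf.
  + by apply: cvg_at_left_filter; exact: cf.
- by move=> x _; rewrite derive1E; case: (fdf x).
by rewrite f00 f0 ?ger0_norm ?(ltW B0)// subee.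
Qed.

(** Two continuous functions that differ at a point differ on a square around it, which has positive
    measure. *)
Lemma continuous_eq_ae (D : set (R * R)) (u v : R * R -> R) : open D ->
  (forall p, D p -> {for p, continuous u}) -> (forall p, D p -> {for p, continuous v}) ->
  {ae mu2, forall p, D p -> u p = v p} -> forall p, D p -> u p = v p.
Proof.
move=> oD cu cv uv p Dp; apply: contrapT => /eqP; rewrite -subr_eq0 => np.
have /cvgr_neq0 : (fun q => u q - v q) @ p --> u p - v p by apply: cvgB; [exact: cu|exact: cv].
move=> /(_ np) /nbhs_ballP[s /= s0 hs].
have [r r0 rD] := open_box oD Dp.
pose t := Num.min s r; have t0 : 0 < t by rewrite lt_min s0 r0.
have : pint (bx p t) = pint (fun=> 0).
  apply: pint_ae; [exact: measurable_bx|exact: measurable_cst|].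
  apply: filterS uv => q uvq; have [[h1 h2]|h] := pselect (box p t q); last by rewrite bx_out.
  have [ts tr] : t <= s /\ t <= r by rewrite /t !ge_min !lexx orbT.
  have /hs : ball p s q by split; rewrite /ball /= distrC; [exact: lt_le_trans ts|exact: lt_le_trans ts].
  have Dq : D q by apply: rD; split; [exact: lt_le_trans tr|exact: lt_le_trans tr].
  by rewrite /= (uvq Dq) subrr eqxx.
rewrite pint0 pint_bx; last exact: ltW.
by move=> /eqP; rewrite gt_eqF// mulr_gt0// exprn_gt0.
Qed.

(* The integrand is [sg * F = 2 F 1_(x >= 0) - F] for [F = d/dx (x phi)], and
   [x phi] vanishes on the line x = 0. *)
Lemma fold_weak_x (phi : R * R -> R) : test_function (box 0 1) phi ->
  pint (fun p => `|p.1| * 'D_e1 phi p) = - pint (fun p => sg p.1 * phi p).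
Proof.
move=> /test_function_box[cphi [sphi sD]].
have dphi p := Ck_is_derive1 p (cphi 1%N).
have cD : continuous ('D_e1 phi) := Ck_continuous (Ck_d1 (cphi 1%N)).
have c0 : continuous phi := Ck_continuous (cphi 0%N).
have cfst : continuous (fun p : R * R => p.1) by move=> p; exact: cvg_fst.
pose F p := phi p + p.1 * 'D_e1 phi p.
have dU p : is_derive p e1 (fun w : R * R => w.1 * phi w) (F p).
  have hf := is_derive_fst p e1 0.
  have h := is_deriveM hf (dphi p).
  rewrite (_ : (fun w : R * R => w.1 * phi w) = (fun w : R * R => w.1 - 0) \* phi); last by apply/funext => w; rewrite /= subr0.
  by apply: (is_derive_eq h); rewrite /GRing.scale /= subr0 mulr1 addrC.
have cF : continuous F.
  by move=> p; apply: cvgD; [exact: c0|apply: cvgM; [exact: cfst|exact: cD]].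
have sF : bsupp F 1 by move=> p np; rewrite /F sphi// (sD _ p np) mulr0 addr0.
have sU : bsupp (fun w : R * R => w.1 * phi w) 1 by move=> p np; rewrite sphi// mulr0.
have iF : pintegrable F := continuous_bsupp_integrable cF sF ler01.
pose hv (x : R) : R := if 0 <= x then 1 else 0.
have mhv : measurable_fun setT (fun p : R * R => hv p.1).
  apply: measurable_fun_ifT; [|exact: measurable_cst|exact: measurable_cst].
  by apply: measurable_fun_ler => //; exact: measurable_cst.
have iFh : pintegrable (fun p => F p * hv p.1).
  apply: (pintegrable_le _ (pintegrable_norm iF)); first by apply: measurable_funM => //; exact: pintegrable_measurable.
  by move=> p; rewrite /hv; case: ifP => _; rewrite ?mulr1// mulr0 normr0.
have E1 : pint F = 0 := pint_derive1 ltr01 dU cF sU sF.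
have E2 : pint (fun p => F p * hv p.1) = 0.
  rewrite pint_fubini21// integral0_eq// => y _.
  apply: (@integral_half (fun x => x * phi (x, y)) (fun x => F (x, y)) 1) => //.
  - by rewrite mul0r.
  - move=> x; have /is_derive_dirP h := dU (x, y).
    have d1 : is_derive x 1 (fun t : R => t - x) 1.
      have := is_deriveB (is_derive_id x (1 : R)) (is_derive_cst x x (1 : R)).
      by rewrite subr0.
    have h' : is_derive ((fun t : R => t - x) x) 1
       (fun t : R => (t *: e1 + (x, y)).1 * phi (t *: e1 + (x, y))) (F (x, y)) by rewrite subrr.
    have := @is_derive1_comp _ (fun t : R => (t *: e1 + (x, y)).1 * phi (t *: e1 + (x, y))) (fun t => t - x) x _ _ h' d1; rewrite mulr1; congr is_derive; apply/funext => t.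
    have E (s : R) : s *: e1 + (x, y) = (s + x, y).
      by congr pair; rewrite /GRing.scale /= ?[_%:A]mulr1 ?scaler0 ?add0r.
    by rewrite /= E /= [_%:A]mulr1 subrK.
  - exact: continuous_sec1.
  - by move=> x Bx; apply: (sU (x, y)) => -[]; rewrite /= subr0 ltNge Bx.
  - by move=> x Bx; apply: (sF (x, y)) => -[]; rewrite /= subr0 ltNge Bx.
have i1 : pintegrable (fun p => `|p.1| * 'D_e1 phi p).
  apply: (continuous_bsupp_integrable (B := 1)) => //.
    by move=> p; apply: cvgM; [exact: continuous_absfst|exact: cD].
  by move=> p np; rewrite (sD _ p np) mulr0.
have i2 : pintegrable (fun p => sg p.1 * phi p).
  apply: (pintegrable_le _ (pintegrable_norm (continuous_bsupp_integrable c0 sphi ler01))).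
    apply: measurable_funM; last exact: continuous_measurable2.
    by apply: measurableT_comp => //; exact: measurable_sg.
  by move=> p; rewrite normrM /sg; case: ifP => _; rewrite ?normrN normr1 mul1r.
apply/eqP; rewrite -addr_eq0 -(pintD i1 i2); apply/eqP.
have -> : (fun p => `|p.1| * 'D_e1 phi p + sg p.1 * phi p) = (fun p => 2 * (F p * hv p.1) - F p).
  apply/funext => p; rewrite /F /sg /hv; case: leP => h.
    by rewrite ger0_norm//; ring.
  by rewrite ltr0_norm//; ring.
by rewrite (pintB (pintegrableZ 2 iFh) iF) (pintZ 2 iFh) E1 E2 mulr0 subrr.
Qed.

Lemma fold_weak_y (phi : R * R -> R) : test_function (box 0 1) phi ->
  pint (fun p => `|p.1| * 'D_e2 phi p) = 0.
Proof.
move=> /test_function_box[cphi [sphi sD]].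
have dphi p := Ck_is_derive2 p (cphi 1%N).
have cD : continuous ('D_e2 phi) := Ck_continuous (Ck_d2 (cphi 1%N)).
apply: (@pint_derive2 _ (fun p => `|p.1| * phi p) _ 1) => //.
- move=> p; have d0 : is_derive p e2 (fun w : R * R => `|w.1|) 0.
    apply: (@is_derive_quad _ _ _ _ _ _ 0) => h.
    have -> : (h *: e2 + p).1 = p.1 by rewrite /= [_ *: 0]mulr0 add0r.
    by rewrite subrr mulr0 subr0 normr0 mul0r.
  by apply: (is_derive_eq (is_deriveM d0 (dphi p))); rewrite scaler0 addr0.
- by move=> p; apply: cvgM; [exact: continuous_absfst|exact: cD].
- by move=> p np; rewrite sphi// mulr0.
- by move=> p np; rewrite (sD _ p np) mulr0.
Qed.

End fold.

(** * The folding map satisfies the hypotheses and is not of class C^1 *)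

Section counterexample.
Context {R : realType}.
Local Notation mu2 := ((@lebesgue_measure R) \x (@lebesgue_measure R))%E.
Local Notation e1 := ((1, 0) : R * R).
Local Notation e2 := ((0, 1) : R * R).
Implicit Types (p q : R * R).

Let zero : C R -> C R := fun=> (0 +i* 0)%C.

Lemma fold_W12 : W12 square (@fold R) fold_x zero.
Proof.
have mfst : measurable_fun setT (fun p : R * R => p.1) by exact: measurable_fst.
have Rint (k : R * R -> R) : (forall p, ~ box 0 1 p -> k p = 0) ->
    \int[mu2]_(p in plane square) k p = pint k.
  move=> k0; rewrite plane_square.
  have -> : \int[mu2]_(p in box 0 1) k p = pint (k \_ (box 0 1)) by exact: Rintegral_mkcond.
  apply: pint_ext => p; rewrite patchE; case: ifPn => // /negP h.
  by rewrite k0// => /mem_set.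
have Z v : weak_deriv v (plane (@square R)) (fun=> 0) (fun=> 0).
  move=> phi _; rewrite !Rint; [|by move=> p _; rewrite mul0r..].
  have E (k : R * R -> R) : pint (fun p => 0 * k p) = 0.
    by rewrite -[RHS](@pint0 R); apply: pint_ext => p; rewrite mul0r.
  by rewrite !E oppr0.
have I0 : imC (@fold R) = fun=> 0 by apply/funext => p.
have Ix : imC (@fold_x R) = fun=> 0 by apply/funext => p.
have Iy : imC zero = fun=> 0 by apply/funext => p.
have Ry : reC zero = fun=> 0 by apply/funext => p.
split; rewrite ?I0 ?Ix ?Iy ?Ry.
- apply: (L2_square (k := fun p => `|p.1|)) => //; first exact: measurableT_comp.
  by move=> p [p1 _]; rewrite normr_id; have := p1; rewrite subr0; exact: ltW.
- apply: (L2_square (k := fun p => sg p.1)) => //.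
    by apply: measurableT_comp => //; exact: measurable_sg.
  by move=> p _; rewrite /sg; case: ifP => _; rewrite ?normrN normr1.
- by apply: (L2_square (k := fun=> 0)) => // p _; rewrite normr0.
- split; last exact: Z.
  rewrite plane_square => phi tphi; have [_ [sphi sD]] := test_function_box tphi.
  rewrite -plane_square !Rint; [|by move=> p np; rewrite sphi ?mulr0|by move=> p np; rewrite (sD _ p np) mulr0].
  exact: fold_weak_x.
- split; last exact: Z.
  rewrite plane_square => phi tphi; have [_ [sphi sD]] := test_function_box tphi.
  rewrite -plane_square !Rint; [|by move=> p np; rewrite mul0r|by move=> p np; rewrite (sD _ p np) mulr0].
  have E : pint (fun p => 0 * phi p) = 0.
    by rewrite -[RHS](@pint0 R); apply: pint_ext => p; rewrite mul0r.
  by rewrite E oppr0; exact: fold_weak_y.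
Qed.

(** The difference quotients along the x-axis are 1 and -1 on the two sides, and no limit is within
    distance less than 1 of both. *)
Lemma abs_not_derivable (u : R * R -> R) : (forall p, box 0 1 p -> u p = `|p.1|) ->
  ~ derivable u (0 : R * R) e1.
Proof.
move=> uE /derivableP /is_derive_dirP [/derivableP d _].
have [/= + _] := d; rewrite /derivable => /cvg_ex[/= l /cvgrPdist_lt /(_ 1 ltr01)].
move=> /nbhs_ballP[r /= r0 hr].
pose t := Num.min r 1 / 2.
have m0 : 0 < Num.min r 1 by rewrite lt_min r0 ltr01.
have [mr m1] : Num.min r 1 <= r /\ Num.min r 1 <= 1 by rewrite !ge_min !lexx orbT.
have t0 : 0 < t by rewrite divr_gt0.
have tr : t < r by rewrite /t; lra.
have t1 : t < 1 by rewrite /t; lra.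
have uh (s : R) : `|s| < 1 -> u (s *: e1 + 0) = `|s|.
  move=> s1; have E : s *: e1 + 0 = (s, 0) :> R * R.
    by congr pair; rewrite /GRing.scale /= ?[_%:A]mulr1 ?[_ *: 0]mulr0 addr0.
  by rewrite E uE//; split; rewrite /= subr0 ?normr0.
have key (s : R) : s != 0 -> `|s| = t -> `|l - s^-1 * t| < 1.
  move=> s0 st; have := hr s; rewrite /ball /= sub0r normrN st => /(_ tr s0).
  congr (`|l - _| < 1); rewrite /GRing.scale /=; congr (_ * _).
  transitivity (u (s *: e1 + 0) - u (0 *: e1 + 0)); first by rewrite mulr1 (addr0 s).
  by rewrite !uh ?normr0 ?subr0 ?st.
have := key t; rewrite gt_eqF// gtr0_norm// mulVf ?gt_eqF// => /(_ isT erefl).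
have := key (- t); rewrite oppr_eq0 gt_eqF// normrN gtr0_norm// invrN mulNr mulVf ?gt_eqF// => /(_ isT erefl).
by rewrite !ltr_norml => /andP[h1 h2] /andP[h3 h4]; lra.
Qed.

Lemma fold_counterexample : exists (Omega : set (C R)) (h hx hy : C R -> C R),
  [/\ domain Omega, W12 Omega h hx hy,
      ae_in Omega (fun z => 0 <= jacobian_det hx hy z),
      (exists2 Phi : C R -> C R, ae_eq_in Omega Phi (hopf hx hy) &
        [bounded Phi z | z in Omega] /\ hoelder_in Omega Phi) &
      ~ (exists2 f : C R -> C R, ae_eq_in Omega f h & C1 Omega f)].
Proof.
exists square, (@fold R), fold_x, zero; split.
- exact: square_domain.
- exact: fold_W12.
- apply: aeW => p _; rewrite jacobian_detE /reC /imC /=.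
  by rewrite !(subr0, addr0) subrr mul0r.
- exists (fun=> (4^-1 +i* 0)%C).
    apply: aeW => p _; rewrite hopfE; apply: complexP; rewrite /reC /imC /= /sg.
      by case: ifP => _; field.
    by case: ifP => _; field.
  split.
    exists `|(4^-1 +i* 0)%C : C R|; split; first exact: normr_real.
    by move=> M hM z _ /=; exact: ltW.
  exists 1, 0; split => // z w _ _; rewrite subrr mul0r cmodE /= expr0n addr0 sqrtr0//.
(* A C^1 representative is continuous, so it agrees with |x| at every point of the square and
   inherits its kink at the origin. *)
- move=> [f fh [[cf df] _]]; rewrite plane_square in cf df.
  have E : forall p, box 0 1 p -> reC f p = `|p.1|.
    apply: (continuous_eq_ae (D := box 0 1)).
    + by rewrite -plane_square; apply: open_plane; case: (@square_domain R).
    + exact: cf.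
    + by move=> p _; exact: continuous_absfst.
    + move: fh; rewrite /ae_eq_in /ae_in; apply: filterS => p hp bp.
      by rewrite /reC hp//; rewrite plane_square.
  have [d _] := df e1 (or_introl erefl).
  apply: (abs_not_derivable E); apply: d.
  by split; rewrite subrr normr0.
Qed.

End counterexample.

Theorem theorem1p3 (R : realType) :
  (forall (Omega : set (C R)) (h hx hy : C R -> C R),
      domain Omega ->
      W12 Omega h hx hy ->
      ae_in Omega (fun z => 0 <= jacobian_det hx hy z) ->
      (exists2 Phi : C R -> C R, ae_eq_in Omega Phi (hopf hx hy) &
        [bounded Phi z | z in Omega] /\ hoelder_in Omega Phi) ->
      exists2 f : C R -> C R, ae_eq_in Omega f h & locally_lipschitz Omega f)
  /\
  (exists (Omega : set (C R)) (h hx hy : C R -> C R),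
      [/\ domain Omega,
          W12 Omega h hx hy,
          ae_in Omega (fun z => 0 <= jacobian_det hx hy z),
          (exists2 Phi : C R -> C R, ae_eq_in Omega Phi (hopf hx hy) &
            [bounded Phi z | z in Omega] /\ hoelder_in Omega Phi) &
          ~ (exists2 f : C R -> C R, ae_eq_in Omega f h & C1 Omega f)]).
Proof.
split; last exact: fold_counterexample.
exact: lipschitz_regularity.
Qed.
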